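(* Let $H$ be a finite-dimensional pivotal unimodular quasi-Hopf algebra over a field $\Bbbk$, with pivot $g$ and unit $\mathbf 1$. For $\lambda\in H^*$ let $\widehat\lambda\in H^*$ be defined by $\widehat\lambda(h)=\lambda(gh)$ for all $h\in H$. Then there is a one-to-one correspondence between right modified traces $\mathsf t_\bullet$ on the full subcategory $\mathrm{Proj}(H\text{-mod})$ of projective objects of $H\text{-mod}$ and right cointegrals $\lambda\in H^*$, given by $$\mathsf t_H(f)=\widehat\lambda\big(f(\mathbf 1)\big)\qquad\text{for all } f\in \mathrm{End}_H(H),$$ where $H$ is regarded as the left regular module. In particular, such traces exist and are unique up to scalar multiples. Every non-zero right modified trace $\mathsf t_\bullet$ on $\mathrm{Proj}(H\text{-mod})$ is non-degenerate.
   Context: **Quasi-Hopf algebras.** A quasi-Hopf algebra $H$ over a field $\Bbbk$ is a unital associative algebra (unit $\mathbf 1$) with algebra maps $\Delta:H\to H\otimes H$ and $\varepsilon:H\to\Bbbk$ ($\varepsilon$ a counit for $\Delta$), an invertible coassociator $\Phi=\Phi_1\otimes\Phi_2\otimes\Phi_3\in H^{\otimes 3}$ (sumless notation) with inverse $\Psi=\Phi^{-1}$, an algebra anti-automorphism $S$ and elements $\alpha,\beta\in H$, such that $(\Delta\otimes\mathrm{id})(\Delta(h))\,\Phi=\Phi\,(\mathrm{id}\otimes\Delta)(\Delta(h))$; $(\Delta\otimes\mathrm{id}\otimes\mathrm{id})(\Phi)\,(\mathrm{id}\otimes\mathrm{id}\otimes\Delta)(\Phi)=(\Phi\otimes\mathbf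 1)(\mathrm{id}\otimes\Delta\otimes\mathrm{id})(\Phi)(\mathbf 1\otimes\Phi)$; $(\mathrm{id}\otimes\varepsilon\otimes\mathrm{id})(\Phi)=\mathbf 1\otimes\mathbf 1$; $S(h_{(1)})\alpha h_{(2)}=\varepsilon(h)\alpha$; $h_{(1)}\beta S(h_{(2)})=\varepsilon(h)\beta$; $S(\Phi_1)\alpha\Phi_2\beta S(\Phi_3)=\mathbf 1=\Psi_1\beta S(\Psi_2)\alpha\Psi_3$. One assumes $\varepsilon(\alpha)=1=\varepsilon(\beta)$. For $x=x_1\otimes x_2\in H\otimes H$ put $x_{21}=x_2\otimes x_1$; $\Delta^{\rm cop}(h)=\Delta(h)_{21}$. **The category.** $H\text{-mod}$ is the category of finite-dimensional left $H$-modules, with action on tensor products via $\Delta$, tensor unit $\Bbbk$ with action via $\varepsilon$, and associator $U\otimes(V\otimes W)\to(U\otimes V)\otimes W$ given by acting with $\Phi$. The left dual $V^\vee$ is $V^*$ with $\langle h.v^*,w\rangle=\langle v^*,S(h)w\rangle$, left evaluation $\mathrm{ev}_V:V^\vee\otimes V\to\Bbbk$, $v^*\otimes v\mapsto\langle v^*,\alpha v\rangle$, and left coevaluation $\mathrm{coev}_V:\Bbbk\to V\otimes V^\vee$, $1\mapsto\sum_i\beta v_i\otimes v^i$ for dual bases $\{v_i\},\{v^i\}$. **Drinfeld twist.** $f\in H\otimes H$ is the invertible element such that the canonical isomorphism $\gamma_{W,V}:W^\vee\otimes V^\vee\to(V\otimes W)^\vee$ (the one for which $\mathrm{ev}_{V\otimes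 W}\circ(\gamma_{W,V}\otimes\mathrm{id})$ equals the nested evaluation $(W^\vee\otimes V^\vee)\otimes(V\otimes W)\to\Bbbk$ built from $\mathrm{ev}_V$, $\mathrm{ev}_W$ and associators/unitors) is $\gamma_{W,V}(\varphi\otimes\psi)(v\otimes w)=(\psi\otimes\varphi)(f_1v\otimes f_2w)$. It satisfies $f\Delta(S(a))f^{-1}=(S\otimes S)(\Delta^{\rm cop}(a))$. **Pivot.** $H$ is pivotal if it is equipped with an invertible element $g$ (the pivot) with $\Delta(g)=f^{-1}\cdot(S\otimes S)(f_{21})\cdot(g\otimes g)$ and $S^2(h)=ghg^{-1}$ for all $h$. Then $H\text{-mod}$ is pivotal with $\delta_V:V\to V^{\vee\vee}$, $\delta_V=\delta_V^{\rm Vect}\circ(g\cdot)$, where $\delta^{\rm Vect}$ is the canonical map to the bidual. Right evaluation and coevaluation are $\widetilde{\mathrm{ev}}_V=\mathrm{ev}_{V^\vee}\circ(\delta_V\otimes\mathrm{id}):V\otimes V^\vee\to\Bbbk$ and $\widetilde{\mathrm{coev}}_V=(\mathrm{id}\otimes\delta_V^{-1})\circ\mathrm{coev}_{V^\vee}:\Bbbk\to V^\vee\otimes V$. **Unimodularity and right cointegrals.** A left (right) integral is $\Lambda\in H$ with $h\Lambda=\varepsilon(h)\Lambda$ ($\Lambda h=\varepsilon(h)\Lambda$) for all $h$; these spaces are one-dimensional. The modulus is the algebra map $\gamma:H\to\Bbbk$ with $\Lambda h=\gamma(h)\Lambda$ for left integrals $\Lambda$. $H$ is unimodular if left and right integrals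 coincide, i.e. $\gamma=\varepsilon$. Put $q^L=S(\Phi_1)\alpha\Phi_2\otimes\Phi_3$, $p^L=\Psi_2S^{-1}(\Psi_1\beta)\otimes\Psi_3$, $\mathsf U^{\rm cop}=(S^{-1}\otimes S^{-1})(q^Lf^{-1})$, $\mathsf V^{\rm cop}=(S\otimes S)(p^L)\,f_{21}$. An element $\lambda\in H^*$ is a right cointegral if for all $h\in H$ $$(\mathrm{id}\otimes\lambda)\big(\mathsf V^{\rm cop}\Delta^{\rm cop}(h)\mathsf U^{\rm cop}\big)=\gamma(\Psi_3)\,\lambda(hS^{-1}(\Psi_2))\,\Psi_1 .$$ **Right modified traces.** For $k:A\otimes C\to B\otimes C$ the right partial trace is $\mathsf{tr}^r_C(k)=[A\cong A\otimes\Bbbk\xrightarrow{\mathrm{id}\otimes\mathrm{coev}_C}A\otimes(C\otimes C^\vee)\cong(A\otimes C)\otimes C^\vee\xrightarrow{k\otimes\mathrm{id}}(B\otimes C)\otimes C^\vee\cong B\otimes(C\otimes C^\vee)\xrightarrow{\mathrm{id}\otimes\widetilde{\mathrm{ev}}_C}B\otimes\Bbbk\cong B]$. A right modified trace on $\mathrm{Proj}(H\text{-mod})$ is a family of linear maps $\{\mathsf t_P:\mathrm{End}_H(P)\to\Bbbk\}_{P\text{ projective}}$ such that (cyclicity) $\mathsf t_P(b\circ a)=\mathsf t_{P'}(a\circ b)$ for all $a:P\to P'$, $b:P'\to P$ between projectives, and (right partial trace property) $\mathsf t_{P\otimes V}(k)=\mathsf t_P(\mathsf{tr}^r_V(k))$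 for all projective $P$, all $V\in H\text{-mod}$ and $k\in\mathrm{End}_H(P\otimes V)$. It is non-degenerate if the pairings $\mathrm{Hom}_H(M,P)\times\mathrm{Hom}_H(P,M)\to\Bbbk$, $(a,b)\mapsto\mathsf t_P(a\circ b)$, are non-degenerate for all $M\in H\text{-mod}$ and all projective $P$. *)

(* Defs.v *)
From HB Require Import structures.
From mathcomp Require Import all_boot all_order all_algebra.
From mathcomp Require Import falgebra.

Set Implicit Arguments.
Unset Strict Implicit.
Unset Printing Implicit Defensive.

Import GRing.Theory.
Local Open Scope ring_scope.

(* A coordinate model of the tensor product of finite-dimensional spaces: x i j *)
(* is the coefficient of b_i ⊗ b'_j in the standard bases.  The ring structure  *)
(* put on tens A B below is the tensor product algebra, not matrix algebra.     *)
Definition tens (K : fieldType) (U V : vectType K) :=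
  'M[K]_(\dim {:U}, \dim {:V}).

Section TensorSpace.
Variables (K : fieldType) (U V : vectType K).

HB.instance Definition _ := Vector.on (tens U V).

Definition pure (u : U) (v : V) : tens U V :=
  \matrix_(i, j) (coord (vbasis {:U}) i u * coord (vbasis {:V}) j v).

Lemma pure_linear u : linear (pure u).
Proof. by move=> a v w; apply/matrixP=> i j; rewrite !mxE linearP /= mulrDr mulrCA. Qed.
HB.instance Definition _ u :=
  GRing.isLinear.Build K V (tens U V) _ (pure u) (pure_linear u).

Lemma pureZr c u v : pure u (c *: v) = c *: pure u v.
Proof. exact: linearZ. Qed.

Lemma pureP a u u' v : pure (a *: u + u') v = a *: pure u v + pure u' v.
Proof. by apply/matrixP=> i j; rewrite !mxE linearP /= mulrDl mulrA. Qed.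
End TensorSpace.
Notation "u ⊗ v" := (pure u v) (at level 40, left associativity) : ring_scope.

Section TensorLift.
Variables (K : fieldType) (U V : vectType K).

(* Sumless notation: tlift (fun a b => F a b) x stands for F x_1 x_2.  It is    *)
(* basis-independent only when F is bilinear, as in every use below.            *)
Definition tlift (W : lmodType K) (B : U -> V -> W) (x : tens U V) : W :=
  \sum_i \sum_j x i j *: B (vbasis {:U})`_i (vbasis {:V})`_j.

Section W.
Variables (W : lmodType K).
Lemma tlift_linear (B : U -> V -> W) : linear (tlift B).
Proof.
move=> a x y; rewrite /tlift scaler_sumr -big_split /=; apply: eq_bigr => i _.
rewrite scaler_sumr -big_split /=; apply: eq_bigr => j _.
by rewrite !mxE scalerDl scalerA.
Qed.
HB.instance Definition _ B :=
  GRing.isLinear.Build K (tens U V) W _ (tlift B) (tlift_linear B).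

Lemma tliftE (B : U -> V -> W) u v :
    (forall v, linear (B^~ v)) -> (forall u, linear (B u)) ->
  tlift B (u ⊗ v) = B u v.
Proof.
move=> Bl Br; pose fl v : {linear U -> W} := HB.pack (B^~ v) (GRing.isLinear.Build _ _ _ _ _ (Bl v)).
pose fr u : {linear V -> W} := HB.pack (B u) (GRing.isLinear.Build _ _ _ _ _ (Br u)).
rewrite {2}(coord_vbasis (memvf u)) -[B _ _]/(fl v _) linear_sum.
apply: eq_bigr => i _; rewrite linearZ /= {2}(coord_vbasis (memvf v)).
rewrite -[B _ _]/(fr (vbasis _)`_i _) linear_sum scaler_sumr.
by apply: eq_bigr => j _; rewrite linearZ /= mxE scalerA.
Qed.

Lemma eq_tlift (B B' : U -> V -> W) : (forall u v, B u v = B' u v) ->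
  tlift B =1 tlift B'.
Proof.
by move=> e x; apply: eq_bigr => i _; apply: eq_bigr => j _; rewrite e.
Qed.

Lemma tliftP a (B B' : U -> V -> W) x :
  tlift (fun u v => a *: B u v + B' u v) x = a *: tlift B x + tlift B' x.
Proof.
rewrite /tlift scaler_sumr -big_split /=; apply: eq_bigr => i _.
rewrite scaler_sumr -big_split /=; apply: eq_bigr => j _.
by rewrite scalerDr !scalerA mulrC.
Qed.
End W.

Lemma linear_tlift (W W' : lmodType K) (f : {linear W -> W'}) B x :
  f (tlift B x) = tlift (fun u v => f (B u v)) x.
Proof.
rewrite linear_sum; apply: eq_bigr => i _.
by rewrite linear_sum; apply: eq_bigr => j _; rewrite linearZ.
Qed.

Lemma tlift_pure x : tlift (@pure K U V) x = x.
Proof.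
apply/matrixP=> i j; rewrite summxE (bigD1 i) //= summxE (bigD1 j) //= !mxE.
rewrite !coord_free ?(basis_free (vbasisP _)) // !eqxx !mulr1.
rewrite !big1 ?addr0 // => [i' ne|j' ne].
  rewrite summxE big1 // => j' _.
  by rewrite !mxE coord_free ?(basis_free (vbasisP _)) // (negPf ne) mul0r mulr0.
by rewrite !mxE [X in _ * (_ * X)]coord_free ?(basis_free (vbasisP _)) // (negPf ne) !mulr0.
Qed.

Lemma tens_ind (P : tens U V -> Prop) :
    (forall u v, P (u ⊗ v)) -> (forall x y, P x -> P y -> P (x + y)) ->
  forall x, P x.
Proof.
move=> Pp PD x; rewrite -(tlift_pure x).
have P0 : P 0 by have <- : (0 : U) ⊗ (0 : V) = 0 by exact: linear0.
rewrite /tlift; apply: (big_ind P) => // i _; apply: (big_ind P) => // j _.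
by rewrite -pureZr.
Qed.
End TensorLift.

Section TensorAlg.
Variables (K : fieldType) (A B : falgType K).
Definition tmul (x y : tens A B) : tens A B :=
  tlift (fun a b => tlift (fun a' b' => (a * a') ⊗ (b * b')) y) x.

Lemma tmul_linearr x : linear (tmul x).
Proof.
move=> c y y'; rewrite /tmul -tliftP; apply: eq_tlift => a b. exact: linearP. Qed.
Lemma tmul_linearl y : linear (tmul^~ y).
Proof. exact: tlift_linear. Qed.
Lemma tmulE a b a' b' : tmul (a ⊗ b) (a' ⊗ b') = (a * a') ⊗ (b * b').
Proof.
rewrite /tmul tliftE ?tliftE //.
- move=> v c u u'. by rewrite mulrDr -scalerAr pureP.
- move=> u c v v'. by rewrite mulrDr -scalerAr linearP.
- move=> v c u u'; rewrite -tliftP; apply: eq_tlift => ??.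
  by rewrite mulrDl -scalerAl pureP.
- move=> u c v v'; rewrite -tliftP; apply: eq_tlift => ??.
  by rewrite mulrDl -scalerAl linearP.
Qed.
Lemma tmulDl x y z : tmul (x + y) z = tmul x z + tmul y z.
Proof. by rewrite -[x]scale1r tmul_linearl !scale1r. Qed.
Lemma tmulDr x y z : tmul x (y + z) = tmul x y + tmul x z.
Proof. by rewrite -[y]scale1r tmul_linearr !scale1r. Qed.
Lemma tmulA : associative tmul.
Proof.
elim/tens_ind => [a b|x x' IH IH'] y z; last by rewrite !tmulDl IH IH'.
elim/tens_ind: y => [a' b'|y y' IH IH']; last by rewrite !(tmulDl, tmulDr) IH IH'.
elim/tens_ind: z => [a'' b''|z z' IH IH']; last by rewrite !tmulDr IH IH'.
by rewrite !tmulE !mulrA.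
Qed.
Lemma tmul1l : left_id (1 ⊗ 1) tmul.
Proof.
by elim/tens_ind => [a b|x y IH IH']; rewrite ?tmulDr ?IH ?IH' // tmulE !mul1r.
Qed.
Lemma tmul1r : right_id (1 ⊗ 1) tmul.
Proof.
by elim/tens_ind => [a b|x y IH IH']; rewrite ?tmulDl ?IH ?IH' // tmulE !mulr1.
Qed.

Lemma tens1_neq0 : 1 ⊗ 1 != 0 :> tens A B.
Proof.
have nz (C : falgType K) : exists i, coord (vbasis {:C}) i 1 != 0.
  apply/existsP; apply: contraNT (oner_neq0 C).
  rewrite negb_exists => /forallP z; apply/eqP.
  rewrite (coord_vbasis (memvf (1 : C))) big1 // => i _.
  by move/eqP: (negbNE (z i)) => ->; rewrite scale0r.
have [[i ni] [j nj]] := (nz A, nz B); apply/eqP => /matrixP/(_ i j)/eqP.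
by rewrite !mxE mulf_eq0 (negPf ni) (negPf nj).
Qed.

HB.instance Definition _ := GRing.Zmodule_isNzRing.Build (tens A B)
  tmulA tmul1l tmul1r tmulDl tmulDr tens1_neq0.

Fact tens_scaleAl c (x y : tens A B) : c *: (x * y) = c *: x * y.
Proof. by rewrite -[c *: x]addr0 -[RHS]/(tmul _ _) tmul_linearl [tmul 0 y]linear0 addr0. Qed.
HB.instance Definition _ := GRing.Lmodule_isLalgebra.Build K (tens A B) tens_scaleAl.
Fact tens_scaleAr c (x y : tens A B) : c *: (x * y) = x * (c *: y).
Proof.
have x0 : tmul x 0 = 0 by exact: mulr0.
by rewrite -[c *: y]addr0 -[RHS]/(tmul _ _) tmul_linearr x0 addr0.
Qed.
HB.instance Definition _ := GRing.Lalgebra_isAlgebra.Build K (tens A B) tens_scaleAr.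
HB.instance Definition _ := Algebra_isFalgebra.Build K (tens A B).

Lemma pureM (a a' : A) (b b' : B) : (a ⊗ b) * (a' ⊗ b') = (a * a') ⊗ (b * b').
Proof. exact: tmulE. Qed.
Lemma pure1 : 1 ⊗ 1 = 1 :> tens A B. Proof. by []. Qed.
End TensorAlg.

Section TensorMaps.
Variable K : fieldType.
Implicit Types U V W : vectType K.

Lemma pureDl U V (u u' : U) (v : V) : (u + u') ⊗ v = u ⊗ v + u' ⊗ v.
Proof. by have := pureP 1 u u' v; rewrite !scale1r. Qed.

Lemma pureZl U V c (u : U) (v : V) : (c *: u) ⊗ v = c *: (u ⊗ v).
Proof.
have z : (0 : U) ⊗ v = 0.
  by apply: (addrI ((0 : U) ⊗ v)); rewrite -pureDl !addr0.
by rewrite -[c *: u]addr0 pureP z addr0.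
Qed.

Lemma pure_suml U V I (r : seq I) (F : I -> U) (v : V) :
  (\sum_(i <- r) F i) ⊗ v = \sum_(i <- r) F i ⊗ v.
Proof.
elim: r => [|i r IH]; last by rewrite !big_cons pureDl IH.
by rewrite !big_nil -(scale0r 0) pureZl scale0r.
Qed.

Lemma pureDr U V (u : U) (v v' : V) : u ⊗ (v + v') = u ⊗ v + u ⊗ v'.
Proof. exact: linearD. Qed.

Lemma lfunPe U V (f : 'Hom(U, V)) c u v : f (c *: u + v) = c *: f u + f v.
Proof. exact: linearP. Qed.

Lemma lfunD U V (f : 'Hom(U, V)) u v : f (u + v) = f u + f v.
Proof. exact: linearD. Qed.

Lemma linfunE U V (f : U -> V) : linear f -> linfun f =1 f.
Proof.
move=> fl; pose g : {linear U -> V} :=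
  HB.pack f (GRing.isLinear.Build _ _ _ _ f fl).
exact: (lfunE g).
Qed.

Lemma lfunZ U V (f : 'Hom(U, V)) c u : f (c *: u) = c *: f u.
Proof. exact: linearZ. Qed.

Lemma tliftD U V (W : lmodType K) (F : U -> V -> W) x y :
  tlift F (x + y) = tlift F x + tlift F y.
Proof. exact: linearD. Qed.

Lemma tens_hom_ext U V W (f g : 'Hom(tens U V, W)) :
  (forall u v, f (u ⊗ v) = g (u ⊗ v)) -> f = g.
Proof.
by move=> e; apply/lfunP; elim/tens_ind => [//|x y IHx IHy]; rewrite !linearD /= IHx IHy.
Qed.

Definition tmap U V U' V' (f : 'Hom(U, U')) (g : 'Hom(V, V')) :
    'Hom(tens U V, tens U' V') :=
  linfun (tlift (fun u v => f u ⊗ g v)).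

Lemma tmapE U V U' V' (f : 'Hom(U, U')) (g : 'Hom(V, V')) u v :
  tmap f g (u ⊗ v) = f u ⊗ g v.
Proof.
rewrite lfunE /= tliftE // => [w|w] c a b; first by rewrite lfunPe pureP.
by rewrite lfunPe linearP.
Qed.

Lemma tmap_comp U V U' V' U2 V2 (f : 'Hom(U, U')) (g : 'Hom(V, V'))
    (f' : 'Hom(U', U2)) (g' : 'Hom(V', V2)) :
  tmap (f' \o f) (g' \o g) = (tmap f' g' \o tmap f g)%VF.
Proof. by apply: tens_hom_ext => u v; rewrite comp_lfunE !tmapE !comp_lfunE. Qed.

Lemma tmap_id U V : tmap \1 \1 = \1%VF :> 'End(tens U V).
Proof. by apply: tens_hom_ext => u v; rewrite tmapE !id_lfunE. Qed.

Definition tlift3 U V W (Z : lmodType K) (F : U -> V -> W -> Z)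
    (x : tens (tens U V) W) : Z :=
  tlift (fun uv w => tlift (fun u v => F u v w) uv) x.

Lemma tlift3_linear U V W (Z : lmodType K) (F : U -> V -> W -> Z) :
  linear (tlift3 F).
Proof. exact: tlift_linear. Qed.
HB.instance Definition _ U V W (Z : lmodType K) F :=
  GRing.isLinear.Build K (tens (tens U V) W) Z _ (tlift3 F) (tlift3_linear F).

Lemma tlift3E U V W (Z : lmodType K) (F : U -> V -> W -> Z) u v w :
    (forall v w, linear (fun u => F u v w)) ->
    (forall u w, linear (fun v => F u v w)) ->
    (forall u v, linear (F u v)) ->
  tlift3 F (u ⊗ v ⊗ w) = F u v w.
Proof.
move=> F1 F2 F3; rewrite /tlift3 !tliftE //.
- by move=> ? ? ? ?; rewrite linearP.
- by move=> uv c a b; rewrite -tliftP; apply: eq_tlift => ? ?; apply: F3.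
Qed.

Definition tassoc U V W : 'Hom(tens U (tens V W), tens (tens U V) W) :=
  linfun (tlift (fun u => tlift (fun v w => u ⊗ v ⊗ w))).

Definition tassocV U V W : 'Hom(tens (tens U V) W, tens U (tens V W)) :=
  linfun (tlift3 (fun u v w => u ⊗ (v ⊗ w))).

Lemma tassocE U V W (u : U) (v : V) (w : W) :
  tassoc U V W (u ⊗ (v ⊗ w)) = u ⊗ v ⊗ w.
Proof.
rewrite lfunE /= tliftE; first rewrite tliftE //.
- by move=> ? ? ? ?; rewrite linearP pureP.
- by move=> ? ? ? ?; rewrite linearP.
- by move=> ? ? ? ?; rewrite -tliftP; apply: eq_tlift => ? ?; rewrite !pureP.
- by move=> ? ? ? ?; rewrite linearP.
Qed.

Lemma tassocVE U V W (u : U) (v : V) (w : W) :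
  tassocV U V W (u ⊗ v ⊗ w) = u ⊗ (v ⊗ w).
Proof.
rewrite lfunE /= tlift3E //.
- by move=> ? ? ? ? ?; rewrite pureP.
- by move=> ? ? ? ? ?; rewrite pureP linearP.
- by move=> ? ? ? ? ?; rewrite !linearP.
Qed.

Lemma tassocK U V W : (tassocV U V W \o tassoc U V W = \1)%VF.
Proof.
apply: tens_hom_ext => u vw; elim/tens_ind: vw => [v w|x y IHx IHy].
  by rewrite comp_lfunE tassocE tassocVE id_lfunE.
by rewrite pureDr !linearD /= IHx IHy.
Qed.

Lemma tassocVK U V W : (tassoc U V W \o tassocV U V W = \1)%VF.
Proof.
apply: tens_hom_ext => uv w; elim/tens_ind: uv => [u v|x y IHx IHy].
  by rewrite comp_lfunE tassocVE tassocE id_lfunE.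
by rewrite pureDl !linearD /= IHx IHy.
Qed.

Definition tswap U V : tens U V -> tens V U := tlift (fun u v => v ⊗ u).

Lemma tswapE U V (u : U) (v : V) : tswap (u ⊗ v) = v ⊗ u.
Proof.
rewrite /tswap tliftE // => ? ? ? ?; by rewrite ?linearP ?pureP.
Qed.
End TensorMaps.

Record hmod (K : fieldType) (A : falgType K) := HMod {
  hcar :> vectType K;
  hact : {linear A -> 'End(hcar)};
  hact1 : hact 1 = \1%VF;
  hactM : forall a b, hact (a * b) = (hact a \o hact b)%VF }.

Section Modules.
Variables (K : fieldType) (A : falgType K).
Implicit Types M N P : hmod A.

Lemma hactP M a b c (v : M) : hact M (c *: a + b) v = c *: hact M a v + hact M b v.
Proof. by rewrite linearP /= add_lfunE scale_lfunE. Qed.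
Lemma hactME M a b (v : M) : hact M (a * b) v = hact M a (hact M b v).
Proof. by rewrite hactM comp_lfunE. Qed.
Lemma hact1E M (v : M) : hact M 1 v = v.
Proof. by rewrite hact1 id_lfunE. Qed.
Lemma hactDE M a b (v : M) : hact M (a + b) v = hact M a v + hact M b v.
Proof. by rewrite linearD /= add_lfunE. Qed.
Lemma hactZE M a c (v : M) : hact M (c *: a) v = c *: hact M a v.
Proof. by rewrite linearZ /= scale_lfunE. Qed.

Definition defect M N (h : A) (f : 'Hom(M, N)) : 'Hom(M, N) :=
  ((f \o hact M h) - (hact N h \o f))%VF.

Lemma defect_linear M N h : linear (@defect M N h).
Proof.
move=> c f f'; rewrite /defect comp_lfunDl comp_lfunDr -comp_lfunZl -comp_lfunZr.
by rewrite scalerBr opprD addrACA.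
Qed.
HB.instance Definition _ M N h :=
  GRing.isLinear.Build K 'Hom(M, N) 'Hom(M, N) _ (@defect M N h)
    (defect_linear h).

(* By linearity it suffices to commute with a basis of A; see intertwP. *)
Definition intertw M N : {vspace 'Hom(M, N)} :=
  (\bigcap_(i < \dim {:A}) lker (linfun (@defect M N (vbasis {:A})`_i)))%VS.

Lemma intertwP M N (f : 'Hom(M, N)) :
  reflect (forall h v, f (hact M h v) = hact N h (f v)) (f \in intertw M N).
Proof.
have e h : defect h f == 0 <-> forall v, f (hact M h v) = hact N h (f v).
  rewrite subr_eq0; split=> [/eqP/lfunP E v|E].
    by have := E v; rewrite !comp_lfunE.
  by apply/eqP/lfunP => v; rewrite !comp_lfunE.
apply: (iffP idP) => [/subv_bigcapP fI h v|fh].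
  rewrite (coord_vbasis (memvf h)) !linear_sum /= !sum_lfunE linear_sum.
  apply: eq_bigr => i _; rewrite !linearZ /= !scale_lfunE linearZ /=.
  congr (_ *: _); apply: (iffLR (e _)).
  by have := fI i isT; rewrite -memvE memv_ker lfunE.
apply/subv_bigcapP => i _; rewrite -memvE memv_ker lfunE /=.
exact/e.
Qed.

(* Hom_H(M, N), as a vector space. *)
Definition homH M N := subvs_of (intertw M N).
HB.instance Definition _ M N := Vector.on (homH M N).

Definition homf M N (f : homH M N) : 'Hom(M, N) := vsval f.

Definition MkHom M N (f : 'Hom(M, N))
    (fH : forall h v, f (hact M h v) = hact N h (f v)) : homH M N :=
  Subvs (introT (intertwP f) fH).

Lemma MkHomE M N (f : 'Hom(M, N)) fH : homf (@MkHom M N f fH) = f.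
Proof. by []. Qed.

Lemma homf_inj M N : injective (@homf M N).
Proof. exact: val_inj. Qed.

Lemma homfP M N (f : homH M N) h v :
  homf f (hact M h v) = hact N h (homf f v).
Proof. exact/intertwP/subvsP. Qed.

Fact idH_subproof M h v : \1%VF (hact M h v) = hact M h (\1%VF v).
Proof. by rewrite !id_lfunE. Qed.
Definition idH M : homH M M := MkHom (@idH_subproof M).

Fact compH_subproof M N P (g : homH N P) (f : homH M N) h v :
  (homf g \o homf f)%VF (hact M h v) = hact P h ((homf g \o homf f)%VF v).
Proof. by rewrite !comp_lfunE !homfP. Qed.
Definition compH M N P (g : homH N P) (f : homH M N) : homH M P :=
  MkHom (compH_subproof g f).

Definition projective P :=
  forall M N (e : homH M N) (f : homH P N),
    limg (homf e) = fullv -> exists f' : homH P M, compH e f' = f.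

Fact regmod_subproof1 : amull 1 = \1%VF :> 'End(A).
Proof. by apply/lfunP=> v; rewrite !lfunE /= mul1r. Qed.
Fact regmod_subproofM (a b : A) : amull (a * b) = (amull a \o amull b)%VF.
Proof. by apply/lfunP=> v; rewrite comp_lfunE !lfunE /= mulrA. Qed.
Definition regmod : hmod A := HMod regmod_subproof1 regmod_subproofM.

Lemma regactE (a : A) (b : regmod) : hact regmod a b = a * (b : A).
Proof. exact: lfunE. Qed.

Lemma projective_regmod : projective regmod.
Proof.
move=> M N e f e_surj.
have /memv_imgP[m _ em] : homf f 1 \in limg (homf e) by rewrite e_surj memvf.
have gl : linear (fun a : regmod => hact M a m) by move=> c a b; rewrite hactP.
pose g : 'Hom(regmod, M) := linfun (fun a : regmod => hact M a m).
have gE a : g a = hact M a m by rewrite [LHS]linfunE.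
have gH h v : g (hact regmod h v) = hact M h (g v).
  by rewrite regactE !gE hactME.
exists (MkHom gH); apply/homf_inj/lfunP => a.
rewrite MkHomE comp_lfunE MkHomE gE homfP -em -homfP regactE.
by rewrite mulr1.
Qed.
End Modules.
Coercion homf : homH >-> hom.

Section ModuleConstructions.
Variables (K : fieldType) (A B : falgType K).

Section Ext.
Variables (V : hmod A) (W : hmod B).
Definition extact (x : tens A B) : 'End(tens V W) :=
  tlift (fun a b => tmap (hact V a) (hact W b)) x.
Fact extact_linear : linear extact. Proof. exact: tlift_linear. Qed.
HB.instance Definition _ :=
  GRing.isLinear.Build K (tens A B) 'End(tens V W) _ extact extact_linear.

Lemma extactE a b v w : extact (a ⊗ b) (v ⊗ w) = hact V a v ⊗ hact W b w.
Proof.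
rewrite /extact tliftE ?tmapE // => ? ? ? ?; apply: tens_hom_ext => ? ?.
  by rewrite add_lfunE scale_lfunE !tmapE hactP pureP.
by rewrite add_lfunE scale_lfunE !tmapE hactP linearP.
Qed.

Lemma extactD x y v : extact (x + y) v = extact x v + extact y v.
Proof. by rewrite /extact tliftD add_lfunE. Qed.

Fact extact1 : extact 1 = \1%VF.
Proof.
by apply: tens_hom_ext => v w; rewrite extactE !hact1E id_lfunE.
Qed.
Fact extactM x y : extact (x * y) = (extact x \o extact y)%VF.
Proof.
elim/tens_ind: x => [a b|x x' IHx IHx']; last first.
  by rewrite mulrDl !linearD /= IHx IHx' comp_lfunDl.
elim/tens_ind: y => [a' b'|y y' IHy IHy']; last first.
  by rewrite mulrDr !linearD /= IHy IHy' comp_lfunDr.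
by apply: tens_hom_ext => v w; rewrite pureM comp_lfunE !extactE !hactME.
Qed.
Definition extmod : hmod (tens A B) := HMod extact1 extactM.
End Ext.

Section Pull.
Variables (phi : {lrmorphism A -> B}) (V : hmod B).
Definition pullact a := hact V (phi a).
Fact pullact_linear : linear pullact.
Proof. by move=> c a b; rewrite /pullact !linearP. Qed.
HB.instance Definition _ :=
  GRing.isLinear.Build K A 'End(V) _ pullact pullact_linear.
Fact pullact1 : pullact 1 = \1%VF.
Proof. by rewrite /pullact rmorph1 hact1. Qed.
Fact pullactM a b : pullact (a * b) = (pullact a \o pullact b)%VF.
Proof. by rewrite /pullact rmorphM hactM. Qed.
Definition pullmod : hmod A := HMod pullact1 pullactM.
End Pull.
End ModuleConstructions.

Section Sumless.
Variables (K : fieldType) (H : falgType K).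
Implicit Types (D : H -> tens H H) (e : H -> K).

(* D_id D = D ⊗ id, id_D_id D = id ⊗ D ⊗ id, etc., with the results rebracketed *)
(* to the left: H^{⊗3} is tens (tens H H) H and H^{⊗4} is                       *)
(* tens (tens (tens H H) H) H.                                                  *)
Definition D_id D (x : tens H H) : tens (tens H H) H :=
  tlift (fun a b => D a ⊗ b) x.

Definition id_D D (x : tens H H) : tens (tens H H) H :=
  tlift (fun a b => tlift (fun b1 b2 => a ⊗ b1 ⊗ b2) (D b)) x.

Definition D_id_id D (x : tens (tens H H) H) : tens (tens (tens H H) H) H :=
  tlift3 (fun a b c => D a ⊗ b ⊗ c) x.

Definition id_D_id D (x : tens (tens H H) H) : tens (tens (tens H H) H) H :=
  tlift3 (fun a b c => tlift (fun b1 b2 => a ⊗ b1 ⊗ b2 ⊗ c) (D b)) x.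

Definition id_id_D D (x : tens (tens H H) H) : tens (tens (tens H H) H) H :=
  tlift3 (fun a b c => tlift (fun c1 c2 => a ⊗ b ⊗ c1 ⊗ c2) (D c)) x.

Definition one_tens (x : tens (tens H H) H) : tens (tens (tens H H) H) H :=
  tlift3 (fun a b c => 1 ⊗ a ⊗ b ⊗ c) x.

Definition id_e_id e (x : tens (tens H H) H) : tens H H :=
  tlift3 (fun a b c => e b *: (a ⊗ c)) x.

Definition e_id e (x : tens H H) : H := tlift (fun a b => e a *: b) x.
Definition id_e e (x : tens H H) : H := tlift (fun a b => e b *: a) x.

Lemma D_idE (D : {linear H -> tens H H}) a b : D_id D (a ⊗ b) = D a ⊗ b.
Proof.
rewrite /D_id tliftE // => ? ? ? ?; first by rewrite linearP pureP.
by rewrite linearP.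
Qed.

Lemma id_DE (D : {linear H -> tens H H}) a b :
  id_D D (a ⊗ b) = tassoc H H H (a ⊗ D b).
Proof.
rewrite /id_D tliftE // => [|z c a1 a2|a' c z z']; last by rewrite !linearP.
  elim/tens_ind: (D b) => [b1 b2|x y IHx IHy]; last first.
    by rewrite tliftD pureDr lfunD IHx IHy.
  rewrite tassocE tliftE // => ? ? ? ?; first by rewrite linearP pureP.
  by rewrite linearP.
by rewrite -tliftP; apply: eq_tlift => ? ?; rewrite !pureP.
Qed.

Lemma e_idE (e : {linear H -> K^o}) a b : e_id e (a ⊗ b) = (e a : K) *: b.
Proof.
rewrite /e_id tliftE // => ? ? ? ?; last by rewrite linearP.
by rewrite linearP scalerDl scalerA.
Qed.

Lemma id_eE (e : {linear H -> K^o}) a b : id_e e (a ⊗ b) = (e b : K) *: a.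
Proof.
rewrite /id_e tliftE // => ? ? ? ?; first by rewrite linearP.
by rewrite linearP scalerDl scalerA.
Qed.

Lemma D_idD D x y : D_id D (x + y) = D_id D x + D_id D y.
Proof. exact: tliftD. Qed.
Lemma id_DD D x y : id_D D (x + y) = id_D D x + id_D D y.
Proof. exact: tliftD. Qed.
Lemma e_idD e x y : e_id e (x + y) = e_id e x + e_id e y.
Proof. exact: tliftD. Qed.
Lemma id_eD e x y : id_e e (x + y) = id_e e x + id_e e y.
Proof. exact: tliftD. Qed.
End Sumless.

(* Products in H^{⊗n} are those of the tensor product algebra, and Phi^-1 is    *)
(* the inverse in H^{⊗3}, written Ψ in the literature.                          *)
Record quasiHopf (K : fieldType) (H : falgType K) := QuasiHopf {
  Delta : {lrmorphism H -> tens H H};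
  eps : {lrmorphism H -> K^o};
  counitl : forall h, e_id eps (Delta h) = h;
  counitr : forall h, id_e eps (Delta h) = h;
  Phi : tens (tens H H) H;
  Phi_unit : Phi \is a GRing.unit;
  coassoc : forall h, D_id Delta (Delta h) * Phi = Phi * id_D Delta (Delta h);
  pentagon : D_id_id Delta Phi * id_id_D Delta Phi =
             Phi ⊗ 1 * id_D_id Delta Phi * one_tens Phi;
  Phi_counit : id_e_id eps Phi = 1 ⊗ 1;
  antip : 'End(H);
  antip_bij : bijective antip;
  antip1 : antip 1 = 1;
  antipM : forall a b, antip (a * b) = antip b * antip a;
  alpha : H;
  beta : H;
  antip_alpha : forall h,
    tlift (fun a b : H => antip a * alpha * b) (Delta h) = (eps h : K) *: alpha;
  antip_beta : forall h,
    tlift (fun a b : H => a * beta * antip b) (Delta h) = (eps h : K) *: beta;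
  antip_Phi : tlift3 (fun a b c : H => antip a * alpha * b * beta * antip c) Phi = 1;
  antip_PhiV :
    tlift3 (fun a b c : H => a * beta * antip b * alpha * c) Phi^-1 = 1;
  eps_alpha : eps alpha = 1;
  eps_beta : eps beta = 1 }.

Section Category.
Variables (K : fieldType) (H : falgType K) (Q : quasiHopf H).
Implicit Types U V W M N P : hmod H.
Local Notation S := (antip Q).
Local Notation Phi := (Phi Q).

Definition tensM V W : hmod H := pullmod (Delta Q) (extmod V W).

Lemma tensME V W h : hact (tensM V W) h = extact V W (Delta Q h).
Proof. by []. Qed.

Definition unitact (h : H) : 'End(K^o) := (eps Q h : K) *: \1%VF.
Fact unitact_linear : linear unitact.
Proof. by move=> c a b; rewrite /unitact linearP /= scalerDl scalerA. Qed.
HB.instance Definition _ :=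
  GRing.isLinear.Build K H 'End(K^o) _ unitact unitact_linear.
Fact unitact1 : unitact 1 = \1%VF.
Proof. by rewrite /unitact rmorph1 scale1r. Qed.
Fact unitactM a b : unitact (a * b) = (unitact a \o unitact b)%VF.
Proof.
by rewrite /unitact rmorphM -comp_lfunZl -comp_lfunZr comp_lfun1l scalerA.
Qed.
Definition unitM : hmod H := HMod unitact1 unitactM.

Lemma unitME h (c : K^o) : hact unitM h c = (eps Q h : K) *: c.
Proof. by rewrite [LHS]scale_lfunE id_lfunE. Qed.

Section Dual.
Variable V : hmod H.
Definition dualact (h : H) : 'End('Hom(V, K^o)) :=
  linfun (fun phi : 'Hom(V, K^o) => (phi \o hact V (S h))%VF).

Lemma dualactE h phi : dualact h phi = (phi \o hact V (S h))%VF.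
Proof.
by rewrite linfunE // => ? ? ?; rewrite comp_lfunDl -comp_lfunZl.
Qed.

Fact dualact_linear : linear dualact.
Proof.
move=> c a b; apply/lfunP => phi; apply/lfunP => v.
rewrite add_lfunE scale_lfunE !dualactE add_lfunE scale_lfunE !comp_lfunE.
by rewrite linearP hactP linearP.
Qed.
HB.instance Definition _ :=
  GRing.isLinear.Build K H 'End('Hom(V, K^o)) _ dualact dualact_linear.
Fact dualact1 : dualact 1 = \1%VF.
Proof.
apply/lfunP => phi; apply/lfunP => v.
by rewrite dualactE antip1 comp_lfunE hact1E id_lfunE.
Qed.
Fact dualactM a b : dualact (a * b) = (dualact a \o dualact b)%VF.
Proof.
apply/lfunP => phi; apply/lfunP => v.
by rewrite comp_lfunE !dualactE antipM !comp_lfunE hactME.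
Qed.
Definition dualM : hmod H := HMod dualact1 dualactM.
End Dual.

Lemma hact_dualE V h (phi : dualM V) v :
  (hact (dualM V) h phi : 'Hom(V, K^o)) v = (phi : 'Hom(V, K^o)) (hact V (S h) v).
Proof.
by rewrite -[hact (dualM V) h phi]/(dualact V h phi) dualactE comp_lfunE.
Qed.

Definition tensor3 U V W := extmod (extmod U V) W.

Lemma tensor3E U V W y : hact (tensor3 U V W) y = extact (extmod U V) W y.
Proof. by []. Qed.

Lemma tmap_extact M N M' N' (f : homH M N) (g : homH M' N') y x :
  tmap f g (extact M M' y x) = extact N N' y (tmap f g x).
Proof.
elim/tens_ind: y => [a b|y y' IH IH']; last first.
  by rewrite !extactD lfunD IH IH'.
elim/tens_ind: x => [m m'|x x' IH IH']; last by rewrite !lfunD IH IH'.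
by rewrite extactE !tmapE extactE !homfP.
Qed.
Fact tensH_subproof M N M' N' (f : homH M N) (g : homH M' N') h x :
  tmap f g (hact (tensM M M') h x) = hact (tensM N N') h (tmap f g x).
Proof. exact: tmap_extact. Qed.
Definition tensH M N M' N' (f : homH M N) (g : homH M' N') :
    homH (tensM M M') (tensM N N') := @MkHom _ _ (tensM M M') (tensM N N') (tmap f g) (tensH_subproof f g).

Lemma tassoc_extact1 U V W (y : tens H H) a u x :
  tassoc U V W (hact U a u ⊗ extact V W y x) =
  extact (extmod U V) W (tassoc H H H (a ⊗ y)) (tassoc U V W (u ⊗ x)).
Proof.
elim/tens_ind: y => [b1 b2|y y' IH IH']; last first.
  by rewrite !(extactD, pureDr, lfunD) IH IH'.
elim/tens_ind: x => [v w|x x' IH IH']; last first.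
  by rewrite lfunD !pureDr !lfunD IH IH'.
by rewrite extactE !tassocE extactE [hact (extmod _ _) _ _]extactE.
Qed.

Lemma tassoc_extact U V W (y : tens H H) x :
  tassoc U V W (extact U (tensM V W) y x) =
  extact (extmod U V) W
    (id_D (Delta Q) y)
    (tassoc U V W x).
Proof.
elim/tens_ind: y => [a b|y y' IH IH']; last first.
  by rewrite extactD lfunD id_DD extactD IH IH'.
elim/tens_ind: x => [u x|x x' IH IH']; last by rewrite !lfunD IH IH'.
rewrite id_DE extactE; exact: tassoc_extact1.
Qed.

Lemma tensM_extact U V W (y : tens H H) (x : tens (tens U V) W) :
  extact (tensM U V) W y x =
  extact (extmod U V) W (D_id (Delta Q) y) x.
Proof.
elim/tens_ind: y => [a b|y y' IH IH']; last first.
  by rewrite extactD D_idD extactD IH IH'.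
elim/tens_ind: x => [uv w|x x' IH IH']; last by rewrite !lfunD IH IH'.
by rewrite D_idE !extactE.
Qed.

Definition assoc_lin U V W : 'Hom(tens U (tens V W), tens (tens U V) W) :=
  (hact (tensor3 U V W) Phi \o tassoc U V W)%VF.
Fact assoc_subproof U V W h x :
  assoc_lin U V W (hact (tensM U (tensM V W)) h x) =
  hact (tensM (tensM U V) W) h (assoc_lin U V W x).
Proof.
rewrite /assoc_lin !comp_lfunE !tensME tassoc_extact tensM_extact -!tensor3E.
have := congr1 (fun z => hact (tensor3 U V W) z (tassoc U V W x)) (coassoc Q h).
by move=> e; rewrite -hactME; exact: (etrans (esym e) (hactME _ _ _)).
Qed.
Definition assocH U V W :
    homH (tensM U (tensM V W)) (tensM (tensM U V) W) :=
  @MkHom _ _ (tensM U (tensM V W)) (tensM (tensM U V) W)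
    (assoc_lin U V W) (@assoc_subproof U V W).

Definition assocV_lin U V W : 'Hom(tens (tens U V) W, tens U (tens V W)) :=
  (tassocV U V W \o hact (tensor3 U V W) (Phi^-1)%R)%VF.
Lemma PhiK U V W x : hact (tensor3 U V W) Phi^-1 (hact (tensor3 U V W) Phi x) = x.
Proof. by rewrite -hactME (mulVr (Phi_unit Q)) hact1E. Qed.
Lemma PhiVK U V W x : hact (tensor3 U V W) Phi (hact (tensor3 U V W) Phi^-1 x) = x.
Proof. by rewrite -hactME (mulrV (Phi_unit Q)) hact1E. Qed.

Lemma assoc_linK U V W x : assocV_lin U V W (assoc_lin U V W x) = x.
Proof.
rewrite /assocV_lin /assoc_lin !comp_lfunE PhiK -[LHS]comp_lfunE tassocK.
exact: id_lfunE.
Qed.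
Lemma assocV_linK U V W x : assoc_lin U V W (assocV_lin U V W x) = x.
Proof.
rewrite /assocV_lin /assoc_lin !comp_lfunE.
have tK y : tassoc U V W (tassocV U V W y) = y.
  by rewrite -[LHS]comp_lfunE tassocVK id_lfunE.
rewrite tK; exact: PhiVK.
Qed.
Fact assocV_subproof U V W h x :
  assocV_lin U V W (hact (tensM (tensM U V) W) h x) =
  hact (tensM U (tensM V W)) h (assocV_lin U V W x).
Proof.
by rewrite -{1}(assocV_linK x) -assoc_subproof assoc_linK.
Qed.
Definition assocVH U V W :
    homH (tensM (tensM U V) W) (tensM U (tensM V W)) :=
  @MkHom _ _ (tensM (tensM U V) W) (tensM U (tensM V W))
    (assocV_lin U V W) (@assocV_subproof U V W).

Definition lunit_lin V : 'Hom(tens K^o V, V) :=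
  linfun (tlift (fun (c : K^o) (v : V) => (c : K) *: v)).
Lemma lunit_linE V (c : K^o) v : lunit_lin V (c ⊗ v) = (c : K) *: v.
Proof.
rewrite lfunE /= tliftE // => ? ? ? ?; last by rewrite linearP.
by rewrite scalerDl scalerA.
Qed.
Fact lunit_subproof V h x :
  lunit_lin V (hact (tensM unitM V) h x) = hact V h (lunit_lin V x).
Proof.
elim/tens_ind: x => [c v|y y' IH IH']; last by rewrite !lfunD IH IH'.
rewrite tensME -[h in RHS](counitl Q).
elim/tens_ind: (Delta Q h) => [a b|y y' IH IH']; last first.
  by rewrite extactD lfunD e_idD hactDE IH IH'.
rewrite extactE e_idE unitME !lunit_linE hactZE lfunZ !scalerA.
by congr (_ *: _); exact: mulrC.
Qed.
Definition lunit V : homH (tensM unitM V) V := 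
  @MkHom _ _ (tensM unitM V) V (lunit_lin V) (@lunit_subproof V).

Definition runit_lin V : 'Hom(tens V K^o, V) :=
  linfun (tlift (fun (v : V) (c : K^o) => (c : K) *: v)).
Lemma runit_linE V (c : K^o) v : runit_lin V (v ⊗ c) = (c : K) *: v.
Proof.
rewrite lfunE /= tliftE // => ? ? ? ?; first by rewrite linearP.
by rewrite scalerDl scalerA.
Qed.
Fact runit_subproof V h x :
  runit_lin V (hact (tensM V unitM) h x) = hact V h (runit_lin V x).
Proof.
elim/tens_ind: x => [v c|y y' IH IH']; last by rewrite !lfunD IH IH'.
rewrite tensME -[h in RHS](counitr Q).
elim/tens_ind: (Delta Q h) => [a b|y y' IH IH']; last first.
  by rewrite extactD lfunD id_eD hactDE IH IH'.
rewrite extactE id_eE unitME !runit_linE hactZE lfunZ !scalerA.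
by congr (_ *: _); exact: mulrC.
Qed.
Definition runit V : homH (tensM V unitM) V := 
  @MkHom _ _ (tensM V unitM) V (runit_lin V) (@runit_subproof V).

Definition runitV_lin V : 'Hom(V, tens V K^o) :=
  linfun (fun v : V => v ⊗ (1 : K^o)).
Lemma runitV_linE V v : runitV_lin V v = v ⊗ (1 : K^o).
Proof. by rewrite linfunE // => ? ? ?; rewrite pureP. Qed.
Fact runitV_subproof V h v :
  runitV_lin V (hact V h v) = hact (tensM V unitM) h (runitV_lin V v).
Proof.
rewrite !runitV_linE tensME -[h in LHS](counitr Q).
elim/tens_ind: (Delta Q h) => [a b|y y' IH IH']; last first.
  by rewrite extactD id_eD hactDE pureDl IH IH'.
by rewrite extactE id_eE unitME hactZE pureZl -pureZr.
Qed.
Definition runitV V : homH V (tensM V unitM) := 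
  @MkHom _ _ V (tensM V unitM) (runitV_lin V) (@runitV_subproof V).

Definition ev_lin V : 'Hom(tens 'Hom(V, K^o) V, K^o) :=
  linfun (tlift (fun (phi : 'Hom(V, K^o)) v => phi (hact V (alpha Q) v))).
Lemma ev_linE V (phi : 'Hom(V, K^o)) v :
  ev_lin V (phi ⊗ v) = phi (hact V (alpha Q) v).
Proof.
rewrite lfunE /= tliftE // => ? ? ? ?; last by rewrite !linearP.
by rewrite add_lfunE scale_lfunE.
Qed.
Fact ev_subproof V h x :
  ev_lin V (hact (tensM (dualM V) V) h x) = hact unitM h (ev_lin V x).
Proof.
elim/tens_ind: x => [phi v|y y' IH IH']; last by rewrite !lfunD IH IH'.
rewrite unitME ev_linE -lfunZ -hactZE -antip_alpha tensME.
elim/tens_ind: (Delta Q h) => [a b|y y' IH IH']; last first.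
  by rewrite extactD lfunD tliftD hactDE lfunD IH IH'.
rewrite extactE ev_linE hact_dualE tliftE ?hactME //.
- by move=> ? ? ? ?; rewrite linearP !mulrDl -!scalerAl.
- by move=> ? ? ? ?; rewrite mulrDr -scalerAr.
Qed.
Definition ev V : homH (tensM (dualM V) V) unitM := 
  @MkHom _ _ (tensM (dualM V) V) unitM (ev_lin V) (@ev_subproof V).

Definition dualv V (i : 'I_(\dim {:V})) : 'Hom(V, K^o) :=
  linfun (coord (vbasis {:V}) i : V -> K^o).
Lemma dualvE V i v : @dualv V i v = coord (vbasis {:V}) i v.
Proof.
by rewrite linfunE // => ? ? ?; rewrite linearP.
Qed.

Lemma dual_basis_move V (f : 'End(V)) :
  \sum_(i < \dim {:V}) (vbasis {:V})`_i ⊗ (dualv i \o f)%VF =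
  \sum_(i < \dim {:V}) f (vbasis {:V})`_i ⊗ dualv i :> tens V 'Hom(V, K^o).
Proof.
have e (phi : 'Hom(V, K^o)) :
    phi = \sum_(i < \dim {:V}) (phi (vbasis {:V})`_i : K) *: dualv i.
  apply/lfunP => v; rewrite sum_lfunE {1}(coord_vbasis (memvf v)) linear_sum.
  by apply: eq_bigr => i _; rewrite linearZ scale_lfunE dualvE; exact: mulrC.
under eq_bigr do rewrite (e (_ \o _)%VF) linear_sum.
rewrite exchange_big /=; apply: eq_bigr => j _.
rewrite [f _ in RHS](coord_vbasis (memvf (f (vbasis {:V})`_j))) pure_suml.
by apply: eq_bigr => i _; rewrite comp_lfunE dualvE pureZr pureZl.
Qed.

Definition coev_lin V : 'Hom(K^o, tens V 'Hom(V, K^o)) :=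
  linfun (fun c : K^o =>
    (c : K) *: \sum_(i < \dim {:V}) hact V (beta Q) (vbasis {:V})`_i ⊗ dualv i).
Lemma coev_linE V (c : K^o) : coev_lin V c =
  (c : K) *: \sum_(i < \dim {:V}) hact V (beta Q) (vbasis {:V})`_i ⊗ dualv i.
Proof.
by rewrite linfunE // => ? ? ?; rewrite scalerDl scalerA.
Qed.
Fact coev_subproof V h c :
  coev_lin V (hact unitM h c) = hact (tensM V (dualM V)) h (coev_lin V c).
Proof.
rewrite !coev_linE unitME lfunZ -[(_ *: c : K)]/((eps Q h : K) * c) mulrC.
rewrite -scalerA; congr (_ *: _).
have -> : (eps Q h : K) *: (\sum_(i < \dim {:V}) hact V (beta Q) (vbasis {:V})`_i ⊗ dualv i)
   = \sum_(i < \dim {:V}) hact V ((eps Q h : K) *: beta Q) (vbasis {:V})`_i ⊗ dualv i.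
  by rewrite scaler_sumr; apply: eq_bigr => i _; rewrite hactZE pureZl.
rewrite -antip_beta tensME.
elim/tens_ind: (Delta Q h) => [a b|y y' IH IH']; last first.
  rewrite tliftD extactD -IH -IH' -[RHS]big_split /=; apply: eq_bigr => i _.
  by rewrite hactDE pureDl.
rewrite tliftE; last first.
- by move=> ? ? ? ?; rewrite linearP mulrDr -scalerAr.
- by move=> ? ? ? ?; rewrite !mulrDl -!scalerAl.
rewrite linear_sum /=.
transitivity (\sum_(i < \dim {:V}) tmap (hact V (a * beta Q)) \1%VF ((hact V (S b) (vbasis {:V})`_i) ⊗ dualv i)).
  by apply: eq_bigr => i _; rewrite tmapE id_lfunE hactME.
rewrite -linear_sum -dual_basis_move linear_sum; apply: eq_bigr => i _.
rewrite [LHS]tmapE [RHS](@extactE _ _ _ V (dualM V)) hactME id_lfunE.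
by congr (_ ⊗ _); exact/esym/dualactE.
Qed.
Definition coev V : homH unitM (tensM V (dualM V)) :=
  @MkHom _ _ unitM (tensM V (dualM V)) (coev_lin V) (@coev_subproof V).
End Category.

Section Pivotal.
Variables (K : fieldType) (H : falgType K) (Q : quasiHopf H).
Implicit Types V W M P : hmod H.
Local Notation S := (antip Q).
Local Notation "V ⊠ W" := (tensM Q V W) (at level 40, left associativity).
Local Notation "V ^∨" := (dualM Q V) (at level 2, format "V ^∨").

Definition nested_ev V W : homH ((W^∨ ⊠ V^∨) ⊠ (V ⊠ W)) (unitM Q) :=
  compH (ev Q W)
 (compH (tensH Q (idH W^∨) (lunit Q W))
 (compH (tensH Q (idH W^∨) (tensH Q (ev Q V) (idH W)))
 (compH (tensH Q (idH W^∨) (assocH Q V^∨ V W))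
        (assocVH Q W^∨ V^∨ (V ⊠ W))))).

(* gam is the canonical map W^∨ ⊗ V^∨ -> (V ⊗ W)^∨: being H-linear, it is       *)
(* determined by the second equation, since evaluations are non-degenerate.     *)
Definition drinfeld_twist (f : tens H H) : Prop :=
  f \is a GRing.unit /\
  forall V W, exists gam : homH (W^∨ ⊠ V^∨) (V ⊠ W)^∨,
    (forall (phi : 'Hom(W, K^o)) (psi : 'Hom(V, K^o)) (v : V) (w : W),
       (gam (phi ⊗ psi) : 'Hom(tens V W, K^o)) (v ⊗ w) =
       tlift (fun a b : H =>
         (psi (hact V a v) : K) * (phi (hact W b w) : K) : K^o) f)
    /\ compH (ev Q (V ⊠ W)) (tensH Q gam (idH (V ⊠ W))) = nested_ev V W.

Record is_pivot (f : tens H H) (g : H) : Prop := IsPivot {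
  pivot_unit : g \is a GRing.unit;
  pivot_Delta : Delta Q g = f^-1 * tmap S S (tswap f) * (g ⊗ g);
  pivot_S2 : forall h, S (S h) = g * h * g^-1 }.

Section Trace.
Variables (f : tens H H) (g : H) (gP : is_pivot f g).

Definition delta_lin V : 'Hom(V, 'Hom('Hom(V, K^o), K^o)) :=
  linfun (fun v => linfun (fun phi : 'Hom(V, K^o) => phi (hact V g v))).
Lemma delta_linE V v (phi : 'Hom(V, K^o)) :
  delta_lin V v phi = phi (hact V g v).
Proof.
have e u (psi : 'Hom(V, K^o)) :
    linfun (fun phi : 'Hom(V, K^o) => phi (hact V g u)) psi = psi (hact V g u).
  by rewrite linfunE // => ? ? ?; rewrite add_lfunE scale_lfunE.
rewrite linfunE ?e // => ? ? ?; apply/lfunP => psi.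
by rewrite add_lfunE scale_lfunE !e !linearP.
Qed.
Fact delta_subproof V h v :
  delta_lin V (hact V h v) = hact V^∨^∨ h (delta_lin V v).
Proof.
apply/lfunP => phi; rewrite delta_linE.
apply/esym/(etrans (@hact_dualE _ _ Q V^∨ h (delta_lin V v) phi)).
apply: etrans (delta_linE _ _) _; apply: etrans (hact_dualE _ _ _) _.
by rewrite (pivot_S2 gP) -!hactME (divrK (pivot_unit gP)).
Qed.
Definition delta V : homH V V^∨^∨ :=
  @MkHom _ _ V V^∨^∨ (delta_lin V) (@delta_subproof V).

(* The right evaluation V ⊗ V^∨ -> k. *)
Definition evR V : homH (V ⊠ V^∨) (unitM Q) :=
  compH (ev Q V^∨) (tensH Q (delta V) (idH V^∨)).

Definition ptrace (A B C : hmod H) (k : homH (A ⊠ C) (B ⊠ C)) : homH A B :=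
  compH (runit Q B)
 (compH (tensH Q (idH B) (evR C))
 (compH (assocVH Q B C C^∨)
 (compH (tensH Q k (idH C^∨))
 (compH (assocH Q A C C^∨)
 (compH (tensH Q (idH A) (coev Q C))
        (runitV Q A)))))).

(* trace_partial ranges over all proofs that P ⊠ V is projective; such a proof  *)
(* always exists, and by cyclicity t P hP does not depend on hP.                *)
Definition trace_family := forall P, projective P -> 'Hom(homH P P, K^o).

Record right_modified_trace (t : trace_family) : Prop := RightModifiedTrace {
  trace_cyclic : forall P P' (hP : projective P) (hP' : projective P')
      (a : homH P P') (b : homH P' P),
    t P hP (compH b a) = t P' hP' (compH a b);
  trace_partial : forall P V (hP : projective P) (hPV : projective (P ⊠ V))
      (k : homH (P ⊠ V) (P ⊠ V)),
    t (P ⊠ V) hPV k = t P hP (ptrace k) }.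

Definition nonzero_trace (t : trace_family) :=
  exists P (hP : projective P) (k : homH P P), t P hP k <> 0.

Definition nondegenerate_trace (t : trace_family) :=
  forall M P (hP : projective P),
    (forall a : homH M P, (forall b : homH P M, t P hP (compH a b) = 0) -> a = 0)
 /\ (forall b : homH P M, (forall a : homH M P, t P hP (compH a b) = 0) -> b = 0).
End Trace.

Definition left_integral (L : H) := forall h, h * L = (eps Q h : K) *: L.
Definition right_integral (L : H) := forall h, L * h = (eps Q h : K) *: L.
Definition unimodular := forall L, left_integral L <-> right_integral L.

Definition is_modulus (gam : {lrmorphism H -> K^o}) :=
  forall L, left_integral L -> forall h, L * h = (gam h : K) *: L.

(* qL and pL are the elements q^L, p^L; Ucop and Vcop are U^cop, V^cop. *)
Definition qL : tens H H :=
  tlift3 (fun a b c : H => (S a * alpha Q * b) ⊗ c) (Phi Q).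
Definition pL : tens H H :=
  tlift3 (fun a b c : H => (b * (S^-1)%VF (a * beta Q)) ⊗ c) (Phi Q)^-1.
Definition Ucop (f : tens H H) : tens H H := tmap S^-1%VF S^-1%VF (qL * f^-1).
Definition Vcop (f : tens H H) : tens H H := tmap S S pL * tswap f.

Definition right_cointegral (f : tens H H) (lam : 'Hom(H, K^o)) :=
  exists2 gam : {lrmorphism H -> K^o}, is_modulus gam &
  forall h,
    tlift (fun a b : H => (lam b : K) *: a)
      (Vcop f * tswap (Delta Q h) * Ucop f) =
    tlift3 (fun a b c : H =>
      ((gam c : K) * (lam (h * (S^-1)%VF b) : K)) *: a) (Phi Q)^-1.
(* hat g lam (h) = lam (g h). *)
Definition hat (g : H) (lam : 'Hom(H, K^o)) : 'Hom(H, K^o) :=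
  (lam \o amull g)%VF.
End Pivotal.

(* Main.v *)
(* Let L be a nonzero integral and P projective.  The invariants of P ⊠ P^∨ are
   L (P ⊠ P^∨), so for k in End(P) we have (k ⊗ 1) coev = L y for some y, and
   t(k) := evR y is well defined because, H being unimodular, morphisms from
   projectives to the unit vanish on the kernel of L.  Cyclicity is dinaturality
   of coev and evR; the partial trace property is the compatibility of coev and
   evR with tensor products, expressed through the twist f and the pivot.  Since
   (r_x ⊗ 1) coev does not vanish for x <> 0, the form x |-> t(r_x) on H is
   non-degenerate, and hence so is t.

   Conversely, let t be any modified trace and nu x := t(r_x).  Every projective
   is a retract of some H ⊠ P, a sum of copies of H, so nu determines t.  The
   trace of F ∘ r_x ∘ G, for G : H ⊠ H -> H and F : H -> H ⊠ H with
   F 1 = U^cop_21, computed by cyclicity and by partial trace, is the cointegral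
   equation for h |-> nu (g^-1 h).  Evaluating that equation at L shows that the
   cointegral of the trace above spans all cointegrals. *)

From HB Require Import structures.
Require Import Defs.
From mathcomp Require Import all_boot all_order all_algebra.
From mathcomp Require Import falgebra.
From Stdlib Require Import FunctionalExtensionality.
Import GRing.Theory.
Local Open Scope ring_scope.

Set Implicit Arguments.
Unset Strict Implicit.
Unset Printing Implicit Defensive.

(** * Multilinear calculus in sumless notation *)

(** The twist is specified only through its action on duals of modules. Besides invertibility, the
    algebra uses two equations read off from it: [f * Δ (S h) = SS (Δ h) * f] and [f * Δ α = gamma].
    The counterpart [Δ β = delta0 * f], without which the coevaluation of a tensor product could not
    be compared with the nested one, has to be derived from them. A second obstacle is a mismatch of
    sides: the cointegral equation is written with q^L and p^L, whereas partial traces produce the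
    right-handed element [qR]. The map [twist_pL] bridges this by expressing p^L, hence V^cop,
    through f^-1 and [qR]. With F 1 = U^cop_21, the composite G (F 1) collapses to the legs of f;
    the f^-1 coming out of V^cop then cancels them. The shift by g between trace and cointegral has
    its origin in [SS f^-1 * f = (g ⊗ g) * Δ g^-1], which is the coproduct rule of the pivot and
    puts g in front of the first leg of V^cop_21. *)

Section LinearityRules.
Variable K : fieldType.

Lemma lin_id (U : lmodType K) : linear (fun x : U => x).
Proof. by []. Qed.

Lemma lin_mull (U : lmodType K) (A : algType K) (a : A) (F : U -> A) :
  linear F -> linear (fun x => a * F x).
Proof. by move=> l c u v; rewrite l mulrDr -scalerAr. Qed.

Lemma lin_mulr (U : lmodType K) (A : algType K) (a : A) (F : U -> A) :
  linear F -> linear (fun x => F x * a).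
Proof. by move=> l c u v; rewrite l mulrDl -scalerAl. Qed.

Lemma lin_scaler (U W : lmodType K) a (F : U -> W) :
  linear F -> linear (fun x => a *: F x).
Proof. by move=> l c u v; rewrite l scalerDr !scalerA mulrC. Qed.

Lemma lin_scalel (U W : lmodType K) (w : W) (F : U -> K^o) :
  linear F -> linear (fun x => (F x : K) *: w).
Proof. by move=> l c u v; rewrite l scalerDl scalerA. Qed.

Lemma lin_purel (U : lmodType K) (V W : vectType K) (w : W) (F : U -> V) :
  linear F -> linear (fun x => F x ⊗ w).
Proof. by move=> l c u v; rewrite l pureP. Qed.

Lemma lin_purer (U : lmodType K) (V W : vectType K) (v : V) (F : U -> W) :
  linear F -> linear (fun x => v ⊗ F x).
Proof. by move=> l c u w; rewrite l linearP. Qed.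

Lemma lin_comp (U V W : lmodType K) (f : {linear V -> W}) (F : U -> V) :
  linear F -> linear (fun x => f (F x)).
Proof. by move=> l c u v; rewrite l linearP. Qed.

Lemma lin_fun (U V W : lmodType K) (f : V -> W) (F : U -> V) :
  linear f -> linear F -> linear (fun x => f (F x)).
Proof. by move=> lf l c u v; rewrite l lf. Qed.

Lemma lin_lfun (U : lmodType K) (V W : vectType K) (f : 'Hom(V, W)) (F : U -> V) :
  linear F -> linear (fun x => f (F x)).
Proof. by move=> l c u v; rewrite l linearP. Qed.

Lemma lin_ffun (U : lmodType K) (V W : vectType K) (F : U -> 'Hom(V, W)) v :
  linear F -> linear (fun x => F x v).
Proof. by move=> l c u w; rewrite l add_lfunE scale_lfunE. Qed.

Lemma lin_tliftf (U : lmodType K) (V1 V2 : vectType K) (W : lmodType K)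
    (F : U -> V1 -> V2 -> W) y :
  (forall a b, linear (fun x => F x a b)) -> linear (fun x => tlift (F x) y).
Proof.
by move=> l c u v; rewrite -tliftP; apply: eq_tlift => a b; rewrite l.
Qed.

Lemma lin_tlift (U : lmodType K) (V1 V2 : vectType K) (W : lmodType K)
    (B : V1 -> V2 -> W) (F : U -> tens V1 V2) :
  linear F -> linear (fun x => tlift B (F x)).
Proof. by move=> l c u v; rewrite l linearP. Qed.

Lemma lin_tlift3f (U : lmodType K) (V1 V2 V3 : vectType K) (W : lmodType K)
    (F : U -> V1 -> V2 -> V3 -> W) y :
  (forall a b c, linear (fun x => F x a b c)) -> linear (fun x => tlift3 (F x) y).
Proof. by move=> l; apply: lin_tliftf => ab c; apply: lin_tliftf => a b. Qed.

Lemma lin_tlift3 (U : lmodType K) (V1 V2 V3 : vectType K) (W : lmodType K)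
    (B : V1 -> V2 -> V3 -> W) (F : U -> tens (tens V1 V2) V3) :
  linear F -> linear (fun x => tlift3 B (F x)).
Proof. exact: lin_tlift. Qed.

Lemma lin_add (U W : lmodType K) (F G : U -> W) :
  linear F -> linear G -> linear (fun x => F x + G x).
Proof. by move=> lF lG c u v; rewrite lF lG scalerDr addrACA. Qed.

Lemma lin_sum (U W : lmodType K) I (r : seq I) (F : I -> U -> W) :
  (forall i, linear (F i)) -> linear (fun x => \sum_(i <- r) F i x).
Proof.
move=> l c u v; rewrite scaler_sumr -big_split /=; apply: eq_bigr => i _.
exact: l.
Qed.
End LinearityRules.

Section Multilinear.
Variables (K : fieldType).

Definition bilin (U V : vectType K) (W : lmodType K) (F : U -> V -> W) :=
  (forall v, linear (fun u => F u v)) /\ (forall u, linear (fun v => F u v)).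

Definition trilin (U V X : vectType K) (W : lmodType K) (F : U -> V -> X -> W) :=
  (forall v x, linear (fun u => F u v x)) /\
  (forall u x, linear (fun v => F u v x)) /\ (forall u v, linear (fun x => F u v x)).

Definition quadlin (U V X Y : vectType K) (W : lmodType K)
    (F : U -> V -> X -> Y -> W) :=
  (forall v x y, linear (fun u => F u v x y)) /\
  (forall u x y, linear (fun v => F u v x y)) /\
  (forall u v y, linear (fun x => F u v x y)) /\
  (forall u v x, linear (fun y => F u v x y)).

(** Pure tensors span. This is the working principle of sumless notation: an identity is generalised
    over the tensors occurring in it and checked on pure ones, linearity of both sides being a side
    condition. *)
Lemma tlift_ext (U V : vectType K) (W : lmodType K) (f g : tens U V -> W) :
    linear f -> linear g -> (forall u v, f (u ⊗ v) = g (u ⊗ v)) -> f =1 g.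
Proof.
move=> lf lg e; elim/tens_ind => [//|x y IHx IHy].
by rewrite -[x]scale1r lf lg !scale1r IHx IHy.
Qed.

Lemma tlift3_ext (U V X : vectType K) (W : lmodType K)
    (f g : tens (tens U V) X -> W) :
    linear f -> linear g ->
  (forall u v x, f (u ⊗ v ⊗ x) = g (u ⊗ v ⊗ x)) -> f =1 g.
Proof.
move=> lf lg e; apply: tlift_ext => // uv x; move: uv.
by apply: tlift_ext => // c u v; rewrite pureP ?lf ?lg.
Qed.

Definition tlift4 (U V X Y : vectType K) (W : lmodType K)
    (F : U -> V -> X -> Y -> W) (z : tens (tens (tens U V) X) Y) : W :=
  tlift (fun uvx y => tlift3 (fun u v x => F u v x y) uvx) z.

Lemma tlift4_ext (U V X Y : vectType K) (W : lmodType K)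
    (f g : tens (tens (tens U V) X) Y -> W) :
    linear f -> linear g ->
  (forall u v x y, f (u ⊗ v ⊗ x ⊗ y) = g (u ⊗ v ⊗ x ⊗ y)) -> f =1 g.
Proof.
move=> lf lg e; apply: tlift_ext => // uvx y; move: uvx.
by apply: tlift3_ext => // c u v; rewrite pureP ?lf ?lg.
Qed.

Lemma bilinE (U V : vectType K) (W : lmodType K) (F : U -> V -> W) u v :
  bilin F -> tlift F (u ⊗ v) = F u v.
Proof. by case=> l r; rewrite tliftE. Qed.

Lemma trilinE (U V X : vectType K) (W : lmodType K) (F : U -> V -> X -> W) u v x :
  trilin F -> tlift3 F (u ⊗ v ⊗ x) = F u v x.
Proof. by case=> [? [? ?]]; rewrite tlift3E. Qed.

Lemma lin_tlift4 (U : lmodType K) (V1 V2 V3 V4 : vectType K) (W : lmodType K)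
    (B : V1 -> V2 -> V3 -> V4 -> W) (F : U -> tens (tens (tens V1 V2) V3) V4) :
  linear F -> linear (fun x => tlift4 B (F x)).
Proof. exact: lin_tlift. Qed.

Lemma quadlinE (U V X Y : vectType K) (W : lmodType K)
    (F : U -> V -> X -> Y -> W) u v x y :
  quadlin F -> tlift4 F (u ⊗ v ⊗ x ⊗ y) = F u v x y.
Proof.
case=> [l1 [l2 [l3 l4]]]; rewrite /tlift4 tliftE.
- by rewrite trilinE.
- by move=> y'; apply: lin_tlift3.
- by move=> uvx; apply: lin_tlift3f => a b c; apply: l4.
Qed.

Lemma lin_tlift4f (U : lmodType K) (V1 V2 V3 V4 : vectType K) (W : lmodType K)
    (F : U -> V1 -> V2 -> V3 -> V4 -> W) y :
  (forall a b c d, linear (fun x => F x a b c d)) -> linear (fun x => tlift4 (F x) y).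
Proof. by move=> l; apply: lin_tliftf => abc d; apply: lin_tlift3f => a b c. Qed.

Lemma eq_tlift3 (U V X : vectType K) (W : lmodType K) (F G : U -> V -> X -> W) :
  (forall u v x, F u v x = G u v x) -> tlift3 F =1 tlift3 G.
Proof. by move=> e z; apply: eq_tlift => uv x; apply: eq_tlift. Qed.

Lemma eq_tlift4 (U V X Y : vectType K) (W : lmodType K)
    (F G : U -> V -> X -> Y -> W) :
  (forall u v x y, F u v x y = G u v x y) -> tlift4 F =1 tlift4 G.
Proof. by move=> e z; apply: eq_tlift => uvx y; apply: eq_tlift3. Qed.

(** Fubini for two independent sumless sums. *)
Lemma tlift_exchange (U V U' V' : vectType K) (W : lmodType K)
    (F : U -> V -> U' -> V' -> W) x y :
  tlift (fun u v => tlift (fun u' v' => F u v u' v') y) x =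
  tlift (fun u' v' => tlift (fun u v => F u v u' v') x) y.
Proof.
rewrite /tlift.
under eq_bigr => i _ do under eq_bigr => j _ do
  (rewrite scaler_sumr; under eq_bigr => k _ do
    (rewrite scaler_sumr; under eq_bigr => l _ do rewrite scalerA mulrC -scalerA)).
under [RHS]eq_bigr => i _ do under eq_bigr => j _ do
  (rewrite scaler_sumr; under eq_bigr => k _ do rewrite scaler_sumr).
under eq_bigr => i _ do rewrite exchange_big /=.
rewrite exchange_big /=; apply: eq_bigr => k _.
under eq_bigr => i _ do rewrite exchange_big /=.
by rewrite exchange_big.
Qed.

Lemma tlift3_exchange2 (U V X U' V' : vectType K) (W : lmodType K)
    (F : U -> V -> X -> U' -> V' -> W) x y :
  tlift3 (fun u v t => tlift (fun u' v' => F u v t u' v') y) x =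
  tlift (fun u' v' => tlift3 (fun u v t => F u v t u' v') x) y.
Proof.
rewrite /tlift3 -tlift_exchange; apply: eq_tlift => uv t.
by rewrite tlift_exchange.
Qed.

Lemma tlift3_exchange (U V X U' V' X' : vectType K) (W : lmodType K)
    (F : U -> V -> X -> U' -> V' -> X' -> W) x y :
  tlift3 (fun u v t => tlift3 (fun u' v' t' => F u v t u' v' t') y) x =
  tlift3 (fun u' v' t' => tlift3 (fun u v t => F u v t u' v' t') x) y.
Proof.
rewrite {2}/tlift3 tlift3_exchange2 [RHS]/tlift3; apply: eq_tlift => uv t.
exact: tlift3_exchange2.
Qed.

Lemma bilin_l (U V : vectType K) (W Z : lmodType K) (F : U -> V -> W)
    (G : Z -> U) v : bilin F -> linear G -> linear (fun z => F (G z) v).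
Proof. by move=> [l _] lG c x y; rewrite lG l. Qed.
Lemma bilin_r (U V : vectType K) (W Z : lmodType K) (F : U -> V -> W)
    (G : Z -> V) u : bilin F -> linear G -> linear (fun z => F u (G z)).
Proof. by move=> [_ l] lG c x y; rewrite lG l. Qed.

Lemma trilin_1 (U V X : vectType K) (W Z : lmodType K) (F : U -> V -> X -> W)
    (G : Z -> U) v x : trilin F -> linear G -> linear (fun z => F (G z) v x).
Proof. by move=> [l _] lG c y z; rewrite lG l. Qed.
Lemma trilin_2 (U V X : vectType K) (W Z : lmodType K) (F : U -> V -> X -> W)
    (G : Z -> V) u x : trilin F -> linear G -> linear (fun z => F u (G z) x).
Proof. by move=> [_ [l _]] lG c y z; rewrite lG l. Qed.
Lemma trilin_3 (U V X : vectType K) (W Z : lmodType K) (F : U -> V -> X -> W)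
    (G : Z -> X) u v : trilin F -> linear G -> linear (fun z => F u v (G z)).
Proof. by move=> [_ [_ l]] lG c y z; rewrite lG l. Qed.

Lemma quadlin_1 (U V X Y : vectType K) (W Z : lmodType K)
    (F : U -> V -> X -> Y -> W) (G : Z -> U) v x y :
  quadlin F -> linear G -> linear (fun z => F (G z) v x y).
Proof. by move=> [l _] lG c w z; rewrite lG l. Qed.
Lemma quadlin_2 (U V X Y : vectType K) (W Z : lmodType K)
    (F : U -> V -> X -> Y -> W) (G : Z -> V) u x y :
  quadlin F -> linear G -> linear (fun z => F u (G z) x y).
Proof. by move=> [_ [l _]] lG c w z; rewrite lG l. Qed.
Lemma quadlin_3 (U V X Y : vectType K) (W Z : lmodType K)
    (F : U -> V -> X -> Y -> W) (G : Z -> X) u v y :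
  quadlin F -> linear G -> linear (fun z => F u v (G z) y).
Proof. by move=> [_ [_ [l _]]] lG c w z; rewrite lG l. Qed.
Lemma quadlin_4 (U V X Y : vectType K) (W Z : lmodType K)
    (F : U -> V -> X -> Y -> W) (G : Z -> Y) u v x :
  quadlin F -> linear G -> linear (fun z => F u v x (G z)).
Proof. by move=> [_ [_ [_ l]]] lG c w z; rewrite lG l. Qed.
End Multilinear.

(** Linearity is decided by the head symbol of the body. In each rule the pattern [@?F x] captures
    the argument in which the variable occurs, and a plain metavariable cannot contain it, so a rule
    fires only if exactly one argument depends on the variable. Multilinearity of a local
    contraction is taken from the context. *)
Ltac lin1 :=
  match goal with
  | |- _ /\ _ => split
  | |- bilin _ => split
  | |- trilin _ => split
  | |- quadlin _ => split
  | |- GRing.linear_for _ (fun x => x) => exact: lin_id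
  | |- GRing.linear_for _ (fun x => @GRing.mul _ (@?F x) ?b) => apply: (lin_mulr b)
  | |- GRing.linear_for _ (fun x => @GRing.mul _ ?a (@?F x)) => apply: (lin_mull a)
  | |- GRing.linear_for _ (fun x => @pure _ _ _ (@?F x) ?b) => apply: (lin_purel b)
  | |- GRing.linear_for _ (fun x => @pure _ _ _ ?a (@?F x)) => apply: (lin_purer a)
  | |- GRing.linear_for _ (fun x => @tlift _ _ _ _ ?B (@?F x)) => apply: (lin_tlift B)
  | |- GRing.linear_for _ (fun x => @tlift _ _ _ _ (@?F x) ?y) => apply: (lin_tliftf (F := F))
  | |- GRing.linear_for _ (fun x => @tlift3 _ _ _ _ _ ?B (@?F x)) => apply: (lin_tlift3 B)
  | |- GRing.linear_for _ (fun x => @tlift3 _ _ _ _ _ (@?F x) ?y) => apply: (lin_tlift3f (F := F))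
  | |- GRing.linear_for _ (fun x => @tlift4 _ _ _ _ _ _ ?B (@?F x)) => apply: (lin_tlift4 B)
  | |- GRing.linear_for _ (fun x => @tlift4 _ _ _ _ _ _ (@?F x) ?y) => apply: (lin_tlift4f (F := F))
  | |- GRing.linear_for _ (fun x => @GRing.scale _ _ ?a (@?F x)) => apply: (lin_scaler a)
  | |- GRing.linear_for _ (fun x => @GRing.scale _ _ (@?F x) ?w) => apply: (lin_scalel w)
  | |- GRing.linear_for _ (fun x => @fun_of_lfun _ _ _ ?f (@?F x)) => apply: (lin_lfun f)
  | |- GRing.linear_for _ (fun x => @fun_of_lfun _ _ _ (@?F x) ?v) => apply: (lin_ffun v)
  | |- GRing.linear_for _ (fun x => @GRing.Linear.sort _ _ _ _ ?f (@?F x)) => apply: (lin_comp f)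
  | H : bilin ?f |- GRing.linear_for _ (fun x => ?f (@?F x) ?b) => apply: (bilin_l b H)
  | H : bilin ?f |- GRing.linear_for _ (fun x => ?f ?a (@?F x)) => apply: (bilin_r a H)
  | H : trilin ?f |- GRing.linear_for _ (fun x => ?f (@?F x) ?b ?c) => apply: (trilin_1 b c H)
  | H : trilin ?f |- GRing.linear_for _ (fun x => ?f ?a (@?F x) ?c) => apply: (trilin_2 a c H)
  | H : trilin ?f |- GRing.linear_for _ (fun x => ?f ?a ?b (@?F x)) => apply: (trilin_3 a b H)
  | H : quadlin ?f |- GRing.linear_for _ (fun x => ?f (@?F x) ?b ?c ?d) => apply: (quadlin_1 b c d H)
  | H : quadlin ?f |- GRing.linear_for _ (fun x => ?f ?a (@?F x) ?c ?d) => apply: (quadlin_2 a c d H)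
  | H : quadlin ?f |- GRing.linear_for _ (fun x => ?f ?a ?b (@?F x) ?d) => apply: (quadlin_3 a b d H)
  | H : quadlin ?f |- GRing.linear_for _ (fun x => ?f ?a ?b ?c (@?F x)) => apply: (quadlin_4 a b c H)
  | H : GRing.linear_for _ ?f |- GRing.linear_for _ (fun x => ?f (@?F x)) => apply: (lin_fun H)
  | H : GRing.linear_for _ ?f |- GRing.linear_for _ ?f => exact: H
  | H : bilin ?f |- GRing.linear_for _ (?f ?a) => exact: (bilin_r a H (@lin_id _ _))
  | H : trilin ?f |- GRing.linear_for _ (?f ?a ?b) => exact: (trilin_3 a b H (@lin_id _ _))
  | H : quadlin ?f |- GRing.linear_for _ (?f ?a ?b ?c) => exact: (quadlin_4 a b c H (@lin_id _ _))
  | |- GRing.linear_for _ (fun x => _) => first [apply: lin_comp]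
  | |- GRing.linear_for _ ?f =>
    lazymatch f with (fun _ => _) => fail | _ => change (linear (fun x => f x)) end
  | |- forall _, _ => move=> ?
  end.
Ltac lin := cbv beta; repeat (lin1; cbv beta).

Section TensorProducts.
Variables (K : fieldType) (A B C D : falgType K).

Lemma tliftM (W : lmodType K) (F : A -> B -> W) x y : bilin F ->
  tlift F (x * y) =
  tlift (fun a b => tlift (fun a' b' => F (a * a') (b * b')) y) x.
Proof.
move=> l; move: x; apply: tlift_ext; [by lin | by lin |] => a b.
rewrite bilinE; last by lin.
move: y; apply: tlift_ext; [by lin | by lin |] => a' b'.
by rewrite pureM !bilinE //; lin.
Qed.

Lemma tlift3M (W : lmodType K) (F : A -> B -> C -> W) x y : trilin F ->
  tlift3 F (x * y) =
  tlift3 (fun a b c =>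
    tlift3 (fun a' b' c' => F (a * a') (b * b') (c * c')) y) x.
Proof.
move=> l; move: x; apply: tlift3_ext; [by lin | by lin |] => a b c.
rewrite trilinE; last by lin.
move: y; apply: tlift3_ext; [by lin | by lin |] => a' b' c'.
by rewrite !pureM !trilinE //; lin.
Qed.

Lemma tlift4M (W : lmodType K) (F : A -> B -> C -> D -> W) x y : quadlin F ->
  tlift4 F (x * y) =
  tlift4 (fun a b c d =>
    tlift4 (fun a' b' c' d' => F (a * a') (b * b') (c * c') (d * d')) y) x.
Proof.
move=> l; move: x; apply: tlift4_ext; [by lin | by lin |] => a b c d.
rewrite quadlinE; last by lin.
move: y; apply: tlift4_ext; [by lin | by lin |] => a' b' c' d'.
by rewrite !pureM !quadlinE //; lin.
Qed.
End TensorProducts.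

Section Coproducts.
Variables (K : fieldType) (H : falgType K) (D : {lrmorphism H -> tens H H}).
Implicit Types (W : lmodType K).

Lemma lrmorphM a b : D (a * b) = D a * D b.
Proof. exact: rmorphM. Qed.

Lemma tlift3_D_id W (F : H -> H -> H -> W) x : trilin F ->
  tlift3 F (D_id D x) = tlift (fun a b => tlift (fun a1 a2 => F a1 a2 b) (D a)) x.
Proof.
move=> l; move: x; rewrite /D_id; apply: tlift_ext; [by lin | by lin |] => a b.
rewrite !bilinE; [|by lin..].
move: (D a); apply: tlift_ext; [by lin | by lin |] => a1 a2.
by rewrite trilinE // bilinE //; lin.
Qed.

Lemma tlift3_id_D W (F : H -> H -> H -> W) x : trilin F ->
  tlift3 F (id_D D x) = tlift (fun a b => tlift (fun b1 b2 => F a b1 b2) (D b)) x.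
Proof.
move=> l; move: x; rewrite /id_D; apply: tlift_ext; [by lin | by lin |] => a b.
rewrite !bilinE; [|by lin..].
move: (D b); apply: tlift_ext; [by lin | by lin |] => b1 b2.
by rewrite !bilinE ?trilinE //; lin.
Qed.

Lemma tlift4_D_id_id W (F : H -> H -> H -> H -> W) x : quadlin F ->
  tlift4 F (D_id_id D x) =
  tlift3 (fun a b c => tlift (fun a1 a2 => F a1 a2 b c) (D a)) x.
Proof.
move=> l; move: x; rewrite /D_id_id; apply: tlift3_ext; [by lin | by lin |] => a b c.
rewrite !trilinE; [|by lin..].
move: (D a); apply: tlift_ext; [by lin | by lin |] => a1 a2.
by rewrite !bilinE ?quadlinE //; lin.
Qed.

Lemma tlift4_id_D_id W (F : H -> H -> H -> H -> W) x : quadlin F ->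
  tlift4 F (id_D_id D x) =
  tlift3 (fun a b c => tlift (fun b1 b2 => F a b1 b2 c) (D b)) x.
Proof.
move=> l; move: x; rewrite /id_D_id; apply: tlift3_ext; [by lin | by lin |] => a b c.
rewrite !trilinE; [|by lin..].
move: (D b); apply: tlift_ext; [by lin | by lin |] => a1 a2.
by rewrite !bilinE ?quadlinE //; lin.
Qed.

Lemma tlift4_id_id_D W (F : H -> H -> H -> H -> W) x : quadlin F ->
  tlift4 F (id_id_D D x) =
  tlift3 (fun a b c => tlift (fun c1 c2 => F a b c1 c2) (D c)) x.
Proof.
move=> l; move: x; rewrite /id_id_D; apply: tlift3_ext; [by lin | by lin |] => a b c.
rewrite !trilinE; [|by lin..].
move: (D c); apply: tlift_ext; [by lin | by lin |] => a1 a2.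
by rewrite !bilinE ?quadlinE //; lin.
Qed.

Lemma tlift4_one_tens W (F : H -> H -> H -> H -> W) x : quadlin F ->
  tlift4 F (one_tens x) = tlift3 (fun a b c => F 1 a b c) x.
Proof.
move=> l; move: x; rewrite /one_tens; apply: tlift3_ext; [by lin | by lin |] => a b c.
by rewrite !trilinE ?quadlinE //; lin.
Qed.

Lemma tlift4_tens_one W (F : H -> H -> H -> H -> W) x : quadlin F ->
  tlift4 F (x ⊗ 1) = tlift3 (fun a b c => F a b c 1) x.
Proof.
move=> l; move: x; apply: tlift3_ext; [by lin | by lin |] => a b c.
by rewrite !trilinE ?quadlinE //; lin.
Qed.

Lemma tlift1 W (F : H -> H -> W) : bilin F -> tlift F 1 = F 1 1.
Proof. by move=> l; rewrite -pure1 bilinE. Qed.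
Lemma tlift3_1 W (F : H -> H -> H -> W) : trilin F -> tlift3 F 1 = F 1 1 1.
Proof. by move=> l; rewrite -!pure1 trilinE. Qed.
Lemma tlift3_pure (x : tens (tens H H) H) : tlift3 (fun a b c => a ⊗ b ⊗ c) x = x.
Proof.
move: x; apply: tlift3_ext; [by lin | by lin |] => a b c.
by rewrite trilinE //; lin.
Qed.

Lemma D_id_idM x y : D_id_id D (x * y) = D_id_id D x * D_id_id D y.
Proof.
move: x; apply: tlift3_ext; rewrite /D_id_id; [by lin | by lin |] => a b c.
move: y; apply: tlift3_ext; [by lin | by lin |] => a' b' c'.
by rewrite !pureM !trilinE ?lrmorphM ?pureM //; lin.
Qed.
Lemma D_id_id1 : D_id_id D 1 = 1.
Proof. by rewrite /D_id_id tlift3_1 ?rmorph1 ?pure1 //; lin. Qed.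

Lemma id_D_idM x y : id_D_id D (x * y) = id_D_id D x * id_D_id D y.
Proof.
move: x; apply: tlift3_ext; rewrite /id_D_id; [by lin | by lin |] => a b c.
move: y; apply: tlift3_ext; [by lin | by lin |] => a' b' c'.
rewrite !pureM !trilinE ?lrmorphM; [|by lin..].
move: (D b); apply: tlift_ext; [by lin | by lin |] => b1 b2.
move: (D b'); apply: tlift_ext; [by lin | by lin |] => b1' b2'.
by rewrite !pureM !bilinE ?pureM //; lin.
Qed.
Lemma id_D_id1 : id_D_id D 1 = 1.
Proof.
rewrite /id_D_id tlift3_1; last by lin.
by rewrite rmorph1 tlift1 ?pure1 //; lin.
Qed.

Lemma id_id_DM x y : id_id_D D (x * y) = id_id_D D x * id_id_D D y.
Proof.
move: x; apply: tlift3_ext; rewrite /id_id_D; [by lin | by lin |] => a b c.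
move: y; apply: tlift3_ext; [by lin | by lin |] => a' b' c'.
rewrite !pureM !trilinE ?lrmorphM; [|by lin..].
move: (D c); apply: tlift_ext; [by lin | by lin |] => b1 b2.
move: (D c'); apply: tlift_ext; [by lin | by lin |] => b1' b2'.
by rewrite !pureM !bilinE ?pureM //; lin.
Qed.
Lemma id_id_D1 : id_id_D D 1 = 1.
Proof.
rewrite /id_id_D tlift3_1; last by lin.
by rewrite rmorph1 tlift1 ?pure1 //; lin.
Qed.

Lemma one_tensM (x y : tens (tens H H) H) :
  one_tens (x * y) = one_tens x * one_tens y.
Proof.
move: x; apply: tlift3_ext; rewrite /one_tens; [by lin | by lin |] => a b c.
move: y; apply: tlift3_ext; [by lin | by lin |] => a' b' c'.
by rewrite !pureM !trilinE ?pureM ?mulr1 //; lin.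
Qed.
Lemma one_tens1 : one_tens (1 : tens (tens H H) H) = 1.
Proof. by rewrite /one_tens tlift3_1 ?pure1 //; lin. Qed.

End Coproducts.

Section LinearFunctions.
Variables (K : fieldType) (W W' : lmodType K) (f : W -> W') (l : linear f).

Lemma linear_fun0 : f 0 = 0.
Proof.
pose g : {linear W -> W'} := HB.pack f (GRing.isLinear.Build _ _ _ _ f l).
exact: (linear0 g).
Qed.
Lemma linear_funB : {morph f : x y / x - y}.
Proof.
pose g : {linear W -> W'} := HB.pack f (GRing.isLinear.Build _ _ _ _ f l).
exact: (linearB g).
Qed.
Lemma linear_funZ c : {morph f : x / c *: x}.
Proof. by move=> x; rewrite -[c *: x]addr0 l linear_fun0 addr0. Qed.
End LinearFunctions.

Lemma fun_tlift (K : fieldType) (U V : vectType K) (W W' : lmodType K) (f : W -> W') (B : U -> V -> W) x : linear f ->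
  f (tlift B x) = tlift (fun u v => f (B u v)) x.
Proof.
move=> l; pose g : {linear W -> W'} := HB.pack f (GRing.isLinear.Build _ _ _ _ f l).
exact: (linear_tlift g).
Qed.

Lemma fun_tlift3 (K : fieldType) (U V X : vectType K) (W W' : lmodType K) (f : W -> W') (B : U -> V -> X -> W) x : linear f ->
  f (tlift3 B x) = tlift3 (fun u v t => f (B u v t)) x.
Proof.
move=> l; rewrite /tlift3 (fun_tlift (f := f)) //.
by apply: eq_tlift => uv t; rewrite (fun_tlift (f := f)).
Qed.

(** * Counit normalisation of all legs of Φ and Ψ *)

Section Counits.
Variables (K : fieldType) (H : falgType K) (Q : quasiHopf H).
Local Notation Δ := (Delta Q).
Local Notation ε := (eps Q).
Local Notation Φ := (Phi Q).
Local Notation Ψ := (Phi Q)^-1.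
Implicit Types (W : lmodType K).

Lemma epsM a b : ε (a * b) = ((ε a : K) * (ε b : K))%R :> K.
Proof. exact: rmorphM. Qed.
Lemma eps1 : ε 1 = 1 :> K.
Proof. exact: rmorph1. Qed.
Lemma DeltaM a b : Δ (a * b) = Δ a * Δ b.
Proof. exact: rmorphM. Qed.
Lemma Delta1 : Δ 1 = 1.
Proof. exact: rmorph1. Qed.

Lemma counit_l W (F : H -> W) h : linear F ->
  tlift (fun a b => (ε a : K) *: F b) (Δ h) = F h.
Proof.
move=> l; rewrite -[h in RHS](counitl Q) /e_id (fun_tlift (f := F)) //.
by apply: eq_tlift => a b; rewrite linear_funZ.
Qed.

Lemma counit_r W (F : H -> W) h : linear F ->
  tlift (fun a b => (ε b : K) *: F a) (Δ h) = F h.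
Proof.
move=> l; rewrite -[h in RHS](counitr Q) /id_e (fun_tlift (f := F)) //.
by apply: eq_tlift => a b; rewrite linear_funZ.
Qed.

Section Leg.
Variable E : tens (tens H H) H -> tens H H.
Hypotheses (EM : forall x y, E (x * y) = E x * E y) (E1 : E 1 = 1) (EP : E Φ = 1).
(** E stands for ε applied to one leg; being multiplicative and unital, it sends the inverse of Φ to
    1 as soon as it does so for Φ. *)
Lemma leg_PhiV : E Ψ = 1.
Proof. by rewrite -[LHS]mul1r -{1}EP -EM mulrV // Phi_unit. Qed.
End Leg.

Definition e_id_id (x : tens (tens H H) H) : tens H H :=
  tlift3 (fun a b c => (ε a : K) *: (b ⊗ c)) x.
Definition id_id_e (x : tens (tens H H) H) : tens H H :=
  tlift3 (fun a b c => (ε c : K) *: (a ⊗ b)) x.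

Lemma scale_pureM (c d : K) (a b a' b' : H) :
  (c *: (a ⊗ b)) * (d *: (a' ⊗ b')) = (c * d) *: ((a * a') ⊗ (b * b')).
Proof. by rewrite -scalerAl -scalerAr scalerA pureM. Qed.

Lemma e_id_idM x y : e_id_id (x * y) = e_id_id x * e_id_id y.
Proof.
rewrite /e_id_id tlift3M; last by lin.
move: x; apply: tlift3_ext; [by lin | by lin |] => a b c.
rewrite !trilinE; [|by lin..].
move: y; apply: tlift3_ext; [by lin | by lin |] => a' b' c'.
by rewrite !trilinE ?scale_pureM ?epsM //; lin.
Qed.
Lemma id_e_idM x y : id_e_id ε (x * y) = id_e_id ε x * id_e_id ε y.
Proof.
rewrite /id_e_id tlift3M; last by lin.
move: x; apply: tlift3_ext; [by lin | by lin |] => a b c.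
rewrite !trilinE; [|by lin..].
move: y; apply: tlift3_ext; [by lin | by lin |] => a' b' c'.
by rewrite !trilinE ?scale_pureM ?epsM //; lin.
Qed.
Lemma id_id_eM x y : id_id_e (x * y) = id_id_e x * id_id_e y.
Proof.
rewrite /id_id_e tlift3M; last by lin.
move: x; apply: tlift3_ext; [by lin | by lin |] => a b c.
rewrite !trilinE; [|by lin..].
move: y; apply: tlift3_ext; [by lin | by lin |] => a' b' c'.
by rewrite !trilinE ?scale_pureM ?epsM //; lin.
Qed.

Let e2 (x : tens (tens (tens H H) H) H) : tens (tens H H) H :=
  tlift4 (fun a b c d => (ε b : K) *: (a ⊗ c ⊗ d)) x.
Let e3 (x : tens (tens (tens H H) H) H) : tens (tens H H) H :=
  tlift4 (fun a b c d => (ε c : K) *: (a ⊗ b ⊗ d)) x.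

Let e2M x y : e2 (x * y) = e2 x * e2 y.
Proof.
rewrite /e2 tlift4M; last by lin.
move: x; apply: tlift4_ext; [by lin | by lin |] => a b c d.
rewrite !quadlinE; [|by lin..].
move: y; apply: tlift4_ext; [by lin | by lin |] => a' b' c' d'.
by rewrite !quadlinE -?scalerAl -?scalerAr ?scalerA ?pureM ?epsM //; lin.
Qed.
Let e3M x y : e3 (x * y) = e3 x * e3 y.
Proof.
rewrite /e3 tlift4M; last by lin.
move: x; apply: tlift4_ext; [by lin | by lin |] => a b c d.
rewrite !quadlinE; [|by lin..].
move: y; apply: tlift4_ext; [by lin | by lin |] => a' b' c' d'.
by rewrite !quadlinE -?scalerAl -?scalerAr ?scalerA ?pureM ?epsM //; lin.
Qed.

(** Only the middle leg is normalised by the axioms. Applying ε to the second slot of the pentagon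
    makes two factors trivial and leaves Φ = Φ (1 ⊗ (ε ⊗ id ⊗ id)(Φ)), where Φ cancels. *)
Lemma e_id_id_Phi : e_id_id Φ = 1.
Proof.
have := congr1 e2 (pentagon Q); rewrite !e2M.
have -> : e2 (D_id_id Δ Φ) = Φ.
  rewrite /e2 tlift4_D_id_id; last by lin.
  rewrite -[RHS]tlift3_pure; apply: eq_tlift3 => a b c.
  by rewrite (counit_r (F := fun a => a ⊗ b ⊗ c)) //; lin.
have <- : 1 = e2 (id_id_D Δ Φ).
  rewrite /e2 tlift4_id_id_D; last by lin.
  transitivity (tlift (fun a c => id_D Δ (a ⊗ c)) (id_e_id ε Φ)).
    rewrite Phi_counit bilinE; last by rewrite /id_D; lin.
    by rewrite /id_D bilinE ?Delta1 ?tlift1 ?pure1 //; lin.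
  rewrite /id_e_id fun_tlift3; last by rewrite /id_D; lin.
  apply: eq_tlift3 => a b c; rewrite linear_funZ; last by rewrite /id_D; lin.
  rewrite bilinE; last by rewrite /id_D; lin.
  rewrite /id_D bilinE; last by lin.
  by rewrite [LHS](fun_tlift (f := GRing.scale (ε b : K))) //; lin.
have -> : e2 (Φ ⊗ 1) = 1.
  rewrite /e2 tlift4_tens_one; last by lin.
  transitivity (id_e_id ε Φ ⊗ (1 : H)); last by rewrite Phi_counit -!pure1.
  rewrite [RHS](fun_tlift3 (f := fun x => x ⊗ (1 : H))); last by lin.
  by apply: eq_tlift3 => a b c; rewrite pureZl.
have -> : e2 (id_D_id Δ Φ) = Φ.
  rewrite /e2 tlift4_id_D_id; last by lin.
  rewrite -[RHS]tlift3_pure; apply: eq_tlift3 => a b c.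
  by rewrite (counit_l (F := fun b => a ⊗ b ⊗ c)) //; lin.
rewrite mul1r mulr1 -[LHS]mulr1 => /(mulrI (Phi_unit Q)) e.
have := congr1 e_id_id e; rewrite /e2 tlift4_one_tens; last by lin.
have -> : e_id_id 1 = 1.
  by rewrite /e_id_id tlift3_1 ?eps1 ?scale1r ?pure1 //; lin.
move=> ->; rewrite /e_id_id [RHS](fun_tlift3); last by lin.
by apply: eq_tlift3 => a b c; rewrite linear_funZ ?trilinE ?eps1 ?scale1r //; lin.
Qed.

(** Mirror image: ε in the third slot of the pentagon leaves Φ = ((id ⊗ id ⊗ ε)(Φ) ⊗ 1) Φ. *)
Lemma id_id_e_Phi : id_id_e Φ = 1.
Proof.
have := congr1 e3 (pentagon Q); rewrite !e3M.
have -> : e3 (id_id_D Δ Φ) = Φ.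
  rewrite /e3 tlift4_id_id_D; last by lin.
  rewrite -[RHS]tlift3_pure; apply: eq_tlift3 => a b c.
  by rewrite (counit_l (F := fun c => a ⊗ b ⊗ c)) //; lin.
have -> : e3 (D_id_id Δ Φ) = 1.
  rewrite /e3 tlift4_D_id_id; last by lin.
  transitivity (tlift (fun a c => D_id Δ (a ⊗ c)) (id_e_id ε Φ)); last first.
    rewrite Phi_counit bilinE; last by rewrite /D_id; lin.
    by rewrite /D_id bilinE ?Delta1 ?pure1 //; lin.
  rewrite /id_e_id fun_tlift3; last by rewrite /D_id; lin.
  apply: eq_tlift3 => a b c; rewrite linear_funZ; last by rewrite /D_id; lin.
  rewrite bilinE; last by rewrite /D_id; lin.
  rewrite /D_id bilinE; last by lin.
  rewrite -[Δ a in RHS]tlift_pure.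
  rewrite (fun_tlift (f := fun x => (ε b : K) *: (x ⊗ c))) //; by lin.
have -> : e3 (one_tens Φ) = 1.
  rewrite /e3 tlift4_one_tens; last by lin.
  transitivity (tlift (fun a c => (1 : H) ⊗ a ⊗ c) (id_e_id ε Φ)); last first.
    by rewrite Phi_counit bilinE ?pure1 //; lin.
  rewrite /id_e_id fun_tlift3; last by lin.
  by apply: eq_tlift3 => a b c; rewrite linear_funZ ?bilinE //; lin.
have -> : e3 (id_D_id Δ Φ) = Φ.
  rewrite /e3 tlift4_id_D_id; last by lin.
  rewrite -[RHS]tlift3_pure; apply: eq_tlift3 => a b c.
  by rewrite (counit_r (F := fun b => a ⊗ b ⊗ c)) //; lin.
rewrite mulr1 => /(mulIr (Phi_unit Q)) e.
have := congr1 id_id_e e; rewrite /e3 tlift4_tens_one; last by lin.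
have -> : id_id_e 1 = 1.
  by rewrite /id_id_e tlift3_1 ?eps1 ?scale1r ?pure1 //; lin.
move=> ->; rewrite /id_id_e [RHS](fun_tlift3); last by lin.
by apply: eq_tlift3 => a b c; rewrite linear_funZ ?trilinE ?eps1 ?scale1r //; lin.
Qed.

Section CounitSums.
Variables (W : lmodType K) (B : H -> H -> W).
Hypothesis Bl : bilin B.

Lemma tlift_e_id_id x :
  tlift B (e_id_id x) = tlift3 (fun a b c => (ε a : K) *: B b c) x.
Proof.
rewrite /e_id_id fun_tlift3; last by lin.
by apply: eq_tlift3 => a b c; rewrite linear_funZ ?bilinE //; lin.
Qed.
Lemma tlift_id_e_id x :
  tlift B (id_e_id ε x) = tlift3 (fun a b c => (ε b : K) *: B a c) x.
Proof.
rewrite /id_e_id fun_tlift3; last by lin.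
by apply: eq_tlift3 => a b c; rewrite linear_funZ ?bilinE //; lin.
Qed.
Lemma tlift_id_id_e x :
  tlift B (id_id_e x) = tlift3 (fun a b c => (ε c : K) *: B a b) x.
Proof.
rewrite /id_id_e fun_tlift3; last by lin.
by apply: eq_tlift3 => a b c; rewrite linear_funZ ?bilinE //; lin.
Qed.

Lemma Phi_counit1 : tlift3 (fun a b c => (ε a : K) *: B b c) Φ = B 1 1.
Proof. by rewrite -tlift_e_id_id e_id_id_Phi tlift1. Qed.
Lemma PhiV_counit1 : tlift3 (fun a b c => (ε a : K) *: B b c) Ψ = B 1 1.
Proof.
rewrite -tlift_e_id_id (leg_PhiV e_id_idM) ?tlift1 ?e_id_id_Phi //.
by rewrite /e_id_id tlift3_1 ?eps1 ?scale1r ?pure1 //; lin.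
Qed.
Lemma PhiV_counit3 : tlift3 (fun a b c => (ε c : K) *: B a b) Ψ = B 1 1.
Proof.
rewrite -tlift_id_id_e (leg_PhiV id_id_eM) ?tlift1 ?id_id_e_Phi //.
by rewrite /id_id_e tlift3_1 ?eps1 ?scale1r ?pure1 //; lin.
Qed.
End CounitSums.
End Counits.

(** * Consequences of the pentagon *)

Lemma tlift4_exchange2 (K : fieldType) (U V X Y U' V' : vectType K) (W : lmodType K)
    (F : U -> V -> X -> Y -> U' -> V' -> W) x y :
  tlift (fun u' v' => tlift4 (fun u v s t => F u v s t u' v') x) y =
  tlift4 (fun u v s t => tlift (fun u' v' => F u v s t u' v') y) x.
Proof.
rewrite /tlift4 tlift_exchange; apply: eq_tlift => uvs t.
by rewrite -tlift3_exchange2.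
Qed.

Lemma tlift4_exchange3 (K : fieldType) (U V X Y U' V' X' : vectType K) (W : lmodType K)
    (F : U -> V -> X -> Y -> U' -> V' -> X' -> W) x y :
  tlift4 (fun u v s t => tlift3 (fun u' v' s' => F u v s t u' v' s') y) x =
  tlift3 (fun u' v' s' => tlift4 (fun u v s t => F u v s t u' v' s') x) y.
Proof.
rewrite /tlift3 -tlift4_exchange2; apply: eq_tlift => u s.
by rewrite tlift4_exchange2.
Qed.

Lemma fun_tlift4 (K : fieldType) (U V X Y : vectType K) (W W' : lmodType K)
    (f : W -> W') (B : U -> V -> X -> Y -> W) x : linear f ->
  f (tlift4 B x) = tlift4 (fun u v s t => f (B u v s t)) x.
Proof.
move=> l; rewrite /tlift4 (fun_tlift (f := f)) //.
by apply: eq_tlift => uvs t; rewrite (fun_tlift3 (f := f)).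
Qed.

Lemma lin_scale (K : fieldType) (W : lmodType K) (c : K) :
  linear (fun x : W => c *: x).
Proof. exact: lin_scaler (@lin_id _ _). Qed.

Section Absorption.
Variables (K : fieldType) (H : falgType K) (Q : quasiHopf H).
Local Notation Δ := (Delta Q).
Local Notation ε := (eps Q).
Local Notation Φ := (Phi Q).
Local Notation Ψ := (Phi Q)^-1.
Local Notation S := (antip Q).
Local Notation α := (alpha Q).
Local Notation β := (beta Q).
Implicit Types (W : lmodType K).

Lemma e_id_id_PhiV : e_id_id Q Ψ = 1.
Proof.
apply: leg_PhiV (e_id_id_Phi Q); first exact: e_id_idM.
by rewrite /e_id_id tlift3_1 ?eps1 ?scale1r ?pure1 //; lin.
Qed.
Lemma id_e_id_PhiV : id_e_id ε Ψ = 1.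
Proof.
apply: leg_PhiV (Phi_counit Q); first exact: id_e_idM.
by rewrite /id_e_id tlift3_1 ?eps1 ?scale1r ?pure1 //; lin.
Qed.
Lemma id_id_e_PhiV : id_id_e Q Ψ = 1.
Proof.
apply: leg_PhiV (id_id_e_Phi Q); first exact: id_id_eM.
by rewrite /id_id_e tlift3_1 ?eps1 ?scale1r ?pure1 //; lin.
Qed.

(* A contraction F with S(-)α- or -βS(-) in two adjacent slots absorbs a
   coproduct multiplied into them.  As Φ and Ψ become 1 when ε is applied to a
   leg, this deletes a whole factor of the pentagon. *)
Section Quad.
Variables (W : lmodType K) (F : H -> H -> H -> H -> W).
Hypothesis Fl : quadlin F.
Implicit Types (x : tens (tens H H) H) (y : tens (tens (tens H H) H) H).

Lemma absorb_l12 x y : e_id_id Q x = 1 ->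
    (forall h a b c d, tlift (fun h1 h2 => F (h1 * a) (h2 * b) c d) (Δ h) =
                       (ε h : K) *: F a b c d) ->
  tlift4 F (D_id_id Δ x * y) = tlift4 F y.
Proof.
move=> x1 ab; rewrite tlift4M // tlift4_D_id_id; last by lin.
transitivity (tlift3 (fun a b c =>
  (ε a : K) *: tlift4 (fun a' b' c' d' => F a' b' (b * c') (c * d')) y) x).
  apply: eq_tlift3 => a b c.
  rewrite tlift4_exchange2 (fun_tlift4 _ _ (lin_scale _)).
  by apply: eq_tlift4 => a' b' c' d'; rewrite ab.
rewrite -(tlift_e_id_id _ (B := fun b c => tlift4 (fun a' b' c' d' => F a' b' (b * c') (c * d')) y)); last by lin.
rewrite x1 tlift1; last by lin.
by apply: eq_tlift4 => a' b' c' d'; rewrite !mul1r.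
Qed.

Lemma absorb_r12 x y : e_id_id Q x = 1 ->
    (forall h a b c d, tlift (fun h1 h2 => F (a * h1) (b * h2) c d) (Δ h) =
                       (ε h : K) *: F a b c d) ->
  tlift4 F (y * D_id_id Δ x) = tlift4 F y.
Proof.
move=> x1 ab; rewrite tlift4M //.
apply: eq_tlift4 => a' b' c' d'; rewrite tlift4_D_id_id; last by lin.
transitivity (tlift3 (fun a b c => (ε a : K) *: F a' b' (c' * b) (d' * c)) x).
  by apply: eq_tlift3 => a b c; rewrite ab.
rewrite -(tlift_e_id_id _ (B := fun b c => F a' b' (c' * b) (d' * c))); last by lin.
by rewrite x1 tlift1 ?mulr1 //; lin.
Qed.

Lemma absorb_l23 x y : id_e_id ε x = 1 ->
    (forall h a b c d, tlift (fun h1 h2 => F a (h1 * b) (h2 * c) d) (Δ h) =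
                       (ε h : K) *: F a b c d) ->
  tlift4 F (id_D_id Δ x * y) = tlift4 F y.
Proof.
move=> x1 ab; rewrite tlift4M // tlift4_id_D_id; last by lin.
transitivity (tlift3 (fun a b c =>
  (ε b : K) *: tlift4 (fun a' b' c' d' => F (a * a') b' c' (c * d')) y) x).
  apply: eq_tlift3 => a b c.
  rewrite tlift4_exchange2 (fun_tlift4 _ _ (lin_scale _)).
  by apply: eq_tlift4 => a' b' c' d'; rewrite ab.
rewrite -(tlift_id_e_id _ (B := fun a c => tlift4 (fun a' b' c' d' => F (a * a') b' c' (c * d')) y)); last by lin.
rewrite x1 tlift1; last by lin.
by apply: eq_tlift4 => a' b' c' d'; rewrite !mul1r.
Qed.

Lemma absorb_r23 x y : id_e_id ε x = 1 ->
    (forall h a b c d, tlift (fun h1 h2 => F a (b * h1) (c * h2) d) (Δ h) =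
                       (ε h : K) *: F a b c d) ->
  tlift4 F (y * id_D_id Δ x) = tlift4 F y.
Proof.
move=> x1 ab; rewrite tlift4M //.
apply: eq_tlift4 => a' b' c' d'; rewrite tlift4_id_D_id; last by lin.
transitivity (tlift3 (fun a b c => (ε b : K) *: F (a' * a) b' c' (d' * c)) x).
  by apply: eq_tlift3 => a b c; rewrite ab.
rewrite -(tlift_id_e_id _ (B := fun a c => F (a' * a) b' c' (d' * c))); last by lin.
by rewrite x1 tlift1 ?mulr1 //; lin.
Qed.

Lemma absorb_l34 x y : id_id_e Q x = 1 ->
    (forall h a b c d, tlift (fun h1 h2 => F a b (h1 * c) (h2 * d)) (Δ h) =
                       (ε h : K) *: F a b c d) ->
  tlift4 F (id_id_D Δ x * y) = tlift4 F y.
Proof.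
move=> x1 ab; rewrite tlift4M // tlift4_id_id_D; last by lin.
transitivity (tlift3 (fun a b c =>
  (ε c : K) *: tlift4 (fun a' b' c' d' => F (a * a') (b * b') c' d') y) x).
  apply: eq_tlift3 => a b c.
  rewrite tlift4_exchange2 (fun_tlift4 _ _ (lin_scale _)).
  by apply: eq_tlift4 => a' b' c' d'; rewrite ab.
rewrite -(tlift_id_id_e _ (B := fun a b => tlift4 (fun a' b' c' d' => F (a * a') (b * b') c' d') y)); last by lin.
rewrite x1 tlift1; last by lin.
by apply: eq_tlift4 => a' b' c' d'; rewrite !mul1r.
Qed.

Lemma absorb_r34 x y : id_id_e Q x = 1 ->
    (forall h a b c d, tlift (fun h1 h2 => F a b (c * h1) (d * h2)) (Δ h) =
                       (ε h : K) *: F a b c d) ->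
  tlift4 F (y * id_id_D Δ x) = tlift4 F y.
Proof.
move=> x1 ab; rewrite tlift4M //.
apply: eq_tlift4 => a' b' c' d'; rewrite tlift4_id_id_D; last by lin.
transitivity (tlift3 (fun a b c => (ε c : K) *: F (a' * a) (b' * b) c' d') x).
  by apply: eq_tlift3 => a b c; rewrite ab.
rewrite -(tlift_id_id_e _ (B := fun a b => F (a' * a) (b' * b) c' d')); last by lin.
by rewrite x1 tlift1 ?mulr1 //; lin.
Qed.

End Quad.

Lemma antip_alphaE W (G : H -> W) h : linear G ->
  tlift (fun a b => G (S a * α * b)) (Δ h) = (ε h : K) *: G α.
Proof. by move=> l; rewrite -linear_funZ // -antip_alpha (fun_tlift (f := G)). Qed.
Lemma antip_betaE W (G : H -> W) h : linear G ->
  tlift (fun a b => G (a * β * S b)) (Δ h) = (ε h : K) *: G β.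
Proof. by move=> l; rewrite -linear_funZ // -antip_beta (fun_tlift (f := G)). Qed.

Lemma coassoc_Phi W (F : H -> H -> H -> W) h : trilin F ->
  tlift (fun h1 h2 => tlift (fun h11 h12 =>
    tlift3 (fun a b c => F (h11 * a) (h12 * b) (h2 * c)) Φ) (Δ h1)) (Δ h) =
  tlift3 (fun a b c => tlift (fun h1 h2 => tlift (fun h21 h22 =>
    F (a * h1) (b * h21) (c * h22)) (Δ h2)) (Δ h)) Φ.
Proof.
move=> l; have := congr1 (tlift3 F) (coassoc Q h).
rewrite !tlift3M // tlift3_D_id; last by lin.
by move=> ->; apply: eq_tlift3 => a b c; rewrite tlift3_id_D //; lin.
Qed.

Lemma coassoc_PhiV W (F : H -> H -> H -> W) h : trilin F ->
  tlift3 (fun a b c => tlift (fun h1 h2 => tlift (fun h11 h12 =>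
    F (a * h11) (b * h12) (c * h2)) (Δ h1)) (Δ h)) Ψ =
  tlift (fun h1 h2 => tlift (fun h21 h22 =>
    tlift3 (fun a b c => F (h1 * a) (h21 * b) (h22 * c)) Ψ) (Δ h2)) (Δ h).
Proof.
move=> l; have /(congr1 (fun z => Ψ * z * Ψ)) := coassoc Q h.
rewrite mulrA mulrK ?Phi_unit // mulKr ?Phi_unit // => /(congr1 (tlift3 F)).
rewrite !tlift3M // tlift3_id_D; last by lin.
by move=> <-; apply: eq_tlift3 => a b c; rewrite tlift3_D_id //; lin.
Qed.

(* qR and pR are the right-handed versions of q^L and p^L; pLS is p^L with S
   applied to its first leg, so that S^-1 does not occur. *)
Definition qR : tens H H := tlift3 (fun a b c => a ⊗ (S b * α * c)) Ψ.
Definition pR : tens H H := tlift3 (fun a b c => a ⊗ (b * β * S c)) Φ.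
Definition pLS : tens H H := tlift3 (fun a b c => (a * β * S b) ⊗ c) Ψ.

Section Bil.
Variables (W : lmodType K) (B : H -> H -> W).
Hypothesis Bl : bilin B.

Lemma tlift_qR : tlift B qR = tlift3 (fun a b c => B a (S b * α * c)) Ψ.
Proof.
by rewrite /qR fun_tlift3; [apply: eq_tlift3 => a b c; rewrite bilinE|lin].
Qed.
Lemma tlift_pR : tlift B pR = tlift3 (fun a b c => B a (b * β * S c)) Φ.
Proof.
by rewrite /pR fun_tlift3; [apply: eq_tlift3 => a b c; rewrite bilinE|lin].
Qed.
Lemma tlift_qL : tlift B (qL Q) = tlift3 (fun a b c => B (S a * α * b) c) Φ.
Proof.
by rewrite /qL fun_tlift3; [apply: eq_tlift3 => a b c; rewrite bilinE|lin].
Qed.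
Lemma tlift_pLS : tlift B pLS = tlift3 (fun a b c => B (a * β * S b) c) Ψ.
Proof.
by rewrite /pLS fun_tlift3; [apply: eq_tlift3 => a b c; rewrite bilinE|lin].
Qed.
End Bil.

End Absorption.

(** * Covariance of the q and p elements, and rearranged pentagons *)

Section Identities.
Variables (K : fieldType) (H : falgType K) (Q : quasiHopf H).
Local Notation Δ := (Delta Q).
Local Notation ε := (eps Q).
Local Notation Φ := (Phi Q).
Local Notation Ψ := (Phi Q)^-1.
Local Notation S := (antip Q).
Local Notation α := (alpha Q).
Local Notation β := (beta Q).
Implicit Types (W : lmodType K).

Section Bil.
Variables (W : lmodType K) (B : H -> H -> W).
Hypothesis Bl : bilin B.

(** Quasi-coassociativity carries the coproducts of h to the other side of Ψ, where S(h_21) α h_22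
    appears in the second leg and collapses to ε(h_2) α. The three covariances below follow the same
    pattern, with β for the p elements. *)
Lemma qR_cov h :
  tlift (fun h1 h2 => tlift (fun x y =>
    tlift (fun a b => B (a * x) (S y * b * h2)) (qR Q)) (Δ h1)) (Δ h) =
  tlift (fun a b => B (h * a) b) (qR Q).
Proof.
have Fl : trilin (fun a b c : H => B a (S b * α * c)) by lin.
have e := coassoc_PhiV Q h Fl.
transitivity (tlift (fun h1 h2 => tlift3 (fun a b c => tlift (fun x y =>
  B (a * x) (S (b * y) * α * (c * h2))) (Δ h1)) Ψ) (Δ h)).
  apply: eq_tlift => h1 h2; rewrite tlift3_exchange2; apply: eq_tlift => x y.
  rewrite tlift_qR; last by lin.
  by apply: eq_tlift3 => a b c; rewrite antipM !mulrA.
rewrite -tlift3_exchange2 e tlift_qR; last by lin.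
transitivity (tlift (fun h1 h2 => (ε h2 : K) *:
   tlift3 (fun a b c => B (h1 * a) (S b * α * c)) Ψ) (Δ h)); last first.
  by rewrite (counit_r Q (F := fun h => tlift3 (fun a b c => B (h * a) (S b * α * c)) Ψ)) //; lin.
apply: eq_tlift => h1 h2; rewrite -tlift3_exchange2.
rewrite (fun_tlift3 _ _ (lin_scale _)); apply: eq_tlift3 => a b c.
rewrite -(antip_alphaE Q _ (G := fun z => B (h1 * a) (S b * z * c))); last by lin.
by apply: eq_tlift => x y; rewrite antipM !mulrA.
Qed.

Lemma pR_cov h :
  tlift (fun h1 h2 => tlift (fun x y =>
    tlift (fun a b => B (x * a) (y * b * S h2)) (pR Q)) (Δ h1)) (Δ h) =
  tlift (fun a b => B (a * h) b) (pR Q).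
Proof.
have Fl : trilin (fun a b c : H => B a (b * β * S c)) by lin.
transitivity (tlift (fun h1 h2 => tlift (fun h11 h12 => tlift3 (fun a b c =>
  B (h11 * a) (h12 * b * β * S (h2 * c))) Φ) (Δ h1)) (Δ h)).
  apply: eq_tlift => h1 h2; apply: eq_tlift => x y.
  rewrite tlift_pR; last by lin.
  by apply: eq_tlift3 => a b c; rewrite antipM !mulrA.
rewrite (coassoc_Phi Q h Fl) tlift_pR; last by lin.
apply: eq_tlift3 => a b c.
rewrite -(counit_r Q (F := fun h => B (a * h) (b * β * S c)) _); last by lin.
apply: eq_tlift => h1 h2.
rewrite -(antip_betaE Q _ (G := fun z => B (a * h1) (b * z * S c))); last by lin.
by apply: eq_tlift => x y; rewrite antipM !mulrA.
Qed.

Lemma qL_cov h :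
  tlift (fun h1 h2 => tlift (fun x y =>
    tlift (fun a b => B (S h1 * a * x) (b * y)) (qL Q)) (Δ h2)) (Δ h) =
  tlift (fun a b => B a (h * b)) (qL Q).
Proof.
have Fl : trilin (fun a b c : H => B (S a * α * b) c) by lin.
transitivity (tlift3 (fun a b c => tlift (fun h1 h2 => tlift (fun x y =>
  B (S (a * h1) * α * (b * x)) (c * y)) (Δ h2)) (Δ h)) Φ).
  rewrite tlift3_exchange2; apply: eq_tlift => h1 h2.
  rewrite tlift3_exchange2; apply: eq_tlift => x y.
  rewrite tlift_qL; last by lin.
  by apply: eq_tlift3 => a b c; rewrite antipM !mulrA.
rewrite -(coassoc_Phi Q h Fl) tlift_qL; last by lin.
rewrite -(counit_l Q (F := fun h => tlift3 (fun a b c => B (S a * α * b) (h * c)) Φ)); last by lin.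
apply: eq_tlift => h1 h2; rewrite -tlift3_exchange2.
rewrite (fun_tlift3 _ _ (lin_scale _)); apply: eq_tlift3 => a b c.
rewrite -(antip_alphaE Q _ (G := fun z => B (S a * z * b) (h2 * c))); last by lin.
by apply: eq_tlift => x y; rewrite antipM !mulrA.
Qed.

Lemma pLS_cov h :
  tlift (fun h1 h2 => tlift (fun x y =>
    tlift (fun u v => B (h1 * u * S x) (y * v)) (pLS Q)) (Δ h2)) (Δ h) =
  tlift (fun u v => B u (v * h)) (pLS Q).
Proof.
have Fl : trilin (fun a b c : H => B (a * β * S b) c) by lin.
transitivity (tlift (fun h1 h2 => tlift (fun x y => tlift3 (fun a b c =>
  B (h1 * a * β * S (x * b)) (y * c)) Ψ) (Δ h2)) (Δ h)).
  apply: eq_tlift => h1 h2; apply: eq_tlift => x y.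
  rewrite tlift_pLS; last by lin.
  by apply: eq_tlift3 => a b c; rewrite antipM !mulrA.
rewrite -(coassoc_PhiV Q h Fl) tlift_pLS; last by lin.
apply: eq_tlift3 => a b c.
rewrite -(counit_l Q (F := fun h => B (a * β * S b) (c * h))); last by lin.
apply: eq_tlift => h1 h2.
rewrite -(antip_betaE Q _ (G := fun z => B (a * z * S b) (c * h2))); last by lin.
by apply: eq_tlift => x y; rewrite antipM !mulrA.
Qed.
End Bil.

Lemma D_id_id_PhiVK : D_id_id Δ Ψ * D_id_id Δ Φ = 1.
Proof. by rewrite -D_id_idM mulVr ?Phi_unit // D_id_id1. Qed.
Lemma id_D_id_PhiVK : id_D_id Δ Ψ * id_D_id Δ Φ = 1.
Proof. by rewrite -id_D_idM mulVr ?Phi_unit // id_D_id1. Qed.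
Lemma id_D_id_PhiK : id_D_id Δ Φ * id_D_id Δ Ψ = 1.
Proof. by rewrite -id_D_idM mulrV ?Phi_unit // id_D_id1. Qed.
Lemma id_id_D_PhiVK : id_id_D Δ Ψ * id_id_D Δ Φ = 1.
Proof. by rewrite -id_id_DM mulVr ?Phi_unit // id_id_D1. Qed.
Lemma id_id_D_PhiK : id_id_D Δ Φ * id_id_D Δ Ψ = 1.
Proof. by rewrite -id_id_DM mulrV ?Phi_unit // id_id_D1. Qed.
Lemma one_tens_PhiK : one_tens Φ * one_tens Ψ = 1 :> tens (tens (tens H H) H) H.
Proof. by rewrite -one_tensM mulrV ?Phi_unit // one_tens1. Qed.
Lemma tens_one_PhiVK : (Ψ ⊗ 1) * (Φ ⊗ 1) = 1 :> tens (tens (tens H H) H) H.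
Proof. by rewrite pureM mulVr ?Phi_unit // mulr1 pure1. Qed.
Lemma tens_one_PhiK : (Φ ⊗ 1) * (Ψ ⊗ 1) = 1 :> tens (tens (tens H H) H) H.
Proof. by rewrite pureM mulrV ?Phi_unit // mulr1 pure1. Qed.

(** Each rearrangement is named after the zigzag it yields. One side has two factors, which contract
    to a q and a p element; the other side consists of factors that the same contraction absorbs or
    evaluates to 1. *)
Lemma pentagon_pR_qR :
  (Ψ ⊗ 1) * D_id_id Δ Φ = id_D_id Δ Φ * (one_tens Φ * id_id_D Δ Ψ).
Proof.
have := congr1 (fun z => (Ψ ⊗ 1) * z * id_id_D Δ Ψ) (pentagon Q).
by rewrite /= -!mulrA id_id_D_PhiK mulr1 => ->; rewrite !mulrA tens_one_PhiVK mul1r.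
Qed.

Lemma pentagonV :
  id_id_D Δ Ψ * D_id_id Δ Ψ = one_tens Ψ * (id_D_id Δ Ψ * (Ψ ⊗ 1)).
Proof.
have e1 : (id_id_D Δ Ψ * D_id_id Δ Ψ) * (D_id_id Δ Φ * id_id_D Δ Φ) = 1.
  by rewrite mulrA -(mulrA (id_id_D _ _)) D_id_id_PhiVK mulr1 id_id_D_PhiVK.
have e2 : (D_id_id Δ Φ * id_id_D Δ Φ) *
    (one_tens Ψ * (id_D_id Δ Ψ * (Ψ ⊗ 1))) = 1.
  rewrite pentagon !mulrA -(mulrA _ (one_tens Φ)) one_tens_PhiK mulr1.
  by rewrite -(mulrA (Φ ⊗ 1)) id_D_id_PhiK mulr1 tens_one_PhiK.
by rewrite -[RHS]mul1r -e1 -mulrA e2 mulr1.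
Qed.

Lemma pentagon_qR_pR :
  D_id_id Δ Ψ * (Φ ⊗ 1) = id_id_D Δ Φ * (one_tens Ψ * id_D_id Δ Ψ).
Proof.
have := congr1 (fun z => id_id_D Δ Φ * z * (Φ ⊗ 1)) pentagonV.
by rewrite /= -!mulrA tens_one_PhiVK mulr1 => <-; rewrite !mulrA id_id_D_PhiK mul1r.
Qed.

Lemma pentagon_qL_pL :
  id_id_D Δ Φ * one_tens Ψ = D_id_id Δ Ψ * ((Φ ⊗ 1) * id_D_id Δ Φ).
Proof.
have := congr1 (fun z => D_id_id Δ Ψ * z * one_tens Ψ) (pentagon Q).
by rewrite /= -!mulrA one_tens_PhiK mulr1 => <-; rewrite !mulrA D_id_id_PhiVK mul1r.
Qed.

Lemma pentagon_pL_qL :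
  one_tens Φ * id_id_D Δ Ψ = id_D_id Δ Ψ * ((Ψ ⊗ 1) * D_id_id Δ Φ).
Proof. by rewrite pentagon_pR_qR !mulrA id_D_id_PhiVK mul1r. Qed.
End Identities.

(** * Zigzag identities and the nested evaluation *)

Section Zigzags.
Variables (K : fieldType) (H : falgType K) (Q : quasiHopf H).
Local Notation Δ := (Delta Q).
Local Notation ε := (eps Q).
Local Notation Φ := (Phi Q).
Local Notation Ψ := (Phi Q)^-1.
Local Notation S := (antip Q).
Local Notation α := (alpha Q).
Local Notation β := (beta Q).
Implicit Types (W : lmodType K).

Lemma antip_PhiE W (G : H -> W) : linear G ->
  tlift3 (fun a b c => G (S a * α * b * β * S c)) Φ = G 1.
Proof. by move=> l; rewrite -(antip_Phi Q) (fun_tlift3 (f := G)). Qed.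
Lemma antip_PhiVE W (G : H -> W) : linear G ->
  tlift3 (fun a b c => G (a * β * S b * α * c)) Ψ = G 1.
Proof. by move=> l; rewrite -(antip_PhiV Q) (fun_tlift3 (f := G)). Qed.

Section Bil.
Variables (W : lmodType K) (B : H -> H -> W).
Hypothesis Bl : bilin B.

(** The last three slots of the pentagon are contracted by S(-) α (-) β S(-). Of the three factors
    on one side, α absorbs the first and β the last, while 1 ⊗ Φ contributes S(Φ_1) α Φ_2 β S(Φ_3) =
    1; the other side spells out [qR] and [pR]. The remaining zigzags differ only in the contraction
    chosen. They are the triangle identities for left duals, in element form. *)
Lemma zigzag_pR_qR :
  tlift (fun p1 p2 => tlift (fun x y =>
    tlift (fun a b => B (a * x) (S y * b * p2)) (qR Q)) (Δ p1)) (pR Q) = B 1 1.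
Proof.
have Fl : quadlin (fun a b c d : H => B a (S b * α * c * β * S d)) by lin.
have := congr1 (tlift4 (fun a b c d : H => B a (S b * α * c * β * S d)))
  (pentagon_pR_qR Q).
rewrite (absorb_l23 Fl _ (Phi_counit Q)); last first.
  move=> h a b c d.
  rewrite -(antip_alphaE Q _ (G := fun z => B a (S b * z * c * β * S d))); last by lin.
  by apply: eq_tlift => x y; rewrite antipM !mulrA.
rewrite (absorb_r34 Fl _ (id_id_e_PhiV Q)); last first.
  move=> h a b c d.
  rewrite -(antip_betaE Q _ (G := fun z => B a (S b * α * c * z * S d))); last by lin.
  by apply: eq_tlift => x y; rewrite antipM !mulrA.
rewrite tlift4_one_tens // antip_PhiE; last by lin.
move=> <-; rewrite tlift4M // tlift4_tens_one; last by lin.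
under eq_tlift3 => a b c do (rewrite tlift4_D_id_id; last by lin).
rewrite tlift3_exchange tlift_pR; last by lin.
apply: eq_tlift3 => a b c; rewrite tlift3_exchange2; apply: eq_tlift => x y.
rewrite tlift_qR; last by lin.
by apply: eq_tlift3 => a' b' c'; rewrite mul1r antipM !mulrA.
Qed.

Lemma zigzag_qR_pR :
  tlift (fun a b => tlift (fun x y =>
    tlift (fun p1 p2 => B (x * p1) (y * p2 * b)) (pR Q)) (Δ a)) (qR Q) = B 1 1.
Proof.
have Fl : quadlin (fun a b c d : H => B a (b * β * S c * α * d)) by lin.
have := congr1 (tlift4 (fun a b c d : H => B a (b * β * S c * α * d)))
  (pentagon_qR_pR Q).
rewrite (absorb_l34 Fl _ (id_id_e_Phi Q)); last first.
  move=> h a b c d.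
  rewrite -(antip_alphaE Q _ (G := fun z => B a (b * β * S c * z * d))); last by lin.
  by apply: eq_tlift => x y; rewrite antipM !mulrA.
rewrite (absorb_r23 Fl _ (id_e_id_PhiV Q)); last first.
  move=> h a b c d.
  rewrite -(antip_betaE Q _ (G := fun z => B a (b * z * S c * α * d))); last by lin.
  by apply: eq_tlift => x y; rewrite antipM !mulrA.
rewrite tlift4_one_tens // antip_PhiVE; last by lin.
move=> <-; rewrite tlift4M // tlift4_D_id_id; last by lin.
rewrite tlift_qR; last by lin.
apply: eq_tlift3 => a b c; apply: eq_tlift => x y.
rewrite tlift4_tens_one; last by lin.
rewrite tlift_pR; last by lin.
by apply: eq_tlift3 => a' b' c'; rewrite mulr1 antipM !mulrA.
Qed.

Lemma zigzag_qL_pL :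
  tlift (fun a b => tlift (fun x y =>
    tlift (fun u v => B (a * u * S x) (y * v)) (pLS Q)) (Δ b)) (qL Q) = B 1 1.
Proof.
have Fl : quadlin (fun a b c d : H => B (S a * α * b * β * S c) d) by lin.
have := congr1 (tlift4 (fun a b c d : H => B (S a * α * b * β * S c) d))
  (pentagon_qL_pL Q).
rewrite (absorb_l12 Fl _ (e_id_id_PhiV Q)); last first.
  move=> h a b c d.
  rewrite -(antip_alphaE Q _ (G := fun z => B (S a * z * b * β * S c) d)); last by lin.
  by apply: eq_tlift => x y; rewrite antipM !mulrA.
rewrite (absorb_r23 Fl _ (Phi_counit Q)); last first.
  move=> h a b c d.
  rewrite -(antip_betaE Q _ (G := fun z => B (S a * α * b * z * S c) d)); last by lin.
  by apply: eq_tlift => x y; rewrite antipM !mulrA.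
rewrite tlift4_tens_one // (antip_PhiE (G := fun z => B z 1)); last by lin.
move=> <-; rewrite tlift4M // tlift4_id_id_D; last by lin.
rewrite tlift_qL; last by lin.
apply: eq_tlift3 => a b c; apply: eq_tlift => x y.
rewrite tlift4_one_tens; last by lin.
rewrite tlift_pLS; last by lin.
by apply: eq_tlift3 => a' b' c'; rewrite mulr1 antipM !mulrA.
Qed.

Lemma zigzag_pL_qL :
  tlift (fun u v => tlift (fun x y =>
    tlift (fun a b => B (u * a * x) (b * y)) (qL Q)) (Δ v)) (pLS Q) = B 1 1.
Proof.
have Fl : quadlin (fun a b c d : H => B (a * β * S b * α * c) d) by lin.
have := congr1 (tlift4 (fun a b c d : H => B (a * β * S b * α * c) d))
  (pentagon_pL_qL Q).
rewrite (absorb_l23 Fl _ (id_e_id_PhiV Q)); last first.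
  move=> h a b c d.
  rewrite -(antip_alphaE Q _ (G := fun z => B (a * β * S b * z * c) d)); last by lin.
  by apply: eq_tlift => x y; rewrite antipM !mulrA.
rewrite (absorb_r12 Fl _ (e_id_id_Phi Q)); last first.
  move=> h a b c d.
  rewrite -(antip_betaE Q _ (G := fun z => B (a * z * S b * α * c) d)); last by lin.
  by apply: eq_tlift => x y; rewrite antipM !mulrA.
rewrite tlift4_tens_one // (antip_PhiVE (G := fun z => B z 1)); last by lin.
move=> <-; rewrite tlift4M // tlift4_one_tens; last by lin.
under eq_tlift3 => a b c do (rewrite tlift4_id_id_D; last by lin).
rewrite tlift3_exchange tlift_pLS; last by lin.
apply: eq_tlift3 => a b c; rewrite tlift3_exchange2; apply: eq_tlift => x y.
rewrite tlift_qL; last by lin.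
by apply: eq_tlift3 => a' b' c'; rewrite mul1r antipM !mulrA.
Qed.
End Bil.

(* The nested evaluation is gamma followed by the two pairings, so gamma is
   f Δ(α) for a Drinfeld twist f. *)
Definition gamma : tens H H :=
  tlift4 (fun a b c d => (S b * α * c) ⊗ (S a * α * d))
    (one_tens Φ * id_id_D Δ Ψ).

Section BilGamma.
Variables (W : lmodType K) (B : H -> H -> W).
Hypothesis Bl : bilin B.

Lemma tlift_gamma : tlift B gamma =
  tlift4 (fun a b c d => B (S b * α * c) (S a * α * d)) (one_tens Φ * id_id_D Δ Ψ).
Proof.
by rewrite /gamma fun_tlift4; [apply: eq_tlift4 => a b c d; rewrite bilinE|lin].
Qed.
End BilGamma.

Section GammaIdentities.
Variables (W : lmodType K) (B : H -> H -> W).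
Hypothesis Bl : bilin B.

Let C := fun a b c d : H => B (S b * α * c) (S a * α * d).
Let Cl : quadlin C. Proof. by rewrite /C; lin. Qed.
Let C_l23 h a b c d : tlift (fun h1 h2 => C a (h1 * b) (h2 * c) d) (Δ h) =
  (ε h : K) *: C a b c d.
Proof.
rewrite /C -(antip_alphaE Q _ (G := fun z => B (S b * z * c) (S a * α * d))); last by lin.
by apply: eq_tlift => x y; rewrite antipM !mulrA.
Qed.

Lemma gamma_qL : tlift B gamma =
  tlift3 (fun a b c => tlift (fun x y => tlift (fun u v =>
    B (S b * u * x) (S a * α * v * y)) (qL Q)) (Δ c)) Ψ.
Proof.
rewrite (tlift_gamma Bl) tlift4M // tlift4_one_tens; last by lin.
under eq_tlift3 => a b c do (rewrite tlift4_id_id_D; last by lin).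
rewrite tlift3_exchange; apply: eq_tlift3 => a b c.
rewrite tlift3_exchange2; apply: eq_tlift => x y.
rewrite tlift_qL; last by lin.
by apply: eq_tlift3 => a' b' c'; rewrite mul1r antipM !mulrA.
Qed.

(** The inner α absorbs a factor (id ⊗ Δ ⊗ id)(Φ) on the left, so the other side of the pentagon
    contracts to [gamma] as well. This is the form that matches a nested right evaluation in
    [pivot_gamma]. *)
Lemma gamma_alt : tlift B gamma =
  tlift3 (fun a b c => tlift (fun x y => tlift3 (fun a' b' c' =>
    B (S (b' * y) * α * (c' * b)) (S (a' * x) * α * c)) Ψ) (Δ a)) Φ.
Proof.
rewrite (tlift_gamma Bl) -/C.
have <- : tlift4 C ((Ψ ⊗ 1) * D_id_id Δ Φ) = tlift4 C (one_tens Φ * id_id_D Δ Ψ).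
  by rewrite pentagon_pR_qR (absorb_l23 Cl _ (Phi_counit Q)).
rewrite tlift4M // tlift4_tens_one; last by lin.
under eq_tlift3 => a b c do (rewrite tlift4_D_id_id; last by lin).
rewrite tlift3_exchange; apply: eq_tlift3 => a b c.
rewrite tlift3_exchange2; apply: eq_tlift => x y.
by apply: eq_tlift3 => a' b' c'; rewrite mul1r.
Qed.

(** Multiplication by (Δ ⊗ id ⊗ id)(Ψ) completes the inverse pentagon, and after absorption only Ψ ⊗
    1 survives. Its contraction is [qR] with the legs exchanged and S(-) α applied to the first
    one. *)
Lemma gamma_qR :
  tlift3 (fun a b c => tlift (fun x y => tlift (fun u v =>
    B (S y * u * b) (S x * v * c)) gamma) (Δ a)) Ψ =
  tlift (fun a b => B b (S a * α)) (qR Q).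
Proof.
have e : tlift4 C (one_tens Φ * id_id_D Δ Ψ * D_id_id Δ Ψ) = tlift4 C (Ψ ⊗ 1).
  rewrite -mulrA pentagonV mulrA one_tens_PhiK mul1r.
  by rewrite (absorb_l23 Cl _ (id_e_id_PhiV Q)).
rewrite tlift_qR; last by lin.
transitivity (tlift4 C (Ψ ⊗ 1)); last first.
  by rewrite tlift4_tens_one //; apply: eq_tlift3 => a b c; rewrite /C mulr1.
rewrite -e tlift4M //.
under [RHS]eq_tlift4 => a b c d do (rewrite tlift4_D_id_id; last by lin).
rewrite tlift4_exchange3; apply: eq_tlift3 => a b c.
rewrite -tlift4_exchange2; apply: eq_tlift => x y.
rewrite tlift_gamma; last by lin.
by apply: eq_tlift4 => a' b' c' d'; rewrite /C !antipM !mulrA.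
Qed.
End GammaIdentities.
End Zigzags.

(** * The Drinfeld twist *)

(** The passage from an equation in a tensor product algebra to sumless notation, used to replace a
    single tensor factor by its legs. *)
Lemma tens_expand (K : fieldType) (U V : vectType K) (W : lmodType K)
    (f : tens U V -> W) x :
  linear f -> f x = tlift (fun a b => f (a ⊗ b)) x.
Proof. by move=> l; rewrite -[x in LHS]tlift_pure (fun_tlift (f := f)). Qed.

Section RingForms.
Variables (K : fieldType) (H : falgType K) (Q : quasiHopf H).
Local Notation Δ := (Delta Q).
Local Notation ε := (eps Q).
Local Notation Ψ := (Phi Q)^-1.
Local Notation S := (antip Q).
Local Notation α := (alpha Q).
Local Notation β := (beta Q).
Local Notation T := ((antip Q)^-1)%VF.
Local Notation qL := (qL Q).
Local Notation qR := (qR Q).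
Local Notation pR := (pR Q).
Local Notation pLS := (pLS Q).
Implicit Types (W : lmodType K).

Lemma antipK h : T (S h) = h.
Proof.
apply: lker0_lfunK; apply/lker0P; exact: bij_inj (antip_bij Q).
Qed.
Lemma antipVK h : S (T h) = h.
Proof.
by have [S' _ SK] := antip_bij Q; rewrite -[h]SK antipK.
Qed.
Lemma antipVM a b : T (a * b) = T b * T a.
Proof. by rewrite -[a in LHS]antipVK -[b in LHS]antipVK -antipM antipK. Qed.
Lemma antipV1 : T 1 = 1.
Proof. by rewrite -[1 in LHS](antip1 Q) antipK. Qed.

Lemma bilin_pure : bilin (fun a b : H => a ⊗ b).
Proof. by lin. Qed.

Lemma qL_covE h :
  tlift (fun h1 h2 => (S h1 ⊗ 1) * qL * Δ h2) (Δ h) = (1 ⊗ h) * qL.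
Proof.
rewrite (tens_expand (f := fun z => (1 ⊗ h) * z)); last by lin.
transitivity (tlift (fun a b : H => a ⊗ (h * b)) qL); last first.
  by apply: eq_tlift => a b; rewrite pureM mul1r.
rewrite -(qL_cov Q bilin_pure); apply: eq_tlift => h1 h2.
rewrite (tens_expand (f := fun z => (S h1 ⊗ 1) * qL * z)); last by lin.
apply: eq_tlift => x y.
rewrite (tens_expand (f := fun z => (S h1 ⊗ 1) * z * (x ⊗ y))); last by lin.
by apply: eq_tlift => a b; rewrite !pureM mul1r.
Qed.

Lemma pR_covE h :
  tlift (fun h1 h2 => Δ h1 * pR * (1 ⊗ S h2)) (Δ h) = pR * (h ⊗ 1).
Proof.
rewrite (tens_expand (f := fun z => z * (h ⊗ 1))); last by lin.
transitivity (tlift (fun a b : H => (a * h) ⊗ b) pR); last first.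
  by apply: eq_tlift => a b; rewrite pureM mulr1.
rewrite -(pR_cov Q bilin_pure); apply: eq_tlift => h1 h2.
rewrite (tens_expand (f := fun z => z * pR * (1 ⊗ S h2))); last by lin.
apply: eq_tlift => x y.
rewrite (tens_expand (f := fun z => (x ⊗ y) * z * (1 ⊗ S h2))); last by lin.
by apply: eq_tlift => a b; rewrite !pureM mulr1.
Qed.

Lemma zigzag_qR_pRE : tlift (fun a b => Δ a * pR * (1 ⊗ b)) qR = 1.
Proof.
rewrite -pure1 -(zigzag_qR_pR Q bilin_pure); apply: eq_tlift => a b.
rewrite (tens_expand (f := fun z => z * pR * (1 ⊗ b))); last by lin.
apply: eq_tlift => x y.
rewrite (tens_expand (f := fun z => (x ⊗ y) * z * (1 ⊗ b))); last by lin.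
by apply: eq_tlift => p1 p2; rewrite !pureM mulr1.
Qed.

Lemma zigzag_pL_qLE : tlift (fun u v => (u ⊗ 1) * qL * Δ v) pLS = 1.
Proof.
rewrite -pure1 -(zigzag_pL_qL Q bilin_pure); apply: eq_tlift => u v.
rewrite (tens_expand (f := fun z => (u ⊗ 1) * qL * z)); last by lin.
apply: eq_tlift => x y.
rewrite (tens_expand (f := fun z => (u ⊗ 1) * z * (x ⊗ y))); last by lin.
by apply: eq_tlift => a b; rewrite !pureM mul1r.
Qed.

Lemma zigzag_qL_pLE :
  tlift (fun a b => tlift (fun u v => Δ b * (T (a * u) ⊗ v)) pLS) qL = 1.
Proof.
have Bl : bilin (fun a b : H => T a ⊗ b) by lin.
rewrite -pure1 -[X in _ = X ⊗ _]antipV1 -(zigzag_qL_pL Q Bl); apply: eq_tlift => a b.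
rewrite tlift_exchange; apply: eq_tlift => u v.
rewrite (tens_expand (f := fun z => z * (T (a * u) ⊗ v))); last by lin.
by apply: eq_tlift => x y; rewrite pureM [T (_ * S _)]antipVM antipK.
Qed.

Lemma gammaE : gamma Q =
  tlift3 (fun a b c => (S b ⊗ (S a * α)) * qL * Δ c) Ψ.
Proof.
rewrite -[LHS]tlift_pure (gamma_qL Q bilin_pure); apply: eq_tlift3 => a b c.
rewrite (tens_expand (f := fun z => (S b ⊗ (S a * α)) * qL * z)); last by lin.
apply: eq_tlift => x y.
rewrite (tens_expand (f := fun z => (S b ⊗ (S a * α)) * z * (x ⊗ y))); last by lin.
by apply: eq_tlift => u v; rewrite !pureM.
Qed.

(** S ⊗ S composed with the flip, so that (S ⊗ S)(Δ^cop(h)) is [SS (Δ h)]. It reverses products, and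
    [TT] is its inverse. *)
Definition SS (x : tens H H) : tens H H := tlift (fun a b => S b ⊗ S a) x.

Lemma SSE a b : SS (a ⊗ b) = S b ⊗ S a.
Proof. by rewrite /SS bilinE //; lin. Qed.
Lemma SSM x y : SS (x * y) = SS y * SS x.
Proof.
move: x; apply: tlift_ext; [by rewrite /SS; lin | by rewrite /SS; lin |] => a b.
move: y; apply: tlift_ext; [by rewrite /SS; lin | by rewrite /SS; lin |] => a' b'.
by rewrite pureM !SSE pureM !antipM.
Qed.
Lemma SS1 : SS 1 = 1.
Proof. by rewrite -pure1 SSE antip1 pure1. Qed.

Definition TT (x : tens H H) : tens H H := tlift (fun a b => T b ⊗ T a) x.
Lemma TTE a b : TT (a ⊗ b) = T b ⊗ T a.
Proof. by rewrite /TT bilinE //; lin. Qed.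
Lemma TTM x y : TT (x * y) = TT y * TT x.
Proof.
move: x; apply: tlift_ext; [by rewrite /TT; lin | by rewrite /TT; lin |] => a b.
move: y; apply: tlift_ext; [by rewrite /TT; lin | by rewrite /TT; lin |] => a' b'.
by rewrite pureM !TTE pureM !antipVM.
Qed.
Lemma TTK x : TT (SS x) = x.
Proof.
move: x; apply: tlift_ext; [by rewrite /SS /TT; lin | by lin |] => a b.
by rewrite SSE TTE !antipK.
Qed.

(* The nested coevaluation, just as gamma is the nested evaluation. *)
Definition delta0 : tens H H :=
  tlift3 (fun a b c => Δ a * pR * ((β * S c) ⊗ S b)) Ψ.

(** The analogue of h_1 β S(h_2) = ε(h) β one tensor level up. It is proved from the formula for
    [delta0], since [Delta_beta] depends on it. *)
Lemma delta0_cov h :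
  tlift (fun h1 h2 => Δ h1 * delta0 * SS (Δ h2)) (Δ h) = (ε h : K) *: delta0.
Proof.
have Fl : trilin (fun a b c : H => Δ a * pR * ((β * S c) ⊗ S b)) by lin.
transitivity (tlift (fun h1 h2 => tlift (fun x y => tlift3 (fun a b c =>
   Δ (h1 * a) * pR * ((β * S (y * c)) ⊗ S (x * b))) Ψ) (Δ h2)) (Δ h)).
  apply: eq_tlift => h1 h2.
  rewrite /SS (fun_tlift (f := fun z => Δ h1 * delta0 * z)); last by lin.
  apply: eq_tlift => x y.
  rewrite /delta0 (fun_tlift3 (f := fun z => Δ h1 * z * (S y ⊗ S x))); last by lin.
  by apply: eq_tlift3 => a b c; rewrite DeltaM !antipM -!mulrA pureM !mulrA.
rewrite -(coassoc_PhiV Q h Fl) /delta0 (fun_tlift3 _ _ (lin_scale _)).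
apply: eq_tlift3 => a b c.
transitivity (tlift (fun h1 h2 => Δ a * pR * ((h1 * β * S h2 * S c) ⊗ S b)) (Δ h)).
  apply: eq_tlift => h1 h2.
  transitivity (Δ a * (pR * (h1 ⊗ 1)) * ((β * S h2 * S c) ⊗ S b)); last first.
    by rewrite -!mulrA pureM mul1r !mulrA.
  rewrite -pR_covE.
  rewrite (fun_tlift (f := fun z => Δ a * z * ((β * S h2 * S c) ⊗ S b))); last by lin.
  apply: eq_tlift => x y.
  by rewrite DeltaM !antipM -!mulrA pureM mul1r.
rewrite -(antip_betaE Q _ (G := fun z => Δ a * pR * ((z * S c) ⊗ S b))) //; by lin.
Qed.
End RingForms.

Section Twist.
Variables (K : fieldType) (H : falgType K) (Q : quasiHopf H).
Local Notation Δ := (Delta Q).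
Local Notation ε := (eps Q).
Local Notation Φ := (Phi Q).
Local Notation Ψ := (Phi Q)^-1.
Local Notation S := (antip Q).
Local Notation α := (alpha Q).
Local Notation β := (beta Q).
Local Notation T := ((antip Q)^-1)%VF.
Local Notation qL := (qL Q).
Local Notation qR := (qR Q).
Local Notation pR := (pR Q).
Local Notation pL := (pL Q).
Local Notation pLS := (pLS Q).
Local Notation SS := (SS Q).
Local Notation TT := (TT Q).
Implicit Types (W : lmodType K).

Variable f : tens H H.
Hypothesis f_unit : f \is a GRing.unit.
Hypothesis f_antip : forall h, f * Δ (S h) = SS (Δ h) * f.
Hypothesis f_alpha : f * Δ α = gamma Q.

Lemma pLE : pL = tlift (fun u v => T u ⊗ v) pLS.
Proof.
rewrite /pLS fun_tlift3; last by lin.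
apply: eq_tlift3 => a b c; rewrite bilinE; last by lin.
by rewrite [T (_ * S _)]antipVM antipK.
Qed.

(** An auxiliary map that can be evaluated in several ways: it sends 1 to [f * pL] and [qL] to f,
    while its values at [gamma] and at f involve [qR]. Comparing these values relates f, [pL] and
    [qR]. *)
Definition twist_pL (x : tens H H) : tens H H :=
  tlift (fun a b => tlift (fun u v => f * Δ b * (T (a * u) ⊗ v)) pLS) x.

Lemma twist_pL_Delta p q c :
  tlift (fun x y => tlift (fun u v => f * Δ (q * y) * (T (p * x * u) ⊗ v)) pLS) (Δ c) =
  tlift (fun u v => f * Δ q * (T (p * u) ⊗ v)) pLS * (1 ⊗ c).
Proof.
have Bl : bilin (fun u v => f * Δ q * (T (p * u) ⊗ v)) by lin.
rewrite (fun_tlift (f := fun z => z * (1 ⊗ c))); last by lin.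
transitivity (tlift (fun u v => f * Δ q * (T (p * u) ⊗ (v * c))) pLS); last first.
  by apply: eq_tlift => u v; rewrite -!mulrA pureM mulr1.
rewrite -(pLS_cov Q Bl); apply: eq_tlift => c1 c2.
rewrite [RHS]tlift_exchange; apply: eq_tlift => u v.
rewrite DeltaM (tens_expand (f := fun z => f * (Δ q * z) * (T (p * c1 * u) ⊗ v))); last by lin.
apply: eq_tlift => x y.
by rewrite -!mulrA pureM !mulrA [T (_ * S _)]antipVM antipK.
Qed.

Lemma twist_pLM_Delta x c : twist_pL (x * Δ c) = twist_pL x * (1 ⊗ c).
Proof.
rewrite /twist_pL tliftM; last by lin.
rewrite (fun_tlift (f := fun z => z * (1 ⊗ c))); last by lin.
by apply: eq_tlift => p q; rewrite -twist_pL_Delta.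
Qed.

Lemma twist_pL_antip h x :
  tlift (fun h1 h2 => SS (Δ h1) * twist_pL x * (h2 ⊗ 1)) (Δ h) =
  twist_pL (SS (Δ h) * x).
Proof.
rewrite {2}/SS (fun_tlift (f := fun z => twist_pL (z * x))); last by rewrite /twist_pL; lin.
apply: eq_tlift => h1 h2; rewrite {2}/twist_pL tliftM; last by lin.
rewrite bilinE; last by lin.
rewrite /twist_pL.
rewrite (fun_tlift (f := fun z => SS (Δ h1) * z * (h2 ⊗ 1))); last by lin.
apply: eq_tlift => a b.
rewrite (fun_tlift (f := fun z => SS (Δ h1) * z * (h2 ⊗ 1))); last by lin.
apply: eq_tlift => u v.
rewrite DeltaM [f * (_ * _)]mulrA f_antip -!mulrA pureM mulr1.
by rewrite [T (S _ * _)]antipVM antipK.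
Qed.

(** An element with this covariance is determined by Z (1 ⊗ α): insert 1 = S(Φ_1) α Φ_2 β S(Φ_3) in
    the second leg and let the covariance carry S(Φ_1) across Z. *)
Lemma covariant_alpha_ext (Z : tens H H) :
    (forall h, tlift (fun h1 h2 => SS (Δ h1) * Z * (h2 ⊗ 1)) (Δ h) = Z * (1 ⊗ S h)) ->
  Z = tlift3 (fun a b c => tlift (fun a1 a2 =>
        SS (Δ a1) * (Z * (1 ⊗ α)) * (a2 ⊗ (b * β * S c))) (Δ a)) Φ.
Proof.
move=> Zc; rewrite -[LHS]mulr1 -pure1.
rewrite -(antip_PhiE Q (G := fun z => Z * (1 ⊗ z))); last by lin.
apply: eq_tlift3 => a b c.
have -> : 1 ⊗ (S a * α * b * β * S c) =
    (1 ⊗ S a) * (1 ⊗ (α * b * β * S c)) :> tens H H.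
  by rewrite pureM mul1r !mulrA.
rewrite mulrA -Zc (fun_tlift (f := fun z => z * (1 ⊗ (α * b * β * S c)))); last by lin.
by apply: eq_tlift => x y; rewrite -!mulrA !pureM !mul1r mulr1 !mulrA.
Qed.

(** Expanding [gamma] through [qL] makes the zigzag of [qL] and [pLS] applicable. What is left, f
    Δ(S(a) α), equals SS(Δ(a)) [gamma], and [gamma_qR] sums it up. *)
Lemma twist_pL_gamma :
  twist_pL (gamma Q) = tlift (fun a b => b ⊗ S a) qR * (1 ⊗ α).
Proof.
have Bl : bilin (fun a b => tlift (fun u v => f * Δ b * (T (a * u) ⊗ v)) pLS) by lin.
rewrite {1}/twist_pL (gamma_qL Q Bl).
rewrite (fun_tlift (f := fun z => z * (1 ⊗ α))); last by lin.
transitivity (tlift (fun a b => b ⊗ (S a * α)) qR); last first.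
  by apply: eq_tlift => a b; rewrite pureM mulr1.
have Bl' : bilin (fun a b : H => a ⊗ b) by lin.
rewrite -(gamma_qR Q Bl'); apply: eq_tlift3 => a b c.
transitivity (tlift (fun u v => tlift (fun u' v' =>
   f * Δ (S a * α * v) * (T (S b * u * u') ⊗ v')) pLS) qL * (1 ⊗ c)).
  rewrite tlift_exchange (fun_tlift (f := fun z => z * (1 ⊗ c))); last by lin.
  by apply: eq_tlift => u v; rewrite -twist_pL_Delta.
have -> : tlift (fun u v => tlift (fun u' v' =>
   f * Δ (S a * α * v) * (T (S b * u * u') ⊗ v')) pLS) qL =
   f * Δ (S a * α) * (b ⊗ 1).
  rewrite -[f * _]mulr1 -(zigzag_qL_pLE Q).
  rewrite (fun_tlift (f := fun z => f * Δ (S a * α) * z * (b ⊗ 1))); last by lin.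
  apply: eq_tlift => u v.
  rewrite (fun_tlift (f := fun z => f * Δ (S a * α) * z * (b ⊗ 1))); last by lin.
  apply: eq_tlift => u' v'.
  by rewrite DeltaM -!mulrA pureM mulr1 [T (S _ * _)]antipVM antipK !mulrA.
rewrite DeltaM mulrA f_antip -[_ * _ * Δ α]mulrA f_alpha.
rewrite -[_ * (b ⊗ 1) * _]mulrA pureM mulr1 mul1r /SS.
rewrite (fun_tlift (f := fun z => z * gamma Q * (b ⊗ c))); last by lin.
apply: eq_tlift => x y.
rewrite (tens_expand (f := fun z => (S y ⊗ S x) * z * (b ⊗ c))); last by lin.
by apply: eq_tlift => u v; rewrite !pureM.
Qed.

(* Both sides have the same covariance, so by covariant_alpha_ext it suffices
   to compare them after multiplication by 1 ⊗ α, where f Δ(α) = gamma applies. *)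
Lemma twist_pL_f : twist_pL f = tlift (fun a b => b ⊗ S a) qR.
Proof.
have qRc h : tlift (fun h1 h2 => SS (Δ h1) *
    tlift (fun a b => b ⊗ S a) qR * (h2 ⊗ 1)) (Δ h) =
    tlift (fun a b => b ⊗ S a) qR * (1 ⊗ S h).
  have Bl : bilin (fun a b : H => b ⊗ S a) by lin.
  rewrite (fun_tlift (f := fun z => z * (1 ⊗ S h))); last by lin.
  transitivity (tlift (fun a b => b ⊗ S (h * a)) qR); last first.
    by apply: eq_tlift => a b; rewrite pureM mulr1 antipM.
  rewrite -(qR_cov Q Bl); apply: eq_tlift => h1 h2.
  rewrite /SS (fun_tlift (f := fun z => z * tlift (fun a b => b ⊗ S a) qR * (h2 ⊗ 1))); last by lin.
  apply: eq_tlift => x y.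
  rewrite (fun_tlift (f := fun z => (S y ⊗ S x) * z * (h2 ⊗ 1))); last by lin.
  by apply: eq_tlift => a b; rewrite !pureM mulr1 antipM.
have pLc h : tlift (fun h1 h2 => SS (Δ h1) * twist_pL f * (h2 ⊗ 1)) (Δ h) =
    twist_pL f * (1 ⊗ S h).
  by rewrite twist_pL_antip -f_antip twist_pLM_Delta.
rewrite (covariant_alpha_ext qRc) (covariant_alpha_ext pLc).
by rewrite -twist_pLM_Delta f_alpha twist_pL_gamma.
Qed.

Lemma twist_pLM x y : twist_pL (x * y) =
  tlift (fun a b => tlift (fun c d => tlift (fun u v =>
    f * Δ b * Δ d * (T (c * u) * T a ⊗ v)) pLS) y) x.
Proof.
rewrite /twist_pL tliftM; last by lin.
apply: eq_tlift => a b; apply: eq_tlift => c d; apply: eq_tlift => u v.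
by rewrite DeltaM -!(mulrA a) antipVM !mulrA.
Qed.

Lemma twist_pL_qL : twist_pL qL = f.
Proof.
rewrite -[RHS]mulr1 -(zigzag_qL_pLE Q) /twist_pL.
rewrite [RHS](fun_tlift (f := fun z => f * z)); last by lin.
apply: eq_tlift => a b.
rewrite [RHS](fun_tlift (f := fun z => f * z)); last by lin.
by apply: eq_tlift => u v; rewrite mulrA.
Qed.

(* Ucop and Vcop are the flips of Utw and Vtw. *)
Definition Utw : tens H H := TT (qL * f^-1).
Definition Vtw : tens H H := SS pL * f.

Lemma tlift_TT W (B : H -> H -> W) x : bilin B ->
  tlift B (TT x) = tlift (fun a b => B (T b) (T a)) x.
Proof.
move=> Bl; rewrite /TT fun_tlift; last by lin.
by apply: eq_tlift => a b; rewrite bilinE.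
Qed.

Lemma SS_Delta_antipV b : SS (Δ (T b)) = f * Δ b * f^-1.
Proof. by rewrite -[b in RHS](antipVK Q) f_antip mulrK. Qed.

(** Evaluate [twist_pL] at qL = (qL f^-1) f. The first factor comes out as f Δ(b) f^-1 =
    SS(Δ(T(b))), which is where the legs of [Utw] arise; the second leaves [twist_pL f], that is
    [qR]. *)
Lemma Utw_qR :
  tlift (fun u1 u2 => SS (Δ u1) * tlift (fun a b => b ⊗ S a) qR * (u2 ⊗ 1)) Utw = f.
Proof.
rewrite tlift_TT; last by rewrite /SS; lin.
rewrite -twist_pL_f -[RHS]twist_pL_qL -[qL in RHS](mulrVK f_unit) twist_pLM.
apply: eq_tlift => a b; rewrite SS_Delta_antipV /twist_pL.
rewrite (fun_tlift (f := fun z => f * Δ b * f^-1 * z * (T a ⊗ 1))); last by lin.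
apply: eq_tlift => c d.
rewrite (fun_tlift (f := fun z => f * Δ b * f^-1 * z * (T a ⊗ 1))); last by lin.
apply: eq_tlift => u v.
by rewrite !mulrA mulrVK // -!mulrA pureM mulr1 mulrA.
Qed.

(** The left side is the contraction that [genG] performs on [Utw]. It is a zigzag with [Utw] in
    place of [pR], returning the legs of f instead of 1 ⊗ 1. *)
Lemma Utw_zigzag W (B : H -> H -> W) : bilin B ->
  tlift (fun u1 u2 => tlift (fun x y =>
    tlift (fun a b => B (a * x) (S y * b * u2)) qR) (Δ u1)) Utw =
  tlift (fun a b => B (T b) a) f.
Proof.
move=> Bl; rewrite -[f in RHS]Utw_qR.
rewrite (fun_tlift (f := fun z => tlift (fun a b => B (T b) a) z)); last by lin.
apply: eq_tlift => u1 u2.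
rewrite {1}/SS (fun_tlift (f := fun z => tlift (fun a b => B (T b) a)
   (z * tlift (fun a b => b ⊗ S a) qR * (u2 ⊗ 1)))); last by lin.
apply: eq_tlift => x y.
rewrite (fun_tlift (f := fun z => tlift (fun a b => B (T b) a)
   ((S y ⊗ S x) * z * (u2 ⊗ 1)))); last by lin.
apply: eq_tlift => a b.
by rewrite !pureM bilinE ?mulr1 -?antipM ?antipK //; lin.
Qed.

(** The covariance of [qL], transported by the anti-automorphism [TT]; f^-1 converts f Δ(-) f^-1
    into SS(Δ(T(-))) on the way. *)
Lemma Utw_cov h :
  tlift (fun h1 h2 => Δ (T h2) * Utw * (1 ⊗ h1)) (Δ h) = Utw * (T h ⊗ 1).
Proof.
have TTl x y z : TT (x * y * z) = TT z * (TT y * TT x) by rewrite !TTM.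
transitivity (TT ((1 ⊗ h) * qL * f^-1)); last first.
  by rewrite !TTM TTE antipV1 /Utw TTM mulrA.
rewrite -qL_covE (fun_tlift (f := fun z => TT (z * f^-1))); last by rewrite /TT; lin.
apply: eq_tlift => h1 h2.
have -> : Δ (T h2) = TT (SS (Δ (T h2))) by rewrite TTK.
rewrite /Utw -[1 ⊗ h1](TTK Q) SSE antip1 -!TTM; congr TT.
rewrite SS_Delta_antipV -!mulrA; congr (_ * (_ * _)).
by rewrite !mulrA mulVr // mul1r.
Qed.

(** In the zigzag of [pR] and [qR], the hypothesis reduces the first leg of [pR] to its counit, and
    ε(Φ_1) Φ_2 β S(Φ_3) = β. *)
Lemma qR_absorb W (A : H -> H -> W) : bilin A ->
    (forall h a b, tlift (fun h1 h2 => A (a * h1) (S h2 * b)) (Δ h) =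
                   (ε h : K) *: A a b) ->
  A 1 1 = tlift (fun a b => A a (b * β)) qR.
Proof.
move=> Al ab; rewrite -(zigzag_pR_qR Q Al).
under eq_tlift => p1 p2 do (rewrite tlift_exchange;
  under eq_tlift => a b do (under eq_tlift => x y do rewrite -mulrA; rewrite ab)).
rewrite tlift_exchange; apply: eq_tlift => a b.
rewrite tlift_pR; last by lin.
have Bl : bilin (fun c d => A a (b * (c * β * S d))) by lin.
by rewrite (Phi_counit1 Q Bl) mul1r antip1 mulr1.
Qed.

(** If [delta0 * f] is Δ(β), this is Δ applied to Ψ_1 β S(Ψ_2) α Ψ_3 = 1. Here it is established
    beforehand, so that the identification with Δ(β) can be deduced from it. *)
Lemma delta0_inv :
  tlift (fun a b => Δ a * (delta0 Q * f) * Δ b) qR = 1.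
Proof.
(* A four-slot contraction under which the two sides of the inverse pentagon become, respectively,
   the sum to be computed and a product of two zigzags. *)
pose J p q r s := Δ p * pR * ((β * S r) ⊗ (S q * α)) * qL * Δ s.
have Jl : quadlin J by rewrite /J; lin.
have e1 : tlift (fun a b => Δ a * (delta0 Q * f) * Δ b) qR =
    tlift4 J (one_tens Ψ * (id_D_id Δ Ψ * (Ψ ⊗ 1))).
  rewrite tlift_qR; last by lin.
  rewrite tlift4M // tlift4_one_tens; last by lin.
  rewrite [RHS](eq_tlift3 (G := fun u v w => tlift3 (fun a b c =>
    tlift (fun x y => tlift3 (fun a' b' c' =>
      J (a * a') (u * (x * b')) (v * (y * c')) (w * c)) Ψ) (Δ b)) Ψ)); last first.
    move=> u v w; rewrite tlift4M; last by lin.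
    rewrite tlift4_id_D_id; last by lin.
    apply: eq_tlift3 => a b c; apply: eq_tlift => x y.
    rewrite tlift4_tens_one; last by lin.
    by apply: eq_tlift3 => a' b' c'; rewrite mul1r mulr1.
  rewrite tlift3_exchange; apply: eq_tlift3 => a b c.
  rewrite tlift3_exchange2.
  rewrite !DeltaM [_ * (delta0 Q * f)]mulrA -!mulrA [f * _]mulrA f_antip.
  rewrite -!mulrA [f * _]mulrA f_alpha !mulrA {1}/SS.
  rewrite (fun_tlift (f := fun z => Δ a * delta0 Q * z * gamma Q * Δ c)); last by lin.
  apply: eq_tlift => x y; rewrite gammaE.
  rewrite (fun_tlift3 (f := fun z => Δ a * delta0 Q * (S y ⊗ S x) * z * Δ c)); last by lin.
  apply: eq_tlift3 => u v w; rewrite /delta0.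
  rewrite (fun_tlift3 (f := fun z => Δ a * z * (S y ⊗ S x) *
     ((S v ⊗ (S u * α)) * qL * Δ w) * Δ c)); last by lin.
  apply: eq_tlift3 => a' b' c'.
  rewrite /J !DeltaM !antipM -!mulrA; congr (_ * (_ * (_ * _))).
  by rewrite !mulrA !pureM !mulrA.
(* On the other side of the pentagon the coproducts next to [pR] and [qL] fit their covariance;
   removing them decouples the two copies of Ψ into a zigzag of [pLS] with [qL] and one of [qR] with
   [pR]. *)
rewrite e1 -pentagonV tlift4M // tlift4_id_id_D; last by lin.
transitivity (tlift3 (fun a b c => Δ a * pR * (1 ⊗ (S b * α * c))) Ψ); last first.
  by rewrite -(zigzag_qR_pRE Q) tlift_qR //; lin.
apply: eq_tlift3 => a b c.
transitivity (tlift3 (fun a' b' c' => Δ a * pR *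
   ((a' * β * S b') ⊗ (S b * α * c)) * qL * Δ c') Ψ); last first.
  rewrite -[_ * (1 ⊗ _)]mulr1 -(zigzag_pL_qLE Q).
  rewrite (fun_tlift (f := fun z => Δ a * pR * (1 ⊗ (S b * α * c)) * z)); last by lin.
  rewrite tlift_pLS; last by lin.
  apply: eq_tlift3 => a' b' c'.
  by rewrite -!mulrA [(1 ⊗ _) * (_ * _)]mulrA pureM mul1r mulr1 !mulrA.
under eq_tlift => x y do (rewrite tlift4_D_id_id; last by lin).
rewrite -tlift3_exchange2; apply: eq_tlift3 => a' b' c'.
rewrite tlift_exchange.
transitivity (Δ a * (pR * (a' ⊗ 1)) * ((β * S b') ⊗ (S b * α * c)) * qL * Δ c'); last first.
  by rewrite -!mulrA [(a' ⊗ 1) * (_ * _)]mulrA pureM mul1r !mulrA.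
rewrite -pR_covE.
rewrite (fun_tlift (f := fun z => Δ a * z * ((β * S b') ⊗ (S b * α * c)) * qL * Δ c')); last by lin.
apply: eq_tlift => x y.
transitivity (Δ a * Δ x * pR * ((β * S b') ⊗ (S y * S b * α)) * ((1 ⊗ c) * qL) * Δ c'); last first.
  rewrite -!mulrA; congr (_ * (_ * (_ * _))).
  by rewrite !mulrA !pureM !mul1r !mulr1 !mulrA.
rewrite -qL_covE.
rewrite (fun_tlift (f := fun z => Δ a * Δ x * pR * ((β * S b') ⊗ (S y * S b * α)) * z * Δ c')); last by lin.
apply: eq_tlift => c1 c2.
rewrite /J !DeltaM !antipM -!mulrA; congr (_ * (_ * (_ * _))).
by rewrite [RHS]mulrA pureM mulr1 !mulrA.
Qed.

(** The map A(a, b) = Δ(a) (delta0 f) Δ(b) satisfies the hypothesis of [qR_absorb] by [delta0_cov].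
    Hence A(1, 1) is the sum of [delta0_inv], which is 1, times Δ(β). *)
Lemma Delta_beta : Δ β = delta0 Q * f.
Proof.
pose A a b := Δ a * (delta0 Q * f) * Δ b.
have Al : bilin A by rewrite /A; lin.
have -> : delta0 Q * f = A 1 1 by rewrite /A Delta1 mul1r mulr1.
rewrite (qR_absorb Al) => [|h a b].
  rewrite -[LHS]mul1r -delta0_inv (fun_tlift (f := fun z => z * Δ β)); last by lin.
  by apply: eq_tlift => a b; rewrite /A DeltaM !mulrA.
have -> : (ε h : K) *: A a b = Δ a * (((ε h : K) *: delta0 Q) * f) * Δ b.
  by rewrite /A -scalerAl -scalerAr -scalerAl.
rewrite -delta0_cov (fun_tlift (f := fun z => Δ a * (z * f) * Δ b)); last by lin.
apply: eq_tlift => h1 h2.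
by rewrite /A !DeltaM -!mulrA [f * (_ * _)]mulrA f_antip -!mulrA.
Qed.

(** Two evaluations of [twist_pL] at f^-1 f = 1: directly it is [f * pL], and with f^-1 pulled out
    it involves [twist_pL f], that is [qR]. *)
Lemma pL_twist :
  pL = tlift (fun a b =>
    Δ b * f^-1 * tlift (fun q q' => q' ⊗ S q) qR * (T a ⊗ 1)) f^-1.
Proof.
rewrite -twist_pL_f pLE.
transitivity (f^-1 * twist_pL (f^-1 * f)).
  rewrite mulVr // -pure1 /twist_pL bilinE; last by lin.
  rewrite (fun_tlift (f := fun z => f^-1 * z)); last by lin.
  by apply: eq_tlift => u v; rewrite Delta1 mulr1 mul1r mulKr.
rewrite twist_pLM (fun_tlift (f := fun z => f^-1 * z)); last by lin.
apply: eq_tlift => a b.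
rewrite /twist_pL (fun_tlift (f := fun z => f^-1 * z)); last by lin.
rewrite (fun_tlift (f := fun z => Δ b * f^-1 * z * (T a ⊗ 1))); last by lin.
apply: eq_tlift => c d.
rewrite (fun_tlift (f := fun z => f^-1 * z)); last by lin.
rewrite (fun_tlift (f := fun z => Δ b * f^-1 * z * (T a ⊗ 1))); last by lin.
apply: eq_tlift => u v.
by rewrite -!mulrA mulKr // !mulrA mulrVK // -[RHS]mulrA pureM mulr1.
Qed.

Section Pivot.
Variable g : H.
Hypothesis gP : is_pivot Q f g.

Lemma tmap_antip_swap x : tmap S S (tswap x) = SS x.
Proof.
move: x; apply: tlift_ext; [by rewrite /tswap; lin | by rewrite /SS; lin |] => a b.
by rewrite tswapE tmapE SSE.
Qed.

Lemma pivot_DeltaE : Δ g = f^-1 * SS f * (g ⊗ g).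
Proof. by rewrite (pivot_Delta gP) tmap_antip_swap. Qed.

Lemma SS_twistV : SS f^-1 * f = (g ⊗ g) * Δ g^-1.
Proof.
have gu := pivot_unit gP.
have e : SS f^-1 * SS f = 1 by rewrite -SSM mulrV ?SS1.
have -> : SS f^-1 * f = SS f^-1 * f * (Δ g * Δ g^-1).
  by rewrite -DeltaM mulrV // Delta1 mulr1.
by rewrite pivot_DeltaE !mulrA mulrK // e mul1r.
Qed.

(** Rewrites V^cop_21 in terms of [qR], the element that partial traces produce. The antipode meets
    S of a leg of [qR], and the resulting S^2 is conjugation by g. *)
Lemma Vtw_qR :
  Vtw = tlift (fun a b => tlift (fun q q' =>
    ((g * q) ⊗ (a * S q' * g)) * Δ (g^-1 * S b)) qR) f^-1.
Proof.
have gu := pivot_unit gP.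
rewrite /Vtw pL_twist (fun_tlift (f := fun z => SS z * f)); last by rewrite /SS; lin.
apply: eq_tlift => a b.
rewrite (fun_tlift (f := fun z => SS (Δ b * f^-1 * z * (T a ⊗ 1)) * f)); last by rewrite /SS; lin.
apply: eq_tlift => q q'.
rewrite !SSM -!mulrA -f_antip [SS f^-1 * (f * _)]mulrA SS_twistV.
rewrite !SSE antip1 antipVK -!mulrA -DeltaM !mulrA; congr (_ * _).
by rewrite !pureM mul1r (pivot_S2 gP) mulrVK.
Qed.
End Pivot.
End Twist.

(** * Modules, currying and integrals *)

Section SumRules.
Variables (K : fieldType) (U V X : vectType K).

Lemma lfun_tlift (W W' : vectType K) (f : 'Hom(W, W')) (B : U -> V -> W) x :
  f (tlift B x) = tlift (fun u v => f (B u v)) x.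
Proof. by rewrite (fun_tlift (f := f)) //; lin. Qed.
Lemma lfun_tlift3 (W W' : vectType K) (f : 'Hom(W, W')) (B : U -> V -> X -> W) x :
  f (tlift3 B x) = tlift3 (fun u v t => f (B u v t)) x.
Proof. by rewrite (fun_tlift3 (f := f)) //; lin. Qed.
Lemma pure_tliftl (W W' : vectType K) (w : W') (B : U -> V -> W) x :
  tlift B x ⊗ w = tlift (fun u v => B u v ⊗ w) x.
Proof. by rewrite (fun_tlift (f := fun z => z ⊗ w)) //; lin. Qed.
Lemma pure_tliftr (W W' : vectType K) (w : W') (B : U -> V -> W) x :
  w ⊗ tlift B x = tlift (fun u v => w ⊗ B u v) x.
Proof. by rewrite (fun_tlift (f := fun z => w ⊗ z)) //; lin. Qed.
Lemma pure_tlift3l (W W' : vectType K) (w : W') (B : U -> V -> X -> W) x :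
  tlift3 B x ⊗ w = tlift3 (fun u v t => B u v t ⊗ w) x.
Proof. by rewrite (fun_tlift3 (f := fun z => z ⊗ w)) //; lin. Qed.
Lemma pure_tlift3r (W W' : vectType K) (w : W') (B : U -> V -> X -> W) x :
  w ⊗ tlift3 B x = tlift3 (fun u v t => w ⊗ B u v t) x.
Proof. by rewrite (fun_tlift3 (f := fun z => w ⊗ z)) //; lin. Qed.
Lemma tlift_lfunE (W W' : vectType K) (B : U -> V -> 'Hom(W, W')) x w :
  tlift B x w = tlift (fun u v => B u v w) x.
Proof. by rewrite (fun_tlift (f := fun z : 'Hom(W, W') => z w)) //; lin. Qed.
End SumRules.

Section ModuleMaps.
Variables (K : fieldType) (H : falgType K) (Q : quasiHopf H).
Implicit Types M N P U V W : hmod H.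
Local Notation Δ := (Delta Q).
Local Notation Φ := (Phi Q).
Local Notation Ψ := (Phi Q)^-1.
Local Notation S := (antip Q).
Local Notation α := (alpha Q).
Local Notation β := (beta Q).
Local Notation "V ⊠ W" := (tensM Q V W) (at level 40, left associativity).
Local Notation "V ^∨" := (dualM Q V) (at level 2, format "V ^∨").

Lemma compHE M N P (g : homH N P) (f : homH M N) x : compH g f x = g (f x).
Proof. by rewrite MkHomE comp_lfunE. Qed.

Lemma idHE M x : idH M x = x.
Proof. by rewrite MkHomE id_lfunE. Qed.

Lemma tensHE M N M' N' (f : homH M N) (g : homH M' N') x y :
  tensH Q f g (x ⊗ y) = f x ⊗ g y.
Proof. by rewrite MkHomE tmapE. Qed.

Lemma homH_ext M N (f g : homH M N) : (forall x, f x = g x) -> f = g.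
Proof. by move=> e; apply/homf_inj/lfunP. Qed.

Lemma extactT M N (x : tens H H) m n :
  extact M N x (m ⊗ n) = tlift (fun a b => hact M a m ⊗ hact N b n) x.
Proof.
rewrite (tens_expand (f := fun z => extact M N z (m ⊗ n))).
  by apply: eq_tlift => a b; rewrite extactE.
by move=> c u v; rewrite extact_linear add_lfunE scale_lfunE.
Qed.

Lemma tensM_act M N h m n :
  hact (M ⊠ N) h (m ⊗ n) = tlift (fun a b => hact M a m ⊗ hact N b n) (Δ h).
Proof. by rewrite tensME extactT. Qed.

Lemma tensor3_act U V W x u v w :
  hact (tensor3 U V W) x (u ⊗ v ⊗ w) =
  tlift3 (fun a b c => hact U a u ⊗ hact V b v ⊗ hact W c w) x.
Proof.
rewrite tensor3E /tlift3 (tens_expand (f := fun z => extact (extmod U V) W z (u ⊗ v ⊗ w))).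
  apply: eq_tlift => ab c; rewrite extactE.
  have -> : hact (extmod U V) ab (u ⊗ v) = extact U V ab (u ⊗ v) by [].
  by rewrite extactT (fun_tlift (f := fun z => z ⊗ hact W c w)) //; lin.
by move=> c y z; rewrite extact_linear add_lfunE scale_lfunE.
Qed.

Lemma assocHE U V W u v w : assocH Q U V W (u ⊗ (v ⊗ w)) =
  tlift3 (fun a b c => hact U a u ⊗ hact V b v ⊗ hact W c w) Φ.
Proof. by rewrite MkHomE comp_lfunE tassocE tensor3_act. Qed.

Lemma assocVHE U V W u v w : assocVH Q U V W (u ⊗ v ⊗ w) =
  tlift3 (fun a b c => hact U a u ⊗ (hact V b v ⊗ hact W c w)) Ψ.
Proof.
rewrite MkHomE comp_lfunE tensor3_act fun_tlift3; last by lin.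
by apply: eq_tlift3 => a b c; rewrite tassocVE.
Qed.

Lemma lunitE V (c : K^o) v : lunit Q V (c ⊗ v) = (c : K) *: v.
Proof. by rewrite MkHomE lunit_linE. Qed.
Lemma runitE V v (c : K^o) : runit Q V (v ⊗ c) = (c : K) *: v.
Proof. by rewrite MkHomE runit_linE. Qed.
Lemma runitVE V v : runitV Q V v = v ⊗ (1 : K^o).
Proof. by rewrite MkHomE runitV_linE. Qed.
Lemma evE V (phi : 'Hom(V, K^o)) v : ev Q V (phi ⊗ v) = phi (hact V α v).
Proof. by rewrite MkHomE ev_linE. Qed.
Lemma coevE V : coev Q V (1 : K^o) =
  \sum_(i < \dim {:V}) hact V β (vbasis {:V})`_i ⊗ dualv i.
Proof. by rewrite MkHomE coev_linE scale1r. Qed.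

Lemma dual_act V h (phi : 'Hom(V, K^o)) v :
  (hact V^∨ h phi : 'Hom(V, K^o)) v = phi (hact V (S h) v).
Proof. exact: hact_dualE. Qed.

Lemma evRE f g (gP : is_pivot Q f g) V v (phi : 'Hom(V, K^o)) :
  evR gP V (v ⊗ phi) = phi (hact V (S α * g) v).
Proof.
rewrite /evR compHE tensHE idHE evE MkHomE.
transitivity (delta_lin g V v (hact V^∨ α phi)).
  by [].
by rewrite delta_linE dual_act -hactME.
Qed.

Lemma nested_evE V W (phi : 'Hom(W, K^o)) (psi : 'Hom(V, K^o)) v w :
  nested_ev Q V W (phi ⊗ psi ⊗ (v ⊗ w)) =
  tlift (fun a b : H => (psi (hact V a v) : K) *: phi (hact W b w)) (gamma Q).
Proof.
rewrite (@gamma_qL _ _ Q _ (fun a b => (psi (hact V a v) : K) *: phi (hact W b w))); last first.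
  by lin.
rewrite /nested_ev !compHE assocVHE !lfun_tlift3.
apply: eq_tlift3 => a b c; rewrite tensHE idHE tensM_act.
rewrite !(pure_tliftr, lfun_tlift); apply: eq_tlift => x y.
rewrite tlift_qL; last by lin.
rewrite assocHE !(pure_tlift3r, lfun_tlift3); apply: eq_tlift3 => a' b' c'.
rewrite !tensHE !idHE evE lunitE dual_act evE dual_act -!hactME.
by rewrite !lfunZ dual_act -!hactME !mulrA.
Qed.

Definition pairing (phi psi : 'Hom(H, K^o)) (x : tens H H) : K^o :=
  tlift (fun a b : H => (psi a : K) *: phi b) x.

Lemma pairing_inj x y : (forall phi psi, pairing phi psi x = pairing phi psi y) -> x = y.
Proof.
have cl i : linear (coord (vbasis {:H}) i : H -> K^o) by exact: linearP.
have e (z : tens H H) i j : pairing (linfun (coord (vbasis {:H}) j : H -> K^o))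
    (linfun (coord (vbasis {:H}) i : H -> K^o)) z = z i j.
  rewrite -[z in RHS]tlift_pure (fun_tlift (f := fun z : tens H H => z i j : K^o)).
    by apply: eq_tlift => a b; rewrite !linfunE // mxE.
  by move=> c u v; rewrite !mxE.
by move=> exy; apply/matrixP => i j; rewrite -!e exy.
Qed.

Section Twist.
Variable f : tens H H.
Hypothesis f_twist : drinfeld_twist Q f.

Lemma twist_dual V W : exists gam : homH (W^∨ ⊠ V^∨) (V ⊠ W)^∨,
  (forall (phi : 'Hom(W, K^o)) (psi : 'Hom(V, K^o)) x,
     (gam (phi ⊗ psi) : 'Hom(tens V W, K^o)) x =
     tlift (fun v w => (psi v : K) *: phi w) (extact V W f x)) /\
  compH (ev Q (V ⊠ W)) (tensH Q gam (idH (V ⊠ W))) = nested_ev Q V W.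
Proof.
have [_ /(_ V W)[gam [gamE gam_ev]]] := f_twist; exists gam; split=> // phi psi.
apply: tlift_ext; [by lin | by lin |] => v w.
rewrite gamE extactT (fun_tlift (f := fun z =>
  tlift (fun v w => (psi v : K) *: phi w) z)); last by lin.
apply: eq_tlift => a b; rewrite bilinE //; lin.
Qed.

Lemma extact_regmod x y :
  extact (regmod H) (regmod H) x (y : tens H H) = x * y.
Proof.
move: y; apply: tlift_ext; [by lin | by lin |] => c d.
rewrite extactT (tens_expand (f := fun z => z * (c ⊗ d))); last by lin.
by apply: eq_tlift => a b; rewrite pureM !regactE.
Qed.

(** H-linearity of [gam] for two regular modules, evaluated at 1 ⊗ 1. The functionals obtained there
    separate the elements of H ⊗ H by [pairing_inj]. *)
Lemma twist_antip h : f * Δ (S h) = SS Q (Δ h) * f.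
Proof.
have [gam [gamE _]] := twist_dual (regmod H) (regmod H).
apply: pairing_inj => phi psi.
have := congr1 (fun F : 'Hom(tens H H, K^o) => F 1)
  (homfP gam h (phi ⊗ psi)).
have e : (hact (regmod H ⊠ regmod H)^∨ h (gam (phi ⊗ psi)) : 'Hom(tens H H, K^o)) 1 =
    pairing phi psi (f * Δ (S h)).
  apply: etrans (@dual_act (regmod H ⊠ regmod H) h _ _) _.
  by rewrite gamE tensME !extact_regmod mulr1.
move=> e'; rewrite -e; apply: etrans (esym e') _ => {e e'}.
rewrite tensM_act lfun_tlift tlift_lfunE /SS.
rewrite (fun_tlift (f := fun z => pairing phi psi (z * f))); last by rewrite /pairing; lin.
apply: eq_tlift => a b; rewrite gamE extact_regmod mulr1 /pairing.
rewrite tliftM; last by lin.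
rewrite bilinE; last by lin.
by apply: eq_tlift => c d; rewrite !dual_act !regactE.
Qed.

(** The compatibility of [gam] with the evaluations, again at 1 ⊗ 1: evaluation acts by Δ(α), nested
    evaluation by [gamma]. *)
Lemma twist_alpha : f * Δ α = gamma Q.
Proof.
have [gam [gamE gam_ev]] := twist_dual (regmod H) (regmod H).
apply: pairing_inj => phi psi.
have := @nested_evE (regmod H) (regmod H) phi psi 1 1.
rewrite -gam_ev compHE tensHE idHE evE gamE tensME !extact_regmod pure1 mulr1.
rewrite -[LHS]/(pairing phi psi (f * Δ α)) => ->.
by apply: eq_tlift => a b; rewrite !regactE !mulr1.
Qed.

Lemma twist_unit : f \is a GRing.unit.
Proof. by case: f_twist. Qed.
End Twist.
End ModuleMaps.

Lemma fun_sum (K : fieldType) (W W' : lmodType K) (f : W -> W') I (r : seq I) (F : I -> W) :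
  linear f -> f (\sum_(i <- r) F i) = \sum_(i <- r) f (F i).
Proof.
move=> l; pose g : {linear W -> W'} := HB.pack f (GRing.isLinear.Build _ _ _ _ f l).
exact: (linear_sum g).
Qed.

Lemma sum_tlift (K : fieldType) (U V : vectType K) (W : lmodType K) I (r : seq I)
    (F : I -> U -> V -> W) x :
  \sum_(i <- r) tlift (F i) x = tlift (fun u v => \sum_(i <- r) F i u v) x.
Proof.
rewrite /tlift exchange_big /=; apply: eq_bigr => i _.
rewrite exchange_big /=; apply: eq_bigr => j _.
by rewrite scaler_sumr.
Qed.

Lemma sum_tlift3 (K : fieldType) (U V X : vectType K) (W : lmodType K) I (r : seq I)
    (F : I -> U -> V -> X -> W) x :
  \sum_(i <- r) tlift3 (F i) x = tlift3 (fun u v t => \sum_(i <- r) F i u v t) x.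
Proof. by rewrite /tlift3 sum_tlift; apply: eq_tlift => uv t; rewrite sum_tlift. Qed.

(** * Tensors with a dual space as linear maps *)

Section Contraction.
Variables (K : fieldType) (H : falgType K) (U : vectType K) (V : hmod H).

(** Views x as a linear map from V to U and evaluates it at w. By [contract_inj] two tensors are
    equal when the maps are. *)
Definition contract (w : V) (x : tens U 'Hom(V, K^o)) : U :=
  tlift (fun (u : U) (phi : 'Hom(V, K^o)) => (phi w : K) *: u) x.

Lemma contractE w u phi : contract w (u ⊗ phi) = (phi w : K) *: u.
Proof. by rewrite /contract bilinE //; lin. Qed.

Lemma contract_linear w : linear (contract w).
Proof. by rewrite /contract; lin. Qed.

Lemma coord_sum (W : lmodType K) (L : V -> W) v : linear L ->
  \sum_(i < \dim {:V}) (dualv i v : K) *: L (vbasis {:V})`_i = L v.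
Proof.
move=> l; pose g : {linear V -> W} := HB.pack L (GRing.isLinear.Build _ _ _ _ L l).
rewrite {2}(coord_vbasis (memvf v)) -[L _]/(g _) linear_sum.
by apply: eq_bigr => i _; rewrite linearZ dualvE.
Qed.

Lemma dualv_expand (phi : 'Hom(V, K^o)) :
  phi = \sum_(i < \dim {:V}) (phi (vbasis {:V})`_i : K) *: dualv i.
Proof.
apply/lfunP => v; rewrite sum_lfunE -(coord_sum (L := phi)); last by lin.
by apply: eq_bigr => i _; rewrite scale_lfunE; exact: mulrC.
Qed.

Lemma contract_expand x :
  x = \sum_(i < \dim {:V}) contract (vbasis {:V})`_i x ⊗ dualv i.
Proof.
move: x; apply: tlift_ext; [by lin | |] => [|u phi].
  apply: lin_sum => i; apply: lin_purel; exact: contract_linear.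
rewrite {1}[phi]dualv_expand linear_sum; apply: eq_bigr => i _.
by rewrite contractE pureZl -pureZr.
Qed.

Lemma contract_inj x y : (forall w, contract w x = contract w y) -> x = y.
Proof.
by move=> e; rewrite [x]contract_expand [y]contract_expand; apply: eq_bigr => i _; rewrite e.
Qed.

Lemma contract_sum_dual (L : V -> U) w : linear L ->
  contract w (\sum_(i < \dim {:V}) L (vbasis {:V})`_i ⊗ dualv i) = L w.
Proof.
move=> l; rewrite -(coord_sum w l).
pose g : {linear tens U 'Hom(V, K^o) -> U} :=
  HB.pack (contract w) (GRing.isLinear.Build _ _ _ _ _ (contract_linear w)).
rewrite -[contract w _]/(g _) linear_sum; apply: eq_bigr => i _.
exact: contractE.
Qed.
End Contraction.

(** * The adjunction between tensoring with V and with its dual *)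

Section Currying.
Variables (K : fieldType) (H : falgType K) (Q : quasiHopf H).
Implicit Types M N P U V W : hmod H.
Local Notation Δ := (Delta Q).
Local Notation S := (antip Q).
Local Notation β := (beta Q).
Local Notation "V ⊠ W" := (tensM Q V W) (at level 40, left associativity).
Local Notation "V ^∨" := (dualM Q V) (at level 2, format "V ^∨").
Local Notation qR := (qR Q).
Local Notation pR := (pR Q).

Lemma contract_act M V w h (x : tens M 'Hom(V, K^o)) :
  contract w (hact (M ⊠ V^∨) h x) =
  tlift (fun a b => hact M a (contract (hact V (S b) w) x)) (Δ h).
Proof.
move: x; apply: tlift_ext; rewrite /contract; [by lin | by lin |] => u phi.
rewrite tensM_act (fun_tlift (f := fun z => tlift (fun (m : M) (phi : 'Hom(V, K^o)) =>
  (phi w : K) *: m) z)); last by lin.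
apply: eq_tlift => a b; rewrite bilinE; last by lin.
by rewrite dual_act bilinE ?lfunZ //; lin.
Qed.

Lemma coev_contract V w : contract w (coev Q V (1 : K^o)) = hact V β w.
Proof. by rewrite coevE (contract_sum_dual (L := hact V β)) //; lin. Qed.

Definition curryH P V N (f : homH (P ⊠ V) N) : homH P (N ⊠ V^∨) :=
  compH (tensH Q f (idH V^∨))
 (compH (assocH Q P V V^∨)
 (compH (tensH Q (idH P) (coev Q V)) (runitV Q P))).

Definition uncurryH P V N (l : homH P (N ⊠ V^∨)) : homH (P ⊠ V) N :=
  compH (runit Q N)
 (compH (tensH Q (idH N) (ev Q V))
 (compH (assocVH Q N V^∨ V) (tensH Q l (idH V)))).

(** The unit of the adjunction acts by [pR] and, in [uncurryE], the counit acts by [qR]; that the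
    two passages are inverse is then exactly the pair of right-handed zigzags. *)
Lemma curry_contract P V N (f : homH (P ⊠ V) N) p w :
  contract w (curryH f p) = tlift (fun a b => f (hact P a p ⊗ hact V b w)) pR.
Proof.
rewrite /curryH !compHE runitVE tensHE idHE coevE.
rewrite (fun_sum (f := fun z => contract w (tensH Q f (idH V^∨)
  (assocH Q P V V^∨ (p ⊗ z))))); last by rewrite /contract; lin.
under eq_bigr => i _.
  rewrite assocHE lfun_tlift3 (fun_tlift3 _ _ (contract_linear w)).
  under eq_tlift3 => a b c do rewrite tensHE idHE contractE dual_act.
  over.
rewrite sum_tlift3 tlift_pR; last by lin.
apply: eq_tlift3 => a b c.
rewrite (coord_sum (L := fun v => f (hact P a p ⊗ hact V b (hact V β v)))); last by lin.
by rewrite !hactME.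
Qed.

Lemma uncurryE P V N (l : homH P (N ⊠ V^∨)) p v :
  uncurryH l (p ⊗ v) = tlift (fun a b => hact N a (contract (hact V b v) (l p))) qR.
Proof.
rewrite /uncurryH !compHE tensHE idHE; move: (l p).
apply: tlift_ext; [by lin | by rewrite /contract; lin |] => n phi.
rewrite assocVHE !lfun_tlift3 tlift_qR; last by rewrite /contract; lin.
apply: eq_tlift3 => a b c.
by rewrite tensHE idHE runitE evE dual_act contractE lfunZ -!hactME.
Qed.

Lemma curryK P V N (f : homH (P ⊠ V) N) : uncurryH (curryH f) = f.
Proof.
apply: homH_ext; apply: tlift_ext; [by lin | by lin |] => p v.
rewrite uncurryE.
have Bl : bilin (fun a b => f (extact P V (a ⊗ b) (p ⊗ v))) by lin.
have e : f (p ⊗ v) = f (extact P V (1 ⊗ 1) (p ⊗ v)).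
  by rewrite extactE !hact1E.
rewrite e -(zigzag_qR_pR Q Bl); apply: eq_tlift => a b.
rewrite curry_contract lfun_tlift tlift_exchange; apply: eq_tlift => p1 p2.
rewrite -homfP tensM_act lfun_tlift; apply: eq_tlift => x y.
by rewrite extactE !hactME.
Qed.

Lemma uncurryK P V N (l : homH P (N ⊠ V^∨)) : curryH (uncurryH l) = l.
Proof.
apply: homH_ext => p; apply: contract_inj => w.
rewrite curry_contract.
have Bl : bilin (fun a b => hact N a (contract (hact V b w) (l p))).
  by rewrite /contract; lin.
have e : contract w (l p) = hact N 1 (contract (hact V 1 w) (l p)).
  by rewrite !hact1E.
rewrite e -(zigzag_pR_qR Q Bl); apply: eq_tlift => p1 p2.
rewrite uncurryE tlift_exchange; apply: eq_tlift => a b.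
rewrite homfP contract_act lfun_tlift; apply: eq_tlift => x y.
by rewrite !hactME.
Qed.

Definition orb_lin M (m : M) : 'Hom(regmod H, M) :=
  linfun (fun a : regmod H => hact M a m).
Lemma orb_linE M (m : M) a : orb_lin m a = hact M a m.
Proof. by rewrite linfunE //; lin. Qed.
Fact orb_subproof M (m : M) h v :
  orb_lin m (hact (regmod H) h v) = hact M h (orb_lin m v).
Proof. by rewrite regactE !orb_linE hactME. Qed.
Definition orb M (m : M) : homH (regmod H) M := MkHom (orb_subproof m).
Lemma orbE M (m : M) a : orb m a = hact M a m.
Proof. by rewrite MkHomE orb_linE. Qed.
Lemma hom_regmod M (f : homH (regmod H) M) a : f a = hact M a (f 1).
Proof. by rewrite -homfP regactE mulr1. Qed.
Lemma orb1 M (m : M) : orb m 1 = m.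
Proof. by rewrite orbE hact1E. Qed.
End Currying.

(** * Integrals and invariants of projective modules *)

Section Integrals.
Variables (K : fieldType) (H : falgType K) (Q : quasiHopf H).
Implicit Types M N P U V W : hmod H.
Local Notation Δ := (Delta Q).
Local Notation ε := (eps Q).
Local Notation S := (antip Q).
Local Notation β := (beta Q).
Local Notation "V ⊠ W" := (tensM Q V W) (at level 40, left associativity).
Local Notation "V ^∨" := (dualM Q V) (at level 2, format "V ^∨").
Local Notation qR := (qR Q).
Local Notation pR := (pR Q).

Lemma limg_fullP (U V : vectType K) (e : 'Hom(U, V)) :
  (forall v, exists u, e u = v) <-> limg e = fullv.
Proof.
split=> [e_surj|e_full v].
  apply/vspaceP => v.
  have [u <-] := e_surj v; rewrite memvf; apply: memv_img; exact: memvf.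
have /memv_imgP[u _ ->] : v \in limg e by rewrite e_full memvf.
by exists u.
Qed.

Lemma contract_nat M N V (e : 'Hom(M, N)) w (x : tens M 'Hom(V, K^o)) :
  contract w (tmap e \1 x) = e (contract w x).
Proof.
move: x; apply: tlift_ext; rewrite /contract; [by lin | by lin |] => u phi.
by rewrite tmapE id_lfunE !bilinE ?lfunZ //; lin.
Qed.

Lemma uncurry_nat P V M N (e : homH M N) (l : homH P (M ⊠ V^∨)) :
  compH e (uncurryH l) = uncurryH (compH (tensH Q e (idH V^∨)) l).
Proof.
apply: homH_ext; apply: tlift_ext; [by lin | by lin |] => p v.
rewrite compHE !uncurryE lfun_tlift; apply: eq_tlift => a b.
by rewrite homfP compHE -contract_nat.
Qed.

(** Tensoring with V is left adjoint to tensoring with its dual, which preserves surjections. *)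
Lemma tensM_projective P V : projective P -> projective (P ⊠ V).
Proof.
move=> hP M N e f /limg_fullP e_surj.
have e1_surj : limg (homf (tensH Q e (idH V^∨))) = fullv.
  apply/limg_fullP; elim/tens_ind => [n phi|x y [x' <-] [y' <-]].
    by have [m <-] := e_surj n; exists (m ⊗ phi); rewrite tensHE idHE.
  by exists (x' + y'); rewrite lfunD.
have [l le] := hP _ _ _ (curryH f) e1_surj.
by exists (uncurryH l); rewrite uncurry_nat le curryK.
Qed.

Definition is_invariant M (x : M) := forall h, hact M h x = (ε h : K) *: x.

Lemma invariant_hom M N (f : homH M N) x : is_invariant x -> is_invariant (f x).
Proof. by move=> ix h; rewrite -homfP ix lfunZ. Qed.

Lemma unit_invariant : is_invariant (1 : unitM Q).
Proof. by move=> h; rewrite unitME. Qed.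

Lemma invariant_contract M V w (x : tens M 'Hom(V, K^o)) :
  @is_invariant (M ⊠ V^∨) x ->
  contract w x = tlift (fun a b => hact M a (contract (hact V (b * β) w) x)) qR.
Proof.
move=> ix; pose A a b := hact M a (contract (hact V b w) x).
have Al : bilin A by rewrite /A /contract; lin.
have -> : contract w x = A 1 1 by rewrite /A !hact1E.
apply: (qR_absorb Al) => h a b.
have -> : (ε h : K) *: A a b = hact M a (contract (hact V b w) ((ε h : K) *: x)).
  rewrite /A (linear_funZ (f := fun z => hact M a (contract (hact V b w) z))) //.
  by rewrite /contract; lin.
rewrite -ix contract_act lfun_tlift; apply: eq_tlift => x1 x2.
by rewrite /A !hactME.
Qed.

(* genF and genG at dual bases of V are the inclusions and projections of a
   decomposition of reg ⊠ V into copies of reg. *)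
Section Generators.
Variable V : hmod H.

Definition genF (v : V) : homH (regmod H) (regmod H ⊠ V) :=
  @orb _ _ (regmod H ⊠ V) (extact (regmod H) V pR ((1 : H) ⊗ v)).
Definition genG (phi : 'Hom(V, K^o)) : homH (regmod H ⊠ V) (regmod H) :=
  uncurryH (@orb _ _ (regmod H ⊠ V^∨) ((1 : H) ⊗ phi)).

Lemma genGE phi h v : genG phi (h ⊗ v) =
  tlift (fun a b => tlift (fun x y =>
    (phi (hact V (S y * b) v) : K) *: (a * x : H)) (Δ h)) qR.
Proof.
rewrite /genG uncurryE; apply: eq_tlift => a b.
rewrite orbE contract_act regactE.
rewrite (fun_tlift (f := fun z : H => a * z)); last by lin.
apply: eq_tlift => x y.
by rewrite contractE linearZ /= regactE mulr1 -scalerAr hactME.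
Qed.

Lemma genG_elem phi (y : tens H H) v :
  genG phi (extact (regmod H) V y ((1 : H) ⊗ v)) =
  tlift (fun y1 y2 => tlift (fun x1 x2 => tlift (fun a b =>
    (phi (hact V (S x2 * b * y2) v) : K) *: (a * x1 : H)) qR) (Δ y1)) y.
Proof.
rewrite extactT lfun_tlift; apply: eq_tlift => y1 y2.
rewrite regactE mulr1 genGE tlift_exchange; apply: eq_tlift => x1 x2.
by apply: eq_tlift => a b; rewrite -hactME.
Qed.

Lemma genGF phi v h : genG phi (genF v h) = (phi v : K) *: (h : H).
Proof.
rewrite -compHE hom_regmod compHE regactE.
rewrite /genF orb1 genG_elem.
have Bl : bilin (fun a b : H => (phi (hact V b v) : K) *: (a : H)) by lin.
by rewrite (zigzag_pR_qR Q Bl) hact1E -scalerAr mulr1.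
Qed.

Lemma genFG z : \sum_(i < \dim {:V}) genF (vbasis {:V})`_i (genG (dualv i) z) = z.
Proof.
move: z; apply: tlift_ext; [by apply: lin_sum => i; lin | by lin |] => h v.
transitivity (tlift (fun a b => tlift (fun x y =>
   \sum_(i < \dim {:V}) (dualv i (hact V (S y * b) v) : K) *:
      genF (vbasis {:V})`_i (a * x)) (Δ h)) qR).
  under eq_bigr => i _ do rewrite genGE lfun_tlift.
  rewrite sum_tlift; apply: eq_tlift => a b.
  under eq_bigr => i _ do rewrite lfun_tlift.
  rewrite sum_tlift; apply: eq_tlift => x y.
  by apply: eq_bigr => i _; rewrite lfunZ.
have -> : h ⊗ v = extact (regmod H) V 1 (h ⊗ v) by rewrite -pure1 extactE !hact1E.
rewrite -(zigzag_qR_pRE Q).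
rewrite (fun_tlift (f := fun z => extact (regmod H) V z (h ⊗ v))); last by lin.
apply: eq_tlift => a b.
have -> : extact (regmod H) V (Δ a * pR * (1 ⊗ b)) (h ⊗ v) =
   extact (regmod H) V (Δ a * (pR * (h ⊗ 1)) * (1 ⊗ b)) ((1 : H) ⊗ v).
  have -> : (h ⊗ v) = extact (regmod H) V (h ⊗ 1) ((1 : H) ⊗ v).
    by rewrite extactE regactE mulr1 hact1E.
  by rewrite -[LHS]comp_lfunE -extactM -!mulrA !pureM !mul1r !mulr1.
rewrite -pR_covE.
rewrite (fun_tlift (f := fun z => extact (regmod H) V (Δ a * z * (1 ⊗ b)) ((1 : H) ⊗ v))); last by lin.
apply: eq_tlift => x y.
rewrite (coord_sum (L := fun w => genF w (a * x))); last first.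
  have l : linear (fun w : V => hact (regmod H ⊠ V) (a * x)
    (extact (regmod H) V pR ((1 : H) ⊗ w))) by lin.
  by move=> c w w'; rewrite /genF !orbE; exact: l.
rewrite orbE tensME -[LHS]comp_lfunE -extactM DeltaM.
have -> : (1 : H) ⊗ hact V (S y * b) v =
   extact (regmod H) V (1 ⊗ (S y * b)) ((1 : H) ⊗ v).
  by rewrite extactE regactE mulr1.
by rewrite -[LHS]comp_lfunE -extactM -!mulrA pureM mul1r.
Qed.
End Generators.

(** Invariants of H ⊠ H^∨ correspond to endomorphisms of the regular module, that is to right
    multiplications r_u, and this extracts u: [invariant_unit_part] says that x is (r_u ⊗ 1) applied
    to the coevaluation. *)
Definition unit_part (x : tens (regmod H) 'Hom(regmod H, K^o)) : H :=
  tlift (fun a b : H => a * (contract (b : regmod H) x : H)) qR.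

Lemma unit_part_linear : linear unit_part.
Proof. by rewrite /unit_part /contract; lin. Qed.

Lemma invariant_unit_part x w :
  @is_invariant (regmod H ⊠ (regmod H)^∨) x ->
  contract (w : regmod H) x = β * w * unit_part x :> H.
Proof.
move=> ix; rewrite (invariant_contract _ ix).
(* Invariance and the covariance of [qR] move h to the front; it is needed for h = β w, the argument
   produced by [invariant_contract]. *)
have e h : tlift (fun a b : H => a * (contract ((b * h) : regmod H) x : H)) qR =
    h * unit_part x.
  rewrite /unit_part (fun_tlift (f := fun z => h * z)); last by lin.
  have Bl : bilin (fun a b : H => a * (contract (b : regmod H) x : H)).
    by rewrite /contract; lin.
  transitivity (tlift (fun a b => (h * a) * (contract (b : regmod H) x : H)) qR); last first.
    by apply: eq_tlift => a b; rewrite mulrA.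
  rewrite -(qR_cov Q Bl).
  transitivity (tlift (fun h1 h2 => (ε h1 : K) *:
     tlift (fun a b : H => a * (contract ((b * h2) : regmod H) x : H)) qR) (Δ h)).
    rewrite (counit_l Q (F := fun h =>
      tlift (fun a b : H => a * (contract ((b * h) : regmod H) x : H)) qR)) //.
    by rewrite /contract; lin.
  apply: eq_tlift => h1 h2.
  rewrite (fun_tlift _ _ (lin_scale _)) tlift_exchange; apply: eq_tlift => a b.
  have -> : (ε h1 : K) *: (a * (contract ((b * h2) : regmod H) x : H)) =
      a * (contract ((b * h2) : regmod H) (hact (regmod H ⊠ (regmod H)^∨) h1 x) : H).
    rewrite ix (linear_funZ (f := fun z => a * (contract ((b * h2) : regmod H) z : H))) //.
    by rewrite /contract; lin.
  rewrite contract_act (fun_tlift (f := fun z : H => a * z)); last by lin.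
  by apply: eq_tlift => x1 x2; rewrite !regactE !mulrA.
rewrite -e; apply: eq_tlift => a b.
by rewrite !regactE !mulrA.
Qed.

Lemma unit_part_inj x : @is_invariant (regmod H ⊠ (regmod H)^∨) x ->
  unit_part x = 0 -> x = 0.
Proof.
move=> ix x0; apply: contract_inj => w.
rewrite (invariant_unit_part _ ix) x0 mulr0.
by rewrite (linear_fun0 (@contract_linear _ _ _ _ w)).
Qed.

Lemma beta_neq0 : β != 0.
Proof.
apply/eqP => b0; have := oner_neq0 K.
by rewrite -(eps_beta Q) b0 linear0 eqxx.
Qed.

Lemma left_integralP L : left_integral Q L <-> @is_invariant (regmod H) L.
Proof. by split=> i h; have := i h; rewrite regactE. Qed.

(** The coevaluation of H is an invariant, nonzero because β is. Splitting H ⊠ H^∨ into copies of H,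
    some coordinate of it is a nonzero invariant of H, hence a left integral. *)
Lemma integral_neq0_exists : exists2 L : H, left_integral Q L & L != 0.
Proof.
pose V := (regmod H)^∨; pose T := coev Q (regmod H) (1 : K^o).
have iT : @is_invariant (regmod H ⊠ V) T by apply: invariant_hom; exact: unit_invariant.
have nzT : T != 0.
  apply/eqP => T0; have := coev_contract Q (1 : regmod H).
  rewrite -/T T0 (linear_fun0 (@contract_linear _ _ _ _ _)) regactE mulr1 => /esym/eqP.
  by rewrite (negPf beta_neq0).
case: (pickP (fun i : 'I_(\dim {:V}) => (genG (dualv i) T : H) != 0)) => [i nzi|z].
  exists (genG (dualv i) T) => //.
  by apply/left_integralP; apply: invariant_hom.
case/eqP: nzT; rewrite -(genFG T) big1 // => i _.
by rewrite (eqP (negbFE (z i))) linear0.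
Qed.

Lemma genF_linear V h : linear (fun v : V => genF v h).
Proof.
have l : linear (fun w : V => hact (regmod H ⊠ V) h
  (extact (regmod H) V pR ((1 : H) ⊗ w))) by lin.
by move=> c w w'; rewrite /genF !orbE; exact: l.
Qed.

Lemma genF_eq0 V (v : V) (h : H) : h != 0 -> genF v h = 0 -> v = 0.
Proof.
move=> nzh F0; rewrite (coord_vbasis (memvf v)) big1 // => i _.
have := genGF (dualv i) v h; rewrite F0 linear0 dualvE => /esym/eqP.
by rewrite scaler_eq0 (negPf nzh) orbF => /eqP ->; rewrite scale0r.
Qed.

(* v |-> genF v L embeds reg^∨ in the invariants of reg ⊠ reg^∨, which
   unit_part embeds in H; by dimension the composite th is onto. *)
Lemma integral_unique (L L' : H) : left_integral Q L -> L != 0 -> left_integral Q L' ->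
  exists c : K, L' = c *: L.
Proof.
move=> iL nzL iL'; pose V := (regmod H)^∨.
have inv_F (v : V) (M : H) : left_integral Q M -> @is_invariant (regmod H ⊠ V) (genF v M).
  by move=> iM; apply: invariant_hom; apply/left_integralP.
pose th : 'Hom(V, H) := linfun (fun v : V => unit_part (genF v L)).
have thE v : th v = unit_part (genF v L).
  by rewrite linfunE // => c u w; rewrite -unit_part_linear genF_linear.
have th_inj : lker th == 0%VS.
  apply/lker0P => u v e; apply/eqP; rewrite -subr_eq0; apply/eqP.
  apply: (genF_eq0 nzL); apply: unit_part_inj; first exact: inv_F.
  by rewrite -thE linearB /= e subrr.
have th_surj h : exists v, th v = h.
  have : limg th = fullv.
    apply/eqP; rewrite eqEdim subvf /= limg_dim_eq; last first.
      by rewrite (eqP th_inj) capv0.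
    by rewrite !dimvf -[leqRHS]/(dim H * 1)%N muln1.
  by move/limg_fullP.
pose w : V := linfun (ε : H -> K^o).
have nzw : w != 0.
  apply/eqP => /lfunP/(_ 1); rewrite lfunE /= zero_lfunE => /eqP.
  by rewrite eps1 oner_eq0.
have [i nzi] : exists i, dualv i w != 0.
  apply/existsP; apply: contraNT nzw; rewrite negb_exists => /forallP z.
  rewrite (coord_vbasis (memvf w)) big1 // => i _.
  by rewrite -dualvE (eqP (negbNE (z i))) scale0r.
have [v ev] := th_surj (unit_part (genF w L')).
have eF : genF v L = genF w L'.
  apply/eqP; rewrite -subr_eq0; apply/eqP; apply: unit_part_inj.
    by move=> h; rewrite linearB /= inv_F // inv_F // scalerBr.
  by rewrite (linear_funB unit_part_linear) -ev thE subrr.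
exists ((dualv i w : K)^-1 * (dualv i v : K)); rewrite -scalerA.
by rewrite -genGF eF genGF scalerA mulVf // scale1r.
Qed.

Definition epsH : homH (regmod H) (unitM Q) := @orb _ _ (unitM Q) (1 : K^o).
Lemma epsHE h : epsH h = ε h.
Proof. by rewrite orbE unitME; exact: mulr1. Qed.

Section Projective.
Variables (L : H) (iL : left_integral Q L) (nzL : L != 0).
Variables (X : hmod H) (hX : projective X).

(** ε ⊗ id makes X a retract of H ⊠ X, a sum of copies of H. There the coordinates of an invariant
    are integrals, hence multiples c_i L, and L factors out. *)
Lemma projective_invariant (x : X) : is_invariant x -> exists y, x = hact X L y.
Proof.
move=> ix; pose e := compH (lunit Q X) (tensH Q epsH (idH X)).
have eE h y : e (h ⊗ y) = (ε h : K) *: y by rewrite compHE tensHE idHE lunitE epsHE.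
have e_surj : limg (homf e) = fullv.
  by apply/limg_fullP => y; exists (1 ⊗ y); rewrite eE eps1 scale1r.
have [s es] := hX (idH X) e_surj.
have iG i : exists c : K, genG (dualv i) (s x) = c *: L.
  apply: integral_unique => //; apply/left_integralP; apply: invariant_hom.
  exact: invariant_hom.
have [c ec] : exists c : 'I_(\dim {:X}) -> K, forall i, genG (dualv i) (s x) = c i *: L.
  exists (fun i => sval (sig_eqW (iG i))) => i; exact: svalP (sig_eqW (iG i)).
exists (e (\sum_(i < \dim {:X}) c i *: genF (vbasis {:X})`_i 1)).
rewrite -homfP -[LHS](idHE x) -es compHE; congr (e _).
rewrite -[LHS]genFG linear_sum; apply: eq_bigr => i _.
rewrite ec lfunZ [RHS]linearZ; congr (_ *: _); exact: (hom_regmod (genF _) L).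
Qed.

Hypothesis H_unimodular : unimodular Q.

(** Lift b along ε to b' : X -> H. Then 0 = b'(L y) = L b'(y) = ε(b'(y)) L, where the last equality
    needs L to be a right integral. *)
Lemma projective_integral_ker (b : homH X (unitM Q)) y :
  hact X L y = 0 -> b y = 0.
Proof.
move=> y0.
have e_surj : limg (homf epsH) = fullv.
  apply/limg_fullP => c; exists ((c : K) *: 1).
  by rewrite lfunZ epsHE eps1; exact: mulr1.
have [b' eb] := hX b e_surj.
rewrite -eb compHE epsHE.
have := congr1 b' y0; rewrite homfP linear0 regactE (iffLR (H_unimodular L) iL).
by move/eqP; rewrite scaler_eq0 (negPf nzL) orbF => /eqP.
Qed.
End Projective.
End Integrals.

(** * The modified trace of an integral *)

Section Trace.
Variables (K : fieldType) (H : falgType K) (Q : quasiHopf H).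
Implicit Types M N P U V W : hmod H.
Local Notation Δ := (Delta Q).
Local Notation Φ := (Phi Q).
Local Notation Ψ := (Phi Q)^-1.
Local Notation S := (antip Q).
Local Notation α := (alpha Q).
Local Notation "V ⊠ W" := (tensM Q V W) (at level 40, left associativity).
Local Notation "V ^∨" := (dualM Q V) (at level 2, format "V ^∨").
Local Notation pR := (pR Q).

Variables (f : tens H H) (g : H) (f_twist : drinfeld_twist Q f).
Variable gP : is_pivot Q f g.
Hypothesis H_unimodular : unimodular Q.
Variables (L : H) (iL : left_integral Q L) (nzL : L != 0).

Let f_unit := twist_unit f_twist.
Let f_antip := twist_antip f_twist.
Let f_alpha := twist_alpha f_twist.

Local Notation cv P := (coev Q P (1 : K^o)).

Section DualMap.
Variables (M N : hmod H) (a : homH M N).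
Definition dual_lin : 'Hom('Hom(N, K^o), 'Hom(M, K^o)) :=
  linfun (fun phi : 'Hom(N, K^o) => (phi \o homf a)%VF).
Lemma dual_linE phi x : dual_lin phi x = phi (a x).
Proof.
by rewrite linfunE ?comp_lfunE // => c u v; rewrite comp_lfunDl -comp_lfunZl.
Qed.
Fact dual_subproof h phi : dual_lin (hact N^∨ h phi) = hact M^∨ h (dual_lin phi).
Proof.
apply/lfunP => x.
by rewrite dual_linE !dual_act dual_linE homfP.
Qed.
Definition dualH : homH N^∨ M^∨ := @MkHom _ _ N^∨ M^∨ dual_lin dual_subproof.
Lemma dualHE (phi : 'Hom(N, K^o)) x : (dualH phi : 'Hom(M, K^o)) x = phi (a x).
Proof. exact: dual_linE. Qed.
End DualMap.

Lemma contract_dualH M N P (b : homH M N) w (x : tens P 'Hom(N, K^o)) :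
  contract w (tensH Q (idH P) (dualH b) x) = contract (b w) x.
Proof.
move: x; apply: tlift_ext; rewrite /contract; [by lin | by lin |] => u phi.
by rewrite tensHE idHE !bilinE ?dualHE //; lin.
Qed.

Lemma contract_tensH M N P (a : homH M N) w (x : tens M 'Hom(P, K^o)) :
  contract w (tensH Q a (idH P^∨) x) = a (contract w x).
Proof. by rewrite -contract_nat. Qed.

Lemma coev_invariant P : @is_invariant K H Q (P ⊠ P^∨) (cv P).
Proof. by apply: invariant_hom; exact: unit_invariant. Qed.

(* (hact L)^-1 is only a partial inverse: it picks some y with L y = (k ⊗ 1) coev.
   By mtr_solve the choice of y is immaterial. *)
Definition mtr P (k : homH P P) : K^o :=
  evR gP P (((hact (P ⊠ P^∨) L)^-1)%VF (tensH Q k (idH P^∨) (cv P))).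

Lemma homf_linear M N : linear (@homf K H M N).
Proof. by move=> c k k'; rewrite /homf linearP. Qed.

Lemma tensH_linearl M N P (x : tens M P) :
  linear (fun k : homH M N => tensH Q k (idH P) x).
Proof.
move=> c k k'; move: x; apply: tlift_ext; [by lin | by apply: lin_add; lin |] => m p.
by rewrite !tensHE homf_linear add_lfunE scale_lfunE pureP.
Qed.

Lemma mtr_linear P : linear (@mtr P).
Proof.
have l : linear (fun x : tens P 'Hom(P, K^o) =>
  evR gP P (((hact (P ⊠ P^∨) L)^-1)%VF x)) by lin.
by move=> c k k'; rewrite /mtr (@tensH_linearl P P P^∨) l.
Qed.

Definition integral_trace : trace_family H := fun P _ => linfun (@mtr P).
Lemma integral_traceE P hP k : @integral_trace P hP k = mtr k.
Proof. by rewrite /integral_trace linfunE //; exact: mtr_linear. Qed.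

Lemma mtr_solve P (k : homH P P) y : projective P ->
  hact (P ⊠ P^∨) L y = tensH Q k (idH P^∨) (cv P) -> mtr k = evR gP P y.
Proof.
move=> hP ey; rewrite /mtr -ey; set z := (_^-1)%VF _.
have Lz : hact (P ⊠ P^∨) L z = hact (P ⊠ P^∨) L y.
  by apply: limg_lfunVK; apply: memv_img; exact: memvf.
have Lzy : hact (P ⊠ P^∨) L (z - y) = 0 by rewrite linearB [X in X - _]Lz subrr.
have := projective_integral_ker iL nzL (tensM_projective (V := P^∨) hP)
  H_unimodular (evR gP P) Lzy.
by move=> e; apply/eqP; rewrite -subr_eq0 -e linearB.
Qed.

(** One preimage y of (a ⊗ 1) coev under L, taken in P' ⊠ P^∨, serves both traces: b moves it into P
    ⊠ P^∨ and the dual of b into P' ⊠ P'^∨. *)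
Lemma mtr_cyclic P P' (a : homH P P') (b : homH P' P) : projective P -> projective P' ->
  mtr (compH b a) = mtr (compH a b).
Proof.
move=> hP hP'.
have [y ey] := projective_invariant iL nzL (tensM_projective (V := P^∨) hP')
  (invariant_hom (tensH Q a (idH P^∨)) (@coev_invariant P)).
rewrite (@mtr_solve P _ (tensH Q b (idH P^∨) y)) //; last first.
  rewrite -homfP -ey; apply: contract_inj => w.
  by rewrite !contract_tensH compHE.
rewrite (@mtr_solve P' _ (tensH Q (idH P') (dualH b) y)) //; last first.
  rewrite -homfP -ey; apply: contract_inj => w.
  by rewrite contract_dualH !contract_tensH compHE !coev_contract [b (hact _ _ _)]homfP.
move: y {ey}; apply: tlift_ext; [by lin | by lin |] => u phi.
by rewrite !tensHE !idHE !evRE dualHE homfP.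
Qed.

Lemma assocH_nat U U' V W (k : homH U U') (x : tens U (tens V W)) :
  assocH Q U' V W (tensH Q k (idH (V ⊠ W)) x) =
  tensH Q (tensH Q k (idH V)) (idH W) (assocH Q U V W x).
Proof.
move: x; apply: tlift_ext; [by lin | by lin |] => u.
apply: tlift_ext; [by lin | by lin |] => v w.
rewrite tensHE idHE !assocHE lfun_tlift3; apply: eq_tlift3 => a b c.
by rewrite !tensHE !idHE homfP.
Qed.

Lemma assocVHK U V W x : assocH Q U V W (assocVH Q U V W x) = x.
Proof. exact: assocV_linK. Qed.

(** The coproduct of the pivot gives f Δ(S(α) g) = SS(gamma) (g ⊗ g): the right evaluation of a
    tensor product is the antipode image of the nested left one. The squares of S met in expanding
    it are absorbed by g. *)
Lemma pivot_gamma (W : lmodType K) (B : H -> H -> W) : bilin B ->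
  tlift B (f * Δ (S α * g)) =
  tlift3 (fun a b c => tlift (fun x y => tlift3 (fun a' b' c' =>
    B (S c * S α * g * a' * x) (S b * S c' * S α * g * b' * y)) Ψ) (Δ a)) Φ.
Proof.
move=> Bl; have gu := pivot_unit gP.
have -> : f * Δ (S α * g) = SS Q (gamma Q) * (g ⊗ g).
  rewrite DeltaM mulrA f_antip -mulrA (pivot_DeltaE gP) -f_alpha SSM.
  by rewrite !mulrA mulrK.
have l : linear (fun z => tlift B (SS Q z * (g ⊗ g))) by rewrite /SS; lin.
rewrite (tens_expand (f := fun z => tlift B (SS Q z * (g ⊗ g)))) //.
have Bl' : bilin (fun a b => tlift B (SS Q (a ⊗ b) * (g ⊗ g))).
  by rewrite /SS; lin.
rewrite (gamma_alt Q Bl'); apply: eq_tlift3 => a b c; apply: eq_tlift => x y.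
apply: eq_tlift3 => a' b' c'.
rewrite SSE pureM bilinE //.
have gS z : S (S z) * g = g * z by rewrite (pivot_S2 gP) mulrVK.
by congr B; rewrite !antipM -!mulrA gS !mulrA -?(mulrA _ _ g) ?gS !mulrA.
Qed.

Section PartialTrace.
Variables P V : hmod H.

Definition coev_in : homH P ((P ⊠ V) ⊠ V^∨) :=
  compH (assocH Q P V V^∨) (compH (tensH Q (idH P) (coev Q V)) (runitV Q P)).

Lemma coev_in_contract p w :
  contract w (coev_in p) = extact P V pR (p ⊗ w).
Proof.
have := curry_contract (idH (P ⊠ V)) p w.
rewrite /curryH compHE -/coev_in contract_tensH idHE => ->.
by rewrite extactT; apply: eq_tlift => a b; rewrite idHE.
Qed.

Definition coev_nested : homH (unitM Q) ((P ⊠ V) ⊠ (V^∨ ⊠ P^∨)) :=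
  compH (assocVH Q (P ⊠ V) V^∨ P^∨)
    (compH (tensH Q coev_in (idH P^∨)) (coev Q P)).

Definition evR_in : homH ((P ⊠ V) ⊠ V^∨) P :=
  compH (runit Q P) (compH (tensH Q (idH P) (evR gP V)) (assocVH Q P V V^∨)).

(** Closes only the V strand. Applied to a map tensored into [coev_nested] it produces the partial
    trace inside P ⊠ P^∨. *)
Definition evR_pass : homH ((P ⊠ V) ⊠ (V^∨ ⊠ P^∨)) (P ⊠ P^∨) :=
  compH (tensH Q evR_in (idH P^∨)) (assocH Q (P ⊠ V) V^∨ P^∨).

Lemma ptraceE (k : homH (P ⊠ V) (P ⊠ V)) p :
  ptrace gP k p = evR_in (tensH Q k (idH V^∨) (coev_in p)).
Proof. by rewrite /ptrace /evR_in /coev_in !compHE. Qed.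

Lemma coev_nested_ptrace (k : homH (P ⊠ V) (P ⊠ V)) :
  evR_pass (tensH Q k (idH (V^∨ ⊠ P^∨)) (coev_nested (1 : K^o))) =
  tensH Q (ptrace gP k) (idH P^∨) (cv P).
Proof.
rewrite /evR_pass /coev_nested !compHE assocH_nat assocVHK.
move: (cv P); apply: tlift_ext; [by lin | by lin |] => p phi.
by rewrite !tensHE !idHE ptraceE.
Qed.

Lemma evR_inE p v (phi : 'Hom(V, K^o)) : evR_in (p ⊗ v ⊗ phi) =
  tlift3 (fun a b c => (phi (hact V (S c * S α * g * b) v) : K) *: hact P a p) Ψ.
Proof.
rewrite /evR_in compHE compHE assocVHE !lfun_tlift3; apply: eq_tlift3 => a b c.
by rewrite tensHE idHE evRE runitE dual_act -!hactME !mulrA.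
Qed.

Variable gam : homH (V^∨ ⊠ P^∨) (P ⊠ V)^∨.
Hypothesis gamE : forall (phi : 'Hom(V, K^o)) (psi : 'Hom(P, K^o)) x,
  (gam (phi ⊗ psi) : 'Hom(tens P V, K^o)) x =
  tlift (fun p v => (psi p : K) *: phi v) (extact P V f x).

Lemma evR_gam y :
  evR gP (P ⊠ V) (tensH Q (idH (P ⊠ V)) gam y) = evR gP P (evR_pass y).
Proof.
move: y; apply: tlift_ext; [by lin | by lin |] => x.
apply: tlift_ext; [by lin | by lin |] => phi psi.
move: x; apply: tlift_ext; [by lin | by lin |] => p v.
rewrite tensHE idHE evRE gamE.
have -> : extact P V f (hact (P ⊠ V) (S α * g) (p ⊗ v)) =
    extact P V (f * Δ (S α * g)) (p ⊗ v) by rewrite extactM comp_lfunE.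
have Bl : bilin (fun a b => (psi (hact P a p) : K) *: phi (hact V b v)) by lin.
transitivity (tlift (fun a b => (psi (hact P a p) : K) *: phi (hact V b v))
   (f * Δ (S α * g))).
  rewrite extactT (fun_tlift (f := fun z =>
    tlift (fun p v => (psi p : K) *: phi v) z)); last by lin.
  by apply: eq_tlift => a b; rewrite bilinE //; lin.
rewrite (pivot_gamma Bl) /evR_pass compHE assocHE !lfun_tlift3.
apply: eq_tlift3 => a b c; rewrite tensM_act !pure_tliftl !lfun_tlift.
apply: eq_tlift => x y; rewrite tensHE idHE evR_inE pure_tlift3l lfun_tlift3.
apply: eq_tlift3 => a' b' c'.
rewrite pureZl lfunZ evRE !dual_act -!hactME !mulrA; exact: mulrC.
Qed.

Definition contract2 v p (z : tens (P ⊠ V) (tens 'Hom(V, K^o) 'Hom(P, K^o))) :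
    tens P V :=
  tlift (fun (x : tens P V) => tlift (fun (phi : 'Hom(V, K^o)) (psi : 'Hom(P, K^o)) =>
    (psi p : K) *: ((phi v : K) *: x))) z.

Lemma contract_gam v p z :
  contract (p ⊗ v : P ⊠ V) (tensH Q (idH (P ⊠ V)) gam z) =
  tlift (fun a b => contract2 (hact V b v) (hact P a p) z) f.
Proof.
move: z; apply: tlift_ext; [by rewrite /contract; lin | by rewrite /contract2; lin |] => x.
apply: tlift_ext; [by rewrite /contract; lin | by rewrite /contract2; lin |] => phi psi.
rewrite tensHE idHE contractE gamE extactT.
rewrite (fun_tlift (f := fun z => (tlift (fun (p : P) (v : V) =>
  (psi p : K) *: phi v) z : K) *: x)); last by lin.
apply: eq_tlift => a b; rewrite /contract2 !bilinE ?scalerA //; lin.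
Qed.

Lemma contract2_assocV v p Z :
  contract2 v p (assocVH Q (P ⊠ V) V^∨ P^∨ Z) =
  tlift3 (fun a b c => hact (P ⊠ V) a
    (contract (hact V (S b) v) (contract (hact P (S c) p) Z))) Ψ.
Proof.
move: Z; apply: tlift_ext;
  [by rewrite /contract2; lin | by rewrite /contract; lin |] => z psi.
move: z; apply: tlift_ext;
  [by rewrite /contract2; lin | by rewrite /contract; lin |] => x phi.
rewrite assocVHE /contract2 (fun_tlift3 (f := fun z => tlift (fun (x : tens P V) =>
  tlift (fun (phi : 'Hom(V, K^o)) (psi : 'Hom(P, K^o)) =>
    (psi p : K) *: ((phi v : K) *: x))) z)); last by lin.
apply: eq_tlift3 => a b c; rewrite bilinE; last by lin.
rewrite bilinE; last by lin.
rewrite !dual_act contractE (linear_funZ (@contract_linear _ _ _ _ _)) contractE.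
by rewrite !lfunZ.
Qed.

(** Read as an endomorphism of P ⊠ V, the left side acts by [delta0 * f] and the right side by β, so
    the claim is [Delta_beta]. *)
Lemma coev_nestedE :
  tensH Q (idH (P ⊠ V)) gam (coev_nested (1 : K^o)) = cv (P ⊠ V).
Proof.
apply: contract_inj => w; rewrite coev_contract.
move: w; apply: tlift_ext => [||p v]; [by rewrite /contract; lin | by lin |].
rewrite contract_gam tensME (Delta_beta f_antip f_alpha).
rewrite extactM [RHS]comp_lfunE extactT lfun_tlift; apply: eq_tlift => a b.
rewrite /coev_nested !compHE contract2_assocV /delta0.
rewrite (fun_tlift3 (f := fun z => extact P V z (hact P a p ⊗ hact V b v))); last by lin.
apply: eq_tlift3 => x y z.
rewrite contract_tensH coev_contract coev_in_contract tensME.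
by rewrite !extactM !comp_lfunE extactE hactME.
Qed.

(** A preimage y under L of k applied to the nested coevaluation computes both traces: [gam] turns
    it into a preimage for k, [evR_pass] into one for the partial trace, and [evR_gam] equates the
    evaluations. *)
Lemma mtr_partial (k : homH (P ⊠ V) (P ⊠ V)) : projective P ->
  mtr k = mtr (ptrace gP k).
Proof.
move=> hP; have hPV : projective (P ⊠ V) := tensM_projective hP.
have ic : is_invariant Q (tensH Q k (idH (V^∨ ⊠ P^∨)) (coev_nested (1 : K^o))).
  by apply: invariant_hom; apply: invariant_hom; exact: unit_invariant.
have [y ey] := projective_invariant iL nzL (tensM_projective (V := V^∨ ⊠ P^∨) hPV) ic.
rewrite (@mtr_solve _ k (tensH Q (idH (P ⊠ V)) gam y)) //; last first.
  rewrite -homfP -ey -coev_nestedE; move: (coev_nested _).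
  apply: tlift_ext; [by lin | by lin |] => x z.
  by rewrite !tensHE !idHE.
rewrite evR_gam (@mtr_solve _ (ptrace gP k) (evR_pass y)) //.
by rewrite -homfP -ey coev_nested_ptrace.
Qed.
End PartialTrace.

Lemma integral_trace_modified : right_modified_trace gP integral_trace.
Proof.
split=> [P P' hP hP' a b|P V hP hPV k]; rewrite !integral_traceE.
  exact: mtr_cyclic.
by have [gam [gamE _]] := twist_dual f_twist P V; apply: mtr_partial gamE _ _.
Qed.

End Trace.

(** * Nondegeneracy of the trace of an integral *)

Section Nondegeneracy.
Variables (K : fieldType) (H : falgType K) (Q : quasiHopf H).
Implicit Types M N P U V W : hmod H.
Local Notation ε := (eps Q).
Local Notation S := (antip Q).
Local Notation α := (alpha Q).
Local Notation β := (beta Q).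
Local Notation "V ^∨" := (dualM Q V) (at level 2, format "V ^∨").
Local Notation qR := (qR Q).
Local Notation reg := (regmod H).
Local Notation orbr x := (@orb K H reg x).
Local Notation cv P := (coev Q P (1 : K^o)).

Lemma orb_comp (x y : H) : compH (orbr y) (orbr x) = orbr (x * y).
Proof. by apply: homH_ext => h; rewrite compHE !orbE !regactE mulrA. Qed.

Lemma hom_reg_orb (k : homH reg reg) : k = orbr (k (1 : H)).
Proof. by apply: homH_ext => h; rewrite hom_regmod orbE. Qed.

Lemma orb_linear M : linear (fun m : M => orb m).
Proof.
move=> c m m'; apply: homH_ext => h.
by rewrite homf_linear add_lfunE scale_lfunE !orbE linearP.
Qed.

Lemma bidual_eval V (phi : 'Hom('Hom(V, K^o), K^o)) :
  exists w, forall xi : 'Hom(V, K^o), phi xi = xi w.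
Proof.
exists (\sum_(i < \dim {:V}) (phi (dualv i) : K) *: (vbasis {:V})`_i) => xi.
rewrite {1}[xi]dualv_expand (fun_sum (f := phi)); last by lin.
rewrite (fun_sum (f := xi)); last by lin.
by apply: eq_bigr => i _; rewrite !lfunZ; exact: mulrC.
Qed.

Lemma eps_antip h : ε (S h) = ε h.
Proof.
have := congr1 ε (antip_alpha Q h).
rewrite (fun_tlift (f := ε)); last by lin.
rewrite [RHS]linearZ /= (eps_alpha Q) => e.
rewrite -[RHS]mulr1 -[RHS]e.
rewrite -(counit_r Q (F := fun h => ε (S h))); last by lin.
apply: eq_tlift => a b; rewrite !epsM (eps_alpha Q) mulr1; exact: mulrC.
Qed.

Lemma tlift3_eq0 (U V X : vectType K) (W : lmodType K) (F : U -> V -> X -> W) x :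
  (forall u v t, F u v t = 0) -> tlift3 F x = 0.
Proof.
move=> F0; rewrite /tlift3 /tlift big1 // => i _; rewrite big1 // => j _.
by rewrite big1 ?scaler0 // => k _; rewrite big1 // => l _; rewrite F0 scaler0.
Qed.

Lemma beta_eq0 (x : H) : (forall w, β * w * x = 0) -> x = 0.
Proof.
move=> b0; rewrite -[x]mul1r -(antip_PhiVE Q (G := fun z => z * x)); last by lin.
apply: tlift3_eq0 => a b c.
have -> : a * β * S b * α * c * x = a * (β * (S b * α * c) * x) by rewrite !mulrA.
by rewrite b0 mulr0.
Qed.

Section IntegralTrace.
Variables (f : tens H H) (g : H) (f_twist : drinfeld_twist Q f).
Variable gP : is_pivot Q f g.
Hypothesis H_unimodular : unimodular Q.
Variables (L : H) (iL : left_integral Q L) (nzL : L != 0).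

Local Notation mu x := (mtr gP L (orbr x)).

(** Under ε the first leg of [qR] disappears and the second becomes α, so the composite is a right
    evaluation. Writing the vector that represents φ as g y cancels the pivot arising from S^2. *)
Lemma eps_genG (phi : 'Hom(reg^∨, K^o)) y z :
    (forall xi : 'Hom(reg, K^o), phi xi = xi (g * y)) ->
  ε (genG Q phi z) = evR gP reg (tensH Q (orbr y) (idH reg^∨) z).
Proof.
move=> phiE; move: z; apply: tlift_ext; [by lin | by lin |] => h xi.
rewrite tensHE idHE evRE orbE genGE (fun_tlift (f := ε)); last by lin.
have Bl : bilin (fun a b : H => (ε a : K) *: phi (hact reg^∨ b xi)) by lin.
transitivity (tlift (fun a b => (ε a : K) *: phi (hact reg^∨ (S h * b) xi)) qR).
  apply: eq_tlift => a b; rewrite (fun_tlift (f := ε)); last by lin.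
  rewrite -(counit_l Q (F := fun h => (ε a : K) *: phi (hact reg^∨ (S h * b) xi))); last by lin.
  apply: eq_tlift => x y'.
  rewrite [ε (_ *: _)]linearZ /= epsM [_ *: _ in RHS]scalerA [(ε x : K) * _]mulrC; exact: mulrC.
rewrite tlift_qR; last by lin.
have Bl' : bilin (fun b c : H => phi (hact reg^∨ (S h * (S b * α * c)) xi)) by lin.
rewrite (PhiV_counit1 Q Bl') antip1 mul1r mulr1 phiE dual_act.
have gu := pivot_unit gP.
by rewrite !regactE antipM (pivot_S2 gP) -!mulrA mulKr.
Qed.

(* If mu (x * y) = 0 for all y, then (r_x ⊗ 1) coev = L z is killed by every genG:
   ε (genG z) is some mu (x * y) by eps_genG. *)
Lemma mu_nondegenerate x : (forall y, mu (x * y) = 0) -> x = 0.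
Proof.
move=> mu0; have hreg := @projective_regmod K H.
have [z ez] := projective_invariant iL nzL (tensM_projective (Q := Q) (V := reg^∨) hreg)
  (invariant_hom (tensH Q (orbr x) (idH reg^∨)) (@coev_invariant _ _ Q reg)).
have G0 (phi : 'Hom(reg^∨, K^o)) :
    genG Q phi (tensH Q (orbr x) (idH reg^∨) (cv reg)) = 0.
  have gu := pivot_unit gP; have [w phiE] := bidual_eval phi.
  rewrite ez homfP regactE (iffLR (H_unimodular L) iL).
  rewrite (@eps_genG _ (g^-1 * w)) => [|xi]; last by rewrite phiE mulVKr.
  rewrite -(@mtr_solve _ _ _ _ _ gP H_unimodular _ iL nzL _ (orbr (x * (g^-1 * w)))) //.
    by rewrite mu0 scale0r.
  rewrite -homfP -ez; apply: contract_inj => v.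
  by rewrite !contract_tensH -orb_comp compHE.
have e0 : tensH Q (orbr x) (idH reg^∨) (cv reg) = 0.
  by rewrite -[LHS](genFG (Q := Q)) big1 // => i _; rewrite G0 linear0.
apply: beta_eq0 => w.
have := congr1 (contract (w : reg)) e0.
rewrite contract_tensH coev_contract orbE !regactE.
by rewrite (linear_fun0 (@contract_linear _ _ _ _ _)).
Qed.
End IntegralTrace.
End Nondegeneracy.

Section FrobeniusForm.
Variables (K : fieldType) (H : falgType K) (m : 'Hom(H, K^o)).

Definition form_map : 'Hom(H, 'Hom(H, K^o)) :=
  linfun (fun a : H => linfun (fun x : H => m (x * a))).
Lemma form_mapE a x : form_map a x = m (x * a).
Proof.
rewrite linfunE ?linfunE // => [|c u v]; first by lin.
apply/lfunP => y; rewrite add_lfunE scale_lfunE !linfunE; try by lin.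
by rewrite mulrDr -scalerAr linearP.
Qed.

Hypothesis m_nondeg : forall a, (forall x, m (x * a) = 0) -> a = 0.

Lemma form_map_inj : injective form_map.
Proof.
move=> a b e; apply/eqP; rewrite -subr_eq0; apply/eqP; apply: m_nondeg => x.
by rewrite -form_mapE linearB /= e subrr zero_lfunE.
Qed.

Lemma form_mapVK nu : form_map ((form_map^-1)%VF nu) = nu.
Proof.
apply: limg_lfunVK; have -> : limg form_map = fullv; last exact: memvf.
have k0 : lker form_map == 0%VS by apply/lker0P; exact: form_map_inj.
apply/eqP; rewrite eqEdim subvf /= limg_dim_eq; last by rewrite (eqP k0) capv0.
by rewrite !dimvf -[leqLHS]/(dim H * 1)%N muln1.
Qed.

Lemma form_repr (nu : 'Hom(H, K^o)) : exists a, forall x, nu x = m (x * a).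
Proof. by exists ((form_map^-1)%VF nu) => x; rewrite -form_mapE form_mapVK. Qed.

Section ModuleMap.
Variables (M : hmod H) (chi : 'Hom(M, K^o)).
Definition orbit_form : 'Hom(M, 'Hom(H, K^o)) :=
  linfun (fun u : M => linfun (fun x : H => chi (hact M x u))).
Lemma orbit_formE u x : orbit_form u x = chi (hact M x u).
Proof.
rewrite linfunE ?linfunE // => [|c v w]; first by lin.
apply/lfunP => y; rewrite add_lfunE scale_lfunE !linfunE; try by lin.
by rewrite !linearP.
Qed.
Fact form_hom_subproof h u :
  (form_map^-1 \o orbit_form)%VF (hact M h u) =
  hact (regmod H) h ((form_map^-1 \o orbit_form)%VF u).
Proof.
apply: form_map_inj; apply/lfunP => x.
rewrite regactE [RHS]form_mapE mulrA -form_mapE !comp_lfunE !form_mapVK.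
by rewrite !orbit_formE hactME.
Qed.
(** Over a Frobenius algebra Hom_H(M, H) is the whole dual of M: χ corresponds to the H-linear map
    characterised in [form_homE]. *)
Definition form_hom : homH M (regmod H) := 
  @MkHom _ _ M (regmod H) (form_map^-1 \o orbit_form)%VF form_hom_subproof.
Lemma form_homE u x : m (x * form_hom u) = chi (hact M x u).
Proof. by rewrite -form_mapE [form_hom u]comp_lfunE form_mapVK orbit_formE. Qed.
End ModuleMap.
End FrobeniusForm.

Section Nondegeneracy.
Variables (K : fieldType) (H : falgType K) (Q : quasiHopf H).
Implicit Types M N P U V W : hmod H.
Local Notation "V ⊠ W" := (tensM Q V W) (at level 40, left associativity).
Local Notation reg := (regmod H).
Local Notation orbr x := (@orb K H reg x).

Lemma projective_section P : projective P ->
  exists e (s : homH P (reg ⊠ P)), compH e s = idH P.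
Proof.
move=> hP; pose e := compH (lunit Q P) (tensH Q (epsH Q) (idH P)).
have e_surj : limg (homf e) = fullv.
  apply/limg_fullP => y; exists (1 ⊗ y).
  by rewrite compHE tensHE idHE lunitE epsHE eps1 scale1r.
by have [s es] := hP _ _ _ (idH P) e_surj; exists e, s.
Qed.

(** P embeds into H ⊠ P, and the coordinates of that sum of copies of H are H-linear. *)
Lemma projective_separated P (p : P) : projective P ->
  (forall b : homH P reg, b p = 0) -> p = 0.
Proof.
move=> hP b0; have [e [s es]] := projective_section hP.
rewrite -[p]idHE -es compHE -[s p](genFG (Q := Q)) big1 ?linear0 // => i _.
by have := b0 (compH (genG Q (dualv i)) s); rewrite compHE => ->; rewrite linear0.
Qed.

Local Notation hreg := (@projective_regmod K H).

Section TraceForm.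
Variable t : trace_family H.

Definition trace_form : 'Hom(H, K^o) := linfun (fun x => t hreg (orbr x)).
Lemma trace_formE x : trace_form x = t hreg (orbr x).
Proof.
by rewrite linfunE // => c u v; rewrite (@orb_linear K H reg) linearP.
Qed.

Lemma trace_form_reg (e : homH reg reg) : t hreg e = trace_form (e (1 : H)).
Proof. by rewrite trace_formE -hom_reg_orb. Qed.

Variables (f : tens H H) (g : H) (gP : is_pivot Q f g).
Hypothesis t_mod : right_modified_trace gP t.

Lemma trace_formC x y : trace_form (x * y) = trace_form (y * x).
Proof. by rewrite !trace_formE -!orb_comp; exact: (trace_cyclic t_mod). Qed.
End TraceForm.

Section IntegralTrace.
Variables (f : tens H H) (g : H) (f_twist : drinfeld_twist Q f).
Variable gP : is_pivot Q f g.
Hypothesis H_unimodular : unimodular Q.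
Variables (L : H) (iL : left_integral Q L) (nzL : L != 0).

Let t0 := integral_trace gP L.
Let t0_mod : right_modified_trace gP t0 := integral_trace_modified f_twist gP H_unimodular iL nzL.

Lemma trace_form_nondegenerate a :
  (forall x, trace_form (integral_trace gP L) (x * a) = 0) -> a = 0.
Proof.
move=> a0; apply: (mu_nondegenerate (gP := gP) H_unimodular iL nzL) => y.
by rewrite -(integral_traceE gP L hreg) -trace_formE (trace_formC t0_mod) a0.
Qed.

(** Cyclicity moves every trace to the regular module. For a : M -> P, test maps factor through H
    and points of P are separated by maps to H; for b : P -> M, test maps come from functionals on M
    through the Frobenius form. *)
Lemma integral_trace_nondegenerate : nondegenerate_trace (integral_trace gP L).
Proof.
move=> M P hP; split=> [a|b] tr0; apply: homH_ext => x; rewrite zero_lfunE.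
  apply: (projective_separated hP) => b.
  apply: trace_form_nondegenerate => y; rewrite trace_formE.
  have := tr0 (compH (compH (orb x) (orbr y)) b).
  have -> : compH a (compH (compH (orb x) (orbr y)) b) =
      compH (compH a (compH (orb x) (orbr y))) b.
    by apply: homH_ext => p; rewrite !compHE.
  rewrite (trace_cyclic t0_mod hP hreg) => <-.
  congr (integral_trace gP L _ _); apply: homH_ext => h.
  by rewrite !compHE !orbE !homfP !regactE !mulrA.
rewrite (coord_vbasis (memvf (b x))) big1 // => i _.
(* The trace form of a(u) is the i-th coordinate of u, so a vanishing trace kills that coordinate of
   b x. *)
pose a := form_hom trace_form_nondegenerate (dualv i).
have := tr0 (compH (orb x) a).
have -> : compH (compH (orb x) a) b = compH (orb x) (compH a b).
  by apply: homH_ext => p; rewrite !compHE.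
rewrite -(trace_cyclic t0_mod hreg hP).
have -> : compH (compH a b) (orb x) = orbr (a (b x)).
  by apply: homH_ext => h; rewrite !compHE !orbE !homfP.
rewrite -trace_formE -[a (b x)]mul1r form_homE hact1E dualvE => ->.
by rewrite scale0r.
Qed.

End IntegralTrace.
End Nondegeneracy.

(** * Modified traces and cointegrals *)

Lemma dual_separated (K : fieldType) (V : vectType K) (u v : V) :
  (forall phi : 'Hom(V, K^o), phi u = phi v) -> u = v.
Proof.
move=> e; rewrite (coord_vbasis (memvf u)) (coord_vbasis (memvf v)).
by apply: eq_bigr => i _; have := e (linfun (coord (vbasis {:V}) i : V -> K^o)); rewrite !lfunE /= => ->.
Qed.

Lemma hatE (K : fieldType) (H : falgType K) (g : H) (lam : 'Hom(H, K^o)) h :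
  hat g lam h = lam (g * h).
Proof. by rewrite /hat comp_lfunE lfunE. Qed.

Section Cointegral.
Variables (K : fieldType) (H : falgType K) (Q : quasiHopf H).
Local Notation Δ := (Delta Q).
Local Notation S := (antip Q).
Local Notation T := ((antip Q)^-1)%VF.
Local Notation "V ⊠ W" := (tensM Q V W) (at level 40, left associativity).
Local Notation "V ^∨" := (dualM Q V) (at level 2, format "V ^∨").
Local Notation qR := (qR Q).
Local Notation reg := (regmod H).
Local Notation hreg := (@projective_regmod K H).
Local Notation orbr x := (@orb K H reg x).

Variables (f : tens H H) (g : H) (f_twist : drinfeld_twist Q f).
Variable gP : is_pivot Q f g.
Let f_unit := twist_unit f_twist.
Let f_antip := twist_antip f_twist.
Let f_alpha := twist_alpha f_twist.
Let gu := pivot_unit gP.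
Local Notation Utw := (Utw Q f).
Local Notation Vtw := (Vtw Q f).

Section OfTrace.
Variables (t : trace_family H) (t_mod : right_modified_trace gP t).
Local Notation ν := (trace_form t).

(* The trace of k = F ∘ r_x ∘ G computed by cyclicity, where Utw_zigzag applies,
   and by the partial trace property. *)
Lemma trace_form_qR x :
  tlift (fun p1 p2 => tlift (fun a b =>
    (ν (a * p1) : K) *: (S b * g * p2)) qR) (Δ x * Utw) =
  tlift (fun a b => (ν (T b * x) : K) *: a) f.
Proof.
apply: dual_separated => phi.
pose F : homH reg (reg ⊠ reg) := @orb _ _ (reg ⊠ reg) (extact reg reg Utw ((1 : H) ⊗ (1 : H))).
pose G : homH (reg ⊠ reg) reg := @genG K H Q reg phi.
pose k := compH F (compH (orbr x) G).
have hrr : projective (reg ⊠ reg) := tensM_projective hreg.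
have cyc : t hrr k = tlift (fun a b => (phi a : K) *: (ν (T b * x) : K^o)) f.
  rewrite (trace_cyclic t_mod hrr hreg) trace_form_reg 2!compHE orbE regactE.
  rewrite /F orb1 /G genG_elem.
  have Bl : bilin (fun p q : H => (phi (hact reg q (1 : H)) : K) *: p) by lin.
  rewrite (Utw_zigzag f_unit f_antip f_alpha Bl).
  rewrite (fun_tlift (f := fun z => ν (z * x))); last by lin.
  by apply: eq_tlift => a b; rewrite regactE mulr1 -scalerAl lfunZ.
have par : t hrr k = tlift (fun p1 p2 => tlift (fun a b =>
    (ν (a * p1) : K) *: (phi (S b * g * p2) : K^o)) qR) (Δ x * Utw).
  rewrite (trace_partial t_mod hreg) trace_form_reg ptraceE.
  have tc M N P (a : homH N P) (b : homH M N) z :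
      tensH Q (compH a b) (idH reg^∨) z = tensH Q a (idH reg^∨) (tensH Q b (idH reg^∨) z).
    by apply: contract_inj => w; rewrite !contract_tensH compHE.
  rewrite /k (tc _ _ _ F (compH (orbr x) G)) (tc _ _ _ (orbr x) G).
  (* G was obtained by uncurrying the orbit map of 1 ⊗ φ, so currying it back removes the
     coevaluation. *)
  have -> : tensH Q G (idH reg^∨) (coev_in Q reg reg (1 : H)) = (1 : H) ⊗ phi.
    have -> : tensH Q G (idH reg^∨) (coev_in Q reg reg (1 : H)) = curryH G (1 : H).
      by rewrite /curryH compHE.
    by rewrite /G /genG uncurryK orb1.
  rewrite !tensHE !idHE orbE regactE mul1r /F orbE tensME.
  rewrite -[extact _ _ (Δ x) _]comp_lfunE -extactM extactT pure_tliftl !lfun_tlift.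
  apply: eq_tlift => p1 p2; rewrite evR_inE tlift_qR; last by lin.
  rewrite lfun_tlift3; apply: eq_tlift3 => a b c.
  rewrite !regactE !mulr1 lfunZ !antipM (pivot_S2 gP) -!mulrA mulKr //.
  exact: mulrC.
rewrite !(fun_tlift (f := phi)); try by lin.
transitivity (t hrr k); [rewrite par | rewrite cyc].
  apply: eq_tlift => p1 p2; rewrite lfun_tlift.
  by apply: eq_tlift => a b; rewrite lfunZ.
by apply: eq_tlift => a b; rewrite lfunZ; exact: mulrC.
Qed.

Lemma antipV_pivot h : T h * g^-1 = g^-1 * S h.
Proof.
by rewrite -{2}[h](antipVK Q) (pivot_S2 gP) !mulrA mulVr // mul1r.
Qed.

(** [Vtw_qR] exposes [qR] and the legs of f^-1, so [trace_form_qR] applies at x = g^-1 S(b) h. It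
    returns the legs of f, and these combine with the outer ones to f^-1 f = 1. *)
Lemma trace_form_cointegral h :
  tlift (fun a b => (hat g^-1 ν a : K) *: b) (Vtw * Δ h * Utw) =
  (hat g^-1 ν h : K) *: (1 : H).
Proof.
have Bl : bilin (fun a b : H => (hat g^-1 ν a : K) *: b) by lin.
rewrite (Vtw_qR f_unit f_antip f_alpha gP).
rewrite (fun_tlift (f := fun z =>
  tlift (fun a b => (hat g^-1 ν a : K) *: b) (z * Δ h * Utw))); last by lin.
transitivity (tlift (fun a b => tlift (fun c d =>
    (hat g^-1 ν (S (b * d) * h) : K) *: (a * c)) f) f^-1); last first.
  have Bl' : bilin (fun a b : H => (hat g^-1 ν (S b * h) : K) *: a) by lin.
  by rewrite -(tliftM _ _ Bl') mulVr // tlift1 // antip1 mul1r.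
apply: eq_tlift => a b.
rewrite (fun_tlift (f := fun z =>
  tlift (fun a b => (hat g^-1 ν a : K) *: b) (z * Δ h * Utw))); last by lin.
transitivity (a * tlift (fun p1 p2 => tlift (fun q q' =>
    (ν (q * p1) : K) *: (S q' * g * p2)) qR) (Δ (g^-1 * S b * h) * Utw)).
  rewrite tlift_exchange (fun_tlift (f := fun z : H => a * z)); last by lin.
  apply: eq_tlift => q q'.
  rewrite -!mulrA [Δ _ * (_ * _)]mulrA -DeltaM -!mulrA tliftM // bilinE; last by lin.
  rewrite (fun_tlift (f := fun z : H => a * z)); last by lin.
  apply: eq_tlift => p1 p2.
  by rewrite hatE !mulrA mulVr // mul1r -scalerAr !mulrA.
rewrite trace_form_qR (fun_tlift (f := fun z : H => a * z)); last by lin.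
apply: eq_tlift => c d.
by rewrite hatE antipM !mulrA antipV_pivot -scalerAr.
Qed.
End OfTrace.
End Cointegral.

(** * The cointegrals form a line *)

Section CointegralSpace.
Variables (K : fieldType) (H : falgType K) (Q : quasiHopf H).
Local Notation Δ := (Delta Q).
Local Notation ε := (eps Q).
Local Notation Ψ := (Phi Q)^-1.
Local Notation S := (antip Q).
Local Notation T := ((antip Q)^-1)%VF.
Local Notation reg := (regmod H).

Lemma tswapM (x y : tens H H) : tswap (x * y) = tswap x * tswap y.
Proof.
move: x; apply: tlift_ext; [by rewrite /tswap; lin | by rewrite /tswap; lin |] => a b.
move: y; apply: tlift_ext; [by rewrite /tswap; lin | by rewrite /tswap; lin |] => c d.
by rewrite pureM !tswapE pureM.
Qed.

Lemma tlift_tswap (W : lmodType K) (B : H -> H -> W) x : bilin B ->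
  tlift B (tswap x) = tlift (fun a b => B b a) x.
Proof.
move=> Bl; rewrite {1}/tswap (fun_tlift (f := tlift B)); last by lin.
by apply: eq_tlift => a b; rewrite bilinE.
Qed.

Variables (f : tens H H) (g : H) (f_twist : drinfeld_twist Q f).
Variable gP : is_pivot Q f g.
Hypothesis H_unimodular : unimodular Q.
Let f_unit := twist_unit f_twist.
Let f_antip := twist_antip f_twist.
Lemma cop_tswap h :
  Vcop Q f * tswap (Δ h) * Ucop Q f = tswap (Vtw Q f * Δ h * Utw Q f).
Proof.
rewrite !tswapM; congr (_ * _ * _ * _).
  rewrite /SS; move: (pL Q); apply: tlift_ext; [by lin | by rewrite /tswap; lin |] => a b.
  by rewrite tmapE bilinE ?tswapE //; lin.
rewrite /Ucop /Utw /TT; move: (qL Q * f^-1).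
apply: tlift_ext; [by lin | by rewrite /tswap; lin |] => a b.
by rewrite tmapE bilinE ?tswapE //; lin.
Qed.

Local Notation Utw := (Utw Q f).
Local Notation Vtw := (Vtw Q f).

Definition cointegral_eqn (lam : 'Hom(H, K^o)) := forall h,
  tlift (fun a b => (lam a : K) *: b) (Vtw * Δ h * Utw) = (lam h : K) *: (1 : H).

Lemma modulus_eps (gam : {lrmorphism H -> K^o}) : is_modulus Q gam -> gam =1 ε.
Proof.
move=> mg h; have [L iL nzL] := integral_neq0_exists Q.
have := mg L iL h; rewrite (iffLR (H_unimodular L) iL) => /eqP.
by rewrite -subr_eq0 -scalerBl scaler_eq0 (negPf nzL) orbF subr_eq0 => /eqP.
Qed.

(** Unimodularity makes the modulus equal to ε, and then (id ⊗ id ⊗ ε)(Ψ) = 1 collapses the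
    right-hand side to lam(h) 1. Flipping the legs turns U^cop and V^cop into [Utw] and [Vtw]. *)
Lemma right_cointegralP lam : right_cointegral Q f lam <-> cointegral_eqn lam.
Proof.
have lhsE h : tlift (fun a b : H => (lam b : K) *: a)
      (Vcop Q f * tswap (Δ h) * Ucop Q f) =
    tlift (fun a b => (lam a : K) *: b) (Vtw * Δ h * Utw).
  by rewrite cop_tswap tlift_tswap //; lin.
have rhsE h : tlift3 (fun a b c : H =>
      ((ε c : K) * (lam (h * T b) : K)) *: a) Ψ = (lam h : K) *: (1 : H).
  have Bl : bilin (fun a b : H => (lam (h * T b) : K) *: a) by lin.
  have := PhiV_counit3 Q Bl; rewrite antipV1 mulr1 => <-.
  by apply: eq_tlift3 => a b c; rewrite scalerA.
split=> [[gam mg e] h|e].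
  rewrite -lhsE e -rhsE; apply: eq_tlift3 => a b c.
  by rewrite (modulus_eps mg).
exists ε => [L iL h|h]; first exact: (iffLR (H_unimodular L) iL).
by rewrite lhsE e rhsE.
Qed.

Lemma eps_antipV h : ε (T h) = ε h.
Proof. by rewrite -[in RHS](antipVK Q h) eps_antip. Qed.

Section Unique.
Variables (L : H) (iL : left_integral Q L) (nzL : L != 0).
Local Notation t0 := (integral_trace gP L).
Local Notation λ0 := (hat g^-1 (trace_form t0)).
Let t0_mod : right_modified_trace gP t0 :=
  integral_trace_modified f_twist gP H_unimodular iL nzL.

Lemma cointegral0_eqn : cointegral_eqn λ0.
Proof. exact: (trace_form_cointegral f_twist t0_mod). Qed.

Lemma cointegral0_nondegenerate a : (forall x, λ0 (x * a) = 0) -> a = 0.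
Proof.
move=> a0; apply: (trace_form_nondegenerate f_twist (gP := gP) H_unimodular iL nzL) => x.
by have := a0 (g * x); rewrite hatE -mulrA mulKr // (pivot_unit gP).
Qed.

(** As λ0(x L) = ε(x) λ0(L), vanishing at L would put L in the radical of a nondegenerate form. *)
Lemma cointegral0_integral : λ0 L != 0.
Proof.
apply: contra nzL => /eqP l0; apply/eqP; apply: cointegral0_nondegenerate => x.
by rewrite iL lfunZ l0 scaler0.
Qed.

(* Write lam = λ0 (- a).  Then λ0 applied to the first leg of Vtw Δ(L) Utw (a ⊗ 1)
   is lam L = 0, but Utw_cov turns a ⊗ 1 into 1 ⊗ S a, which gives λ0 L S a. *)
Lemma cointegral_integral_eq0 lam : cointegral_eqn lam -> lam L = 0 -> lam = 0.
Proof.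
move=> el l0; have [a ea] := form_repr cointegral0_nondegenerate lam.
suff a0 : a = 0 by apply/lfunP => x; rewrite ea a0 mulr0 linear0 zero_lfunE.
have Bl : bilin (fun x y : H => (λ0 x : K) *: y) by lin.
have e1 : tlift (fun x y : H => (λ0 x : K) *: y) (Vtw * Δ L * Utw * (a ⊗ 1)) = 0.
  rewrite tliftM //; transitivity (tlift (fun x y => (lam x : K) *: y) (Vtw * Δ L * Utw)).
    apply: eq_tlift => x y; rewrite bilinE; last by lin.
    by rewrite ea mulr1.
  by rewrite el l0 scale0r.
have e2 : tlift (fun x y : H => (λ0 x : K) *: y) (Vtw * Δ L * Utw * (a ⊗ 1)) =
    (λ0 L : K) *: S a.
  have <- : tlift (fun x y : H => (λ0 x : K) *: y) (Vtw * Δ L * Utw * (1 ⊗ S a)) =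
    (λ0 L : K) *: S a.
    rewrite tliftM //; transitivity ((tlift (fun x y => (λ0 x : K) *: y) (Vtw * Δ L * Utw)) * S a).
      rewrite (fun_tlift (f := fun z : H => z * S a)); last by lin.
      apply: eq_tlift => x y; rewrite bilinE; last by lin.
      by rewrite mulr1 -scalerAl.
    by rewrite cointegral0_eqn -scalerAl mul1r.
  rewrite -[a in LHS](antipK Q) -!mulrA -(Utw_cov f_unit f_antip) !mulrA.
  rewrite (fun_tlift (f := fun z => tlift (fun x y => (λ0 x : K) *: y) (Vtw * Δ L * z))); last by lin.
  rewrite -[S a in RHS](counit_r Q (F := fun h => h)); last by lin.
  rewrite (fun_tlift (f := fun z => tlift (fun x y => (λ0 x : K) *: y)
    (Vtw * Δ L * Utw * (1 ⊗ z)))); last by lin.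
  apply: eq_tlift => h1 h2.
  (* Since L is a right integral, Δ(L) swallows Δ(T(h2)) up to ε(h2), and the counit then recombines
     h1 into S(a). *)
  have -> : Vtw * Δ L * (Δ (T h2) * Utw * (1 ⊗ h1)) =
      (ε h2 : K) *: (Vtw * Δ L * Utw * (1 ⊗ h1)).
    rewrite !mulrA -(mulrA Vtw) -DeltaM (iffLR (H_unimodular L) iL) eps_antipV.
    by rewrite linearZ /= -scalerAr -!scalerAl.
  by rewrite linearZ /= pureZr -scalerAr linearZ.
have /eqP := etrans (esym e2) e1.
rewrite scaler_eq0 (negPf cointegral0_integral) /= => /eqP e.
by rewrite -[a](antipK Q) e linear0.
Qed.

Lemma cointegral_unique lam : cointegral_eqn lam -> exists c : K, lam = c *: λ0.
Proof.
move=> el; exists ((lam L : K) / (λ0 L : K)); apply/eqP; rewrite -subr_eq0; apply/eqP.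
set c := _ / _; apply: cointegral_integral_eq0 => [h|].
  transitivity (tlift (fun a b => (- c) *: ((λ0 a : K) *: b) + (lam a : K) *: b) (Vtw * Δ h * Utw)).
    apply: eq_tlift => a b.
    by rewrite add_lfunE opp_lfunE scale_lfunE scalerBl scaleNr scalerA addrC.
  rewrite tliftP el cointegral0_eqn add_lfunE opp_lfunE scale_lfunE scalerBl.
  by rewrite scaleNr scalerA addrC.
rewrite add_lfunE opp_lfunE scale_lfunE -[X in _ - X]/((c : K) * (λ0 L : K)).
by rewrite /c mulfVK ?subrr // cointegral0_integral.
Qed.
End Unique.
End CointegralSpace.

(** * Modified traces form a line, and the correspondence *)

Section TraceSpace.
Variables (K : fieldType) (H : falgType K) (Q : quasiHopf H).
Local Notation "V ⊠ W" := (tensM Q V W) (at level 40, left associativity).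
Local Notation reg := (regmod H).
Local Notation hreg := (@projective_regmod K H).
Variables (f : tens H H) (g : H) (gP : is_pivot Q f g).

Lemma homf_sum (M N : hmod H) (I : finType) (k : I -> homH M N) x :
  (\sum_i k i : homH M N) x = \sum_i k i x.
Proof.
have l : linear (fun k : homH M N => k x).
  by move=> c k1 k2; rewrite homf_linear add_lfunE scale_lfunE.
exact: (fun_sum (f := fun k : homH M N => k x)).
Qed.

(** Equality of whole families is proved, as unique existence of a trace demands; hence
    extensionality in the module and in the proof of projectivity. *)
Lemma trace_determined (t t' : trace_family H) :
    right_modified_trace gP t -> right_modified_trace gP t' ->
  (forall e, t reg hreg e = t' reg hreg e) -> t = t'.
Proof.
move=> t_mod t'_mod e.
have rp (V : hmod H) (k : homH (reg ⊠ V) (reg ⊠ V)) (hV : projective (reg ⊠ V)) :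
    t _ hV k = t' _ hV k.
  have -> : k = \sum_(i < \dim {:V})
      compH (genF Q (vbasis {:V})`_i) (compH (genG Q (dualv i)) k).
    apply: homH_ext => x; rewrite homf_sum -[LHS](genFG (Q := Q)).
    by apply: eq_bigr => i _; rewrite !compHE.
  rewrite !linear_sum /=; apply: eq_bigr => i _.
  by rewrite (trace_cyclic t_mod hV hreg) (trace_cyclic t'_mod hV hreg) e.
apply: functional_extensionality_dep => P.
apply: functional_extensionality_dep => hP; apply/lfunP => k.
have [p [s ps]] := projective_section Q hP.
have hV : projective (reg ⊠ P) := tensM_projective hreg.
have -> : k = compH p (compH s k).
  by apply: homH_ext => x; rewrite -[LHS]idHE -ps !compHE.
by rewrite (trace_cyclic t_mod hP hV) (trace_cyclic t'_mod hP hV) rp.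
Qed.

Definition scale_trace (c : K) (t : trace_family H) : trace_family H :=
  fun P hP => c *: t P hP.

Lemma scale_trace_modified c t :
  right_modified_trace gP t -> right_modified_trace gP (scale_trace c t).
Proof.
move=> t_mod; split=> [P P' hP hP' a b|P V hP hPV k]; rewrite !scale_lfunE.
  by rewrite (trace_cyclic t_mod hP hP').
by rewrite (trace_partial t_mod hP).
Qed.

Lemma trace_form_scale c t : trace_form (scale_trace c t) = c *: trace_form t.
Proof. by apply/lfunP => x; rewrite scale_lfunE !trace_formE scale_lfunE. Qed.

Lemma hat_invK (lam : 'Hom(H, K^o)) : hat g (hat g^-1 lam) = lam.
Proof.
by apply/lfunP => x; rewrite !hatE mulKr // (pivot_unit gP).
Qed.
Lemma hatK (lam : 'Hom(H, K^o)) : hat g^-1 (hat g lam) = lam.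
Proof.
by apply/lfunP => x; rewrite !hatE mulVKr // (pivot_unit gP).
Qed.

Lemma trace_form_hat (t : trace_family H) lam :
  (forall e : homH reg reg, t reg hreg e = hat g lam (e (1 : H))) ->
  lam = hat g^-1 (trace_form t).
Proof.
move=> e; rewrite -[LHS]hatK; congr (hat _ _); apply/lfunP => x.
by rewrite trace_formE e orb1.
Qed.

Hypothesis f_twist : drinfeld_twist Q f.
Hypothesis H_unimodular : unimodular Q.
Variables (L : H) (iL : left_integral Q L) (nzL : L != 0).
Local Notation t0 := (integral_trace gP L).

(** The cointegral of t is a multiple of λ0, and t is recovered from its cointegral, so the same
    scalar relates the traces. *)
Lemma modified_trace_scale t : right_modified_trace gP t ->
  exists c : K, t = scale_trace c t0.
Proof.
move=> t_mod; have t0_mod := integral_trace_modified f_twist gP H_unimodular iL nzL.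
have [c ec] := cointegral_unique f_twist gP H_unimodular iL nzL
  (trace_form_cointegral f_twist t_mod).
exists c; apply: trace_determined => // [|e].
  exact: scale_trace_modified.
rewrite !trace_form_reg trace_form_scale; congr (fun_of_lfun _ _).
rewrite -[LHS]hat_invK ec; apply/lfunP => x.
by rewrite hatE !scale_lfunE hatE mulKr // (pivot_unit gP).
Qed.

Lemma integral_trace_nonzero : nonzero_trace t0.
Proof.
exists reg, hreg, (@orb K H reg (g^-1 * L)); rewrite -trace_formE -hatE.
by apply/eqP; apply: cointegral0_integral.
Qed.
End TraceSpace.

Unset Implicit Arguments.
Set Strict Implicit.
Set Printing Implicit Defensive.

Theorem theorem1p1 (K : fieldType) (H : falgType K) (Q : quasiHopf H)
    (f : tens H H) (f_twist : drinfeld_twist Q f)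
    (g : H) (g_pivot : is_pivot Q f g) (H_unimodular : unimodular Q) :
  let mtrace := @right_modified_trace K H Q f g g_pivot in
  let corresponds (t : trace_family H) (lam : 'Hom(H, K^o)) :=
    forall e : homH (regmod H) (regmod H),
      t (regmod H) (@projective_regmod K H) e = hat g lam (e (1 : H)) in
  [/\ forall t, mtrace t ->
        exists! lam, right_cointegral Q f lam /\ corresponds t lam,
      forall lam, right_cointegral Q f lam ->
        exists! t, mtrace t /\ corresponds t lam,
      exists t, [/\ mtrace t, nonzero_trace t
        & forall t', mtrace t' -> exists c : K,
            forall P (hP : projective P) (k : homH P P),
              t' P hP k = (c * t P hP k :> K)]
    & forall t, mtrace t -> nonzero_trace t -> nondegenerate_trace t].
Proof.
move=> mtr corr; have [L iL nzL] := integral_neq0_exists Q.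
have t0_mod := integral_trace_modified f_twist g_pivot H_unimodular iL nzL.
split.
- move=> t t_mod; exists (hat g^-1 (trace_form t)); split.
    split; first by apply/(right_cointegralP _ H_unimodular)/(trace_form_cointegral f_twist t_mod).
    by move=> e; rewrite (hat_invK g_pivot) trace_form_reg.
  by move=> lam [_ /(trace_form_hat g_pivot) ->].
- move=> lam /(right_cointegralP _ H_unimodular)/
    (cointegral_unique f_twist g_pivot H_unimodular iL nzL)[c ->].
  have ct_mod := scale_trace_modified c t0_mod.
  exists (scale_trace c (integral_trace g_pivot L)); split.
    split=> // e; rewrite trace_form_reg trace_form_scale.
    by rewrite hatE !scale_lfunE hatE mulKr // (pivot_unit g_pivot).
  move=> t [t_mod et]; apply: (trace_determined ct_mod t_mod) => e.
  rewrite [RHS]et trace_form_reg trace_form_scale.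
  by rewrite hatE !scale_lfunE hatE mulKr // (pivot_unit g_pivot).
- exists (integral_trace g_pivot L); split=> //.
    exact: (integral_trace_nonzero g_pivot f_twist H_unimodular iL nzL).
  move=> t' t'_mod.
  have [c ->] := modified_trace_scale f_twist H_unimodular iL nzL t'_mod.
  by exists c => P hP k; rewrite scale_lfunE.
move=> t t_mod.
have [c ->] := modified_trace_scale f_twist H_unimodular iL nzL t_mod.
(* A single nonzero value of t forces the scalar c to be nonzero, and then the pairings of t and of
   the integral trace have the same radicals. *)
move=> [P [hP [k]]]; rewrite scale_lfunE => nz M P' hP'.
have nzc : c != 0 by apply/eqP => c0; apply: nz; rewrite c0 scale0r.
have [nd1 nd2] := integral_trace_nondegenerate f_twist g_pivot H_unimodular iL nzL M hP'.
split=> [a|b] h; [apply: nd1 => b | apply: nd2 => a];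
  [have := h b | have := h a]; rewrite scale_lfunE => /eqP.
  by rewrite scaler_eq0 (negPf nzc) => /eqP.
by rewrite scaler_eq0 (negPf nzc) => /eqP.
Qed.
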